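(* The superalgebra ${\cal U}_{\mathsf h}(sl(2|1))$ admits a Hopf superalgebra structure with coproduct $\Delta$, antipode $S$ and counit $\epsilon$ determined by \begin{align*} &\Delta(H_1)=H_1\otimes T+T^{-1}\otimes H_1,\quad \Delta(T^{\pm1})=T^{\pm1}\otimes T^{\pm1},\quad \Delta(F_1)=F_1\otimes T+T^{-1}\otimes F_1,\\ &S(H_1)=-TH_1T^{-1},\quad S(T^{\pm1})=T^{\mp1},\quad S(F_1)=-TF_1T^{-1},\quad \epsilon(H_1)=\epsilon(F_1)=0,\quad \epsilon(T^{\pm1})=1,\\ &\Delta(E_2)=E_2\otimes T^{1/2}+T^{-1/2}\otimes E_2+\tfrac{\mathsf h}{4}T^{-1}E_3\otimes\left(T^{-1/2}H_1+H_1T^{-1/2}\right)-\tfrac{\mathsf h}{4}\left(T^{1/2}H_1+H_1T^{1/2}\right)\otimes TE_3,\\ &\Delta(F_2)=F_2\otimes T^{-1/2}+T^{1/2}\otimes F_2,\quad \Delta(E_3)=E_3\otimes T^{-1/2}+T^{1/2}\otimes E_3,\\ &\Delta(F_3)=F_3\otimes T^{1/2}+T^{-1/2}\otimes F_3-\tfrac{\mathsf h}{4}T^{-1}F_2\otimes\left(T^{-1/2}H_1+H_1T^{-1/2}\right)+\tfrac{\mathsf h}{4}\left(T^{1/2}H_1+H_1T^{1/2}\right)\otimes TF_2,\\ &\Delta(H_2)=H_2\otimes1+1\otimes H_2+\tfrac14TH_1\otimes(1-T^2)+\tfrac14(1-T^{-2})\otimes T^{-1}H_1,\\ &\Delta(H_3)=H_3\otimes1+1\otimes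 H_3-\tfrac14TH_1\otimes(1-T^2)-\tfrac14(1-T^{-2})\otimes T^{-1}H_1,\\ &S(E_2)=-E_2-\tfrac{\mathsf h}{2}(T+T^{-1})E_3,\quad S(F_3)=-F_3+\tfrac{\mathsf h}{2}(T+T^{-1})F_2,\\ &S(F_2)=-F_2,\quad S(E_3)=-E_3,\\ &S(H_2)=-H_2+\tfrac12(T^{-2}-1),\quad S(H_3)=-H_3-\tfrac12(T^{-2}-1),\\ &\epsilon(H_2)=\epsilon(H_3)=\epsilon(E_2)=\epsilon(F_2)=\epsilon(E_3)=\epsilon(F_3)=0. \end{align*}
   Context: Let $a_{11}=2$, $a_{12}=a_{21}=-1$, $a_{22}=0$. ${\cal U}(sl(2|1))$ is the associative superalgebra over $\mathbb C$ generated by $h_i,e_i,f_i$ ($i=1,2$), with $e_2,f_2$ odd and the other generators even, subject to $[h_i,h_j]=0$, $[h_i,e_j]=a_{ij}e_j$, $[h_i,f_j]=-a_{ij}f_j$, $[e_i,f_j]=\delta_{ij}h_i$, $[e_2,e_2]=[f_2,f_2]=0$, $[e_1,[e_1,e_2]]=[f_1,[f_1,f_2]]=0$, where $[a,b]=ab-(-1)^{\deg(a)\deg(b)}ba$ is the $\mathbb Z_2$-graded commutator. Put $e_3=e_1e_2-e_2e_1$, $f_3=f_2f_1-f_1f_2$, $h_3=h_1+h_2$. Let $\mathsf h$ be the deformation parameter; all expressions are understood as formal power series in $\mathsf h$, i.e. in ${\cal U}(sl(2|1))[[\mathsf h]]$ and its completed tensor powers; $T^{\pm1/2}$ is the power-series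 square root of $T^{\pm1}$ with constant term $1$. Define \begin{align*} &T^{\pm1}=\pm\mathsf h e_1+\sqrt{1+\mathsf h^2e_1^2},\quad H_1=\sqrt{1+\mathsf h^2e_1^2}\,h_1,\quad F_1=f_1-\tfrac{\mathsf h^2}{4}e_1(h_1^2-1),\\ &H_2=h_2-\tfrac{\mathsf h^2}{2}e_1^2h_1,\quad E_2=e_2-\tfrac{\mathsf h^2}{4}e_1e_3(2h_1+1),\quad F_2=f_2,\\ &H_3=h_3+\tfrac{\mathsf h^2}{2}e_1^2h_1,\quad E_3=e_3,\quad F_3=f_3+\tfrac{\mathsf h^2}{4}e_1f_2(2h_1+1). \end{align*} ${\cal U}_{\mathsf h}(sl(2|1))$ denotes the superalgebra ${\cal U}(sl(2|1))[[\mathsf h]]$ described through these deformed generators ($E_2,F_2,E_3,F_3$ odd, the others even). Tensor products are multiplied by $(a\otimes b)(c\otimes d)=(-1)^{\deg(b)\deg(c)}ac\otimes bd$; $\Delta$ and $\epsilon$ are superalgebra homomorphisms and $S$ is a graded antihomomorphism, $S(ab)=(-1)^{\deg(a)\deg(b)}S(b)S(a)$. *)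

(* Defs.v *)
From HB Require Import structures.
From mathcomp Require Import all_boot all_order all_algebra.
From mathcomp Require Import boolp classical_sets reals complex.

Set Implicit Arguments.
Unset Strict Implicit.
Unset Printing Implicit Defensive.

Import Order.TTheory GRing.Theory Num.Theory.
Local Open Scope quotient_scope.
Local Open Scope ring_scope.

(* A Z/2-grading is given by its projections: spart d x is the component of
   degree d of x, with d = true the odd degree; degrees add by (+). *)
HB.mixin Record Algebra_isSuper (k : comNzRingType) A
    of GRing.Algebra k A := {
  spart : bool -> A -> A;
  spart_is_linear : forall d, linear (spart d);
  spart_sum : forall x, spart false x + spart true x = x;
  spartK : forall d d' x,
    spart d (spart d' x) = if d == d' then spart d' x else 0;
  spartM : forall d d' x y,
    spart (d (+) d') (spart d x * spart d' y) = spart d x * spart d' y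
}.
#[short(type="superAlgType")]
HB.structure Definition SuperAlg (k : comNzRingType) :=
  {A of GRing.Algebra k A & Algebra_isSuper k A}.

HB.instance Definition _ (k : comNzRingType) (A : superAlgType k) d :=
  GRing.isLinear.Build k A A *:%R (@spart k A d) (spart_is_linear d).

Definition homogeneous (k : comNzRingType) (A : superAlgType k) (d : bool)
  (x : A) : Prop := spart d x = x.

(* The ground ring is a purely even superalgebra over itself. *)
Section RegularSuper.
Variable k : comNzRingType.

Definition regular_spart (d : bool) (x : k^o) : k^o := if d then 0 else x.

Fact regular_spart_is_linear d : linear (regular_spart d).
Proof. by case: d => c x y //=; rewrite scaler0 addr0. Qed.
Fact regular_spart_sum x : regular_spart false x + regular_spart true x = x.
Proof. exact: addr0. Qed.
Fact regular_spartK d d' x : regular_spart d (regular_spart d' x)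
  = if d == d' then regular_spart d' x else 0.
Proof. by case: d d' => [] []. Qed.
Fact regular_spartM d d' x y :
  regular_spart (d (+) d') (regular_spart d x * regular_spart d' y)
  = regular_spart d x * regular_spart d' y.
Proof. by case: d d' => [] [] //=; rewrite ?mul0r ?mulr0. Qed.

HB.instance Definition _ := Algebra_isSuper.Build k k^o regular_spart_is_linear
  regular_spart_sum regular_spartK regular_spartM.
End RegularSuper.

Lemma asbool_equiv_class (T : Type) (r : T -> T -> Prop) :
  (forall x, r x x) -> (forall x y, r x y -> r y x) ->
  (forall x y z, r x y -> r y z -> r x z) ->
  equiv_class_of (fun x y : {classic T} => `[< r x y >]).
Proof.
move=> rr rs rt; split => [x|x y|y x z]; first exact/asboolP.
- by apply/asboolP/asboolP => /rs.
- by move=> /asboolP xy /asboolP yz; apply/asboolP; apply: rt xy yz.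
Qed.

(* Tensor product of modules: formal linear combinations of symbols a (x) b
   modulo the module axioms and bilinearity. *)
Section Tensor.
Variables (k : comNzRingType) (A B : lmodType k).

Inductive tterm : Type :=
  | TZero | TPure of A & B | TAdd of tterm & tterm | TScale of k & tterm.

Inductive teqv : tterm -> tterm -> Prop :=
  | teqv_refl s : teqv s s
  | teqv_sym s t : teqv s t -> teqv t s
  | teqv_trans s t u : teqv s t -> teqv t u -> teqv s u
  | teqv_congD s s' t t' :
      teqv s s' -> teqv t t' -> teqv (TAdd s t) (TAdd s' t')
  | teqv_congZ c s s' : teqv s s' -> teqv (TScale c s) (TScale c s')
  | teqv_addA s t u : teqv (TAdd s (TAdd t u)) (TAdd (TAdd s t) u)
  | teqv_addC s t : teqv (TAdd s t) (TAdd t s)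
  | teqv_add0 s : teqv (TAdd TZero s) s
  | teqv_addN s : teqv (TAdd (TScale (-1) s) s) TZero
  | teqv_scaleA c d s : teqv (TScale c (TScale d s)) (TScale (c * d) s)
  | teqv_scale1 s : teqv (TScale 1 s) s
  | teqv_scaleDr c s t :
      teqv (TScale c (TAdd s t)) (TAdd (TScale c s) (TScale c t))
  | teqv_scaleDl c d s :
      teqv (TScale (c + d) s) (TAdd (TScale c s) (TScale d s))
  | teqv_pureDl a a' b : teqv (TPure (a + a') b) (TAdd (TPure a b) (TPure a' b))
  | teqv_pureDr a b b' : teqv (TPure a (b + b')) (TAdd (TPure a b) (TPure a b'))
  | teqv_pureZl c a b : teqv (TPure (c *: a) b) (TScale c (TPure a b))
  | teqv_pureZr c a b : teqv (TPure a (c *: b)) (TScale c (TPure a b)).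

Definition teqv_rel : equiv_rel {classic tterm} :=
  EquivRelPack (asbool_equiv_class teqv_refl teqv_sym teqv_trans).

Definition tens : Type := {eq_quot teqv_rel}.

Definition tpi (s : tterm) : tens := \pi_({eq_quot teqv_rel}) s.
Definition trepr (x : tens) : tterm := repr (x : {eq_quot teqv_rel}).

Lemma treprK : cancel trepr tpi. Proof. exact: reprK. Qed.
Lemma tpiP s t : tpi s = tpi t <-> teqv s t.
Proof.
split; first by move=> /eqmodP/asboolP.
by move=> st; apply/eqmodP/asboolP.
Qed.
Lemma trepr_pi s : teqv (trepr (tpi s)) s.
Proof. by apply/tpiP; rewrite treprK. Qed.

HB.instance Definition _ := Choice.on tens.

Definition tadd x y := locked (tpi (TAdd (trepr x) (trepr y))).
Definition tscale c x := locked (tpi (TScale c (trepr x))).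
Definition topp := tscale (-1).
Definition tpure a b : tens := tpi (TPure a b).

Lemma tpiD s t : tpi (TAdd s t) = tadd (tpi s) (tpi t).
Proof. by rewrite /tadd -lock; apply/tpiP/teqv_sym/teqv_congD; apply: trepr_pi. Qed.
Lemma tpiZ c s : tpi (TScale c s) = tscale c (tpi s).
Proof. by rewrite /tscale -lock; apply/tpiP/teqv_sym/teqv_congZ; apply: trepr_pi. Qed.

Local Ltac tsolve l := repeat move=> ?; rewrite /topp; repeat match goal with x : tens |- _ =>
  rewrite -(treprK x); move: (trepr x) => {}x end;
  do 3 rewrite -?tpiD -?tpiZ; apply/tpiP; exact: l.

Fact taddA : associative tadd. Proof. tsolve teqv_addA. Qed.
Fact taddC : commutative tadd. Proof. tsolve teqv_addC. Qed.
Fact tadd0 : left_id (tpi TZero) tadd. Proof. tsolve teqv_add0. Qed.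
Fact taddN : left_inverse (tpi TZero) topp tadd.
Proof. tsolve teqv_addN. Qed.
HB.instance Definition _ :=
  GRing.isZmodule.Build tens taddA taddC tadd0 taddN.

Lemma taddE (x y : tens) : x + y = tadd x y. Proof. by []. Qed.

Fact tscaleA c d x : tscale c (tscale d x) = tscale (c * d) x.
Proof. tsolve teqv_scaleA. Qed.
Fact tscale1 : left_id 1 tscale. Proof. tsolve teqv_scale1. Qed.
Fact tscaleDr : right_distributive tscale +%R.
Proof. by move=> c x y; rewrite !taddE; tsolve teqv_scaleDr. Qed.
Fact tscaleDl x : {morph tscale^~ x : c d / c + d}.
Proof. move=> c d; rewrite taddE; tsolve teqv_scaleDl. Qed.
HB.instance Definition _ := GRing.Zmodule_isLmodule.Build k tens
  tscaleA tscale1 tscaleDr tscaleDl.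

Lemma tpureDl a a' b : tpure (a + a') b = tpure a b + tpure a' b.
Proof. rewrite taddE -tpiD; exact/tpiP/teqv_pureDl. Qed.
Lemma tpureDr a b b' : tpure a (b + b') = tpure a b + tpure a b'.
Proof. rewrite taddE -tpiD; exact/tpiP/teqv_pureDr. Qed.
Lemma tpureZl c a b : tpure (c *: a) b = c *: tpure a b.
Proof. rewrite -[RHS]/(tscale _ _) -tpiZ; exact/tpiP/teqv_pureZl. Qed.
Lemma tpureZr c a b : tpure a (c *: b) = c *: tpure a b.
Proof. rewrite -[RHS]/(tscale _ _) -tpiZ; exact/tpiP/teqv_pureZr. Qed.
Lemma tpure0l b : tpure 0 b = 0.
Proof. by rewrite -(scale0r 0) tpureZl scale0r. Qed.
Lemma tpure0r a : tpure a 0 = 0.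
Proof. by rewrite -(scale0r 0) tpureZr scale0r. Qed.

Lemma tens_ind (P : tens -> Prop) :
  (forall a b, P (tpure a b)) -> (forall x y, P x -> P y -> P (x + y)) ->
  forall x, P x.
Proof.
move=> Pp PD x; rewrite -(treprK x) -[tpi _]scale1r.
elim: (trepr x) (1 : k) => [|a b|s IHs t IHt|c s IHs] d.
- rewrite [X in P X](_ : _ = tpure 0 0) //.
  by rewrite (_ : tpi TZero = 0) // scaler0 tpure0l.
- by rewrite -[tpi _]/(tpure a b) -tpureZl.
- rewrite (_ : tpi (TAdd s t) = tpi s + tpi t); last exact: tpiD.
  by rewrite scalerDr; apply: PD.
- rewrite (_ : tpi (TScale c s) = c *: tpi s); last exact: tpiZ.
  by rewrite scalerA.
Qed.

Section Lift.
Variables (M : lmodType k) (f : A -> B -> M).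

Definition bilin : Prop :=
  (forall b, linear (f^~ b)) /\ (forall a, linear (f a)).

Fixpoint teval (s : tterm) : M :=
  match s with
  | TZero => 0
  | TPure a b => f a b
  | TAdd s t => teval s + teval t
  | TScale c s => c *: teval s
  end.

(* The linear map tens -> M induced by f, when f is bilinear. *)
Definition tlift (x : tens) : M := teval (trepr x).

Hypothesis fP : bilin.

Lemma teval_teqv s t : teqv s t -> teval s = teval t.
Proof.
case: fP => fl fr.
have fDl a a' b : f (a + a') b = f a b + f a' b.
  by rewrite -[a]scale1r (fl b) !scale1r.
have fDr a b b' : f a (b + b') = f a b + f a b'.
  by rewrite -[b]scale1r (fr a) !scale1r.
have f0l b : f 0 b = 0 by apply: (addrI (f 0 b)); rewrite -fDl !addr0.
have f0r a : f a 0 = 0 by apply: (addrI (f a 0)); rewrite -fDr !addr0.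
elim=> //=.
- by move=> {}s {}t u _ -> _.
- by move=> s1 s2 t1 t2 _ -> _ ->.
- by move=> c s1 s2 _ ->.
- by move=> *; rewrite addrA.
- by move=> *; rewrite addrC.
- by move=> *; rewrite add0r.
- by move=> *; rewrite scaleN1r addNr.
- by move=> *; rewrite scalerA.
- by move=> *; rewrite scale1r.
- by move=> *; rewrite scalerDr.
- by move=> *; rewrite scalerDl.
- by move=> c a b; rewrite -[c *: a]addr0 (fl b) f0l addr0.
- by move=> c a b; rewrite -[c *: b]addr0 (fr a) f0r addr0.
Qed.

Lemma tliftE a b : tlift (tpure a b) = f a b.
Proof. exact: (teval_teqv (trepr_pi (TPure a b))). Qed.

Lemma tlift_is_linear : linear tlift.
Proof.
move=> c x y; rewrite -{1}(treprK x) -{1}(treprK y).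
have -> : c *: tpi (trepr x) + tpi (trepr y)
  = tpi (TAdd (TScale c (trepr x)) (trepr y)).
  by rewrite tpiD tpiZ.
exact: (teval_teqv (trepr_pi _)).
Qed.

Lemma tliftD x y : tlift (x + y) = tlift x + tlift y.
Proof. by rewrite -[x]scale1r tlift_is_linear !scale1r. Qed.
Lemma tlift0 : tlift 0 = 0.
Proof. by apply: (addrI (tlift 0)); rewrite -tliftD !addr0. Qed.
Lemma tliftZ c x : tlift (c *: x) = c *: tlift x.
Proof. by rewrite -[c *: x]addr0 tlift_is_linear tlift0 addr0. Qed.
End Lift.
End Tensor.
Notation "a *t b" := (tpure a b) (at level 40, left associativity) : ring_scope.
Arguments tpure {k A B}.

(* Linear functionals separate points; used for 1 != 0 in tensor products. *)
Lemma separating_functional (k : fieldType) (V : lmodType k) (v : V) :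
  v <> 0 -> exists phi : V -> k^o, linear phi /\ phi v = 1.
Proof.
move=> v0.
pose closed (W : set V) := forall (c : k) x y, W x -> W y -> W (c *: x + y).
pose P (W : set V) := closed W /\ ~ W v.
have [F FP Ftot|A [[Acl Av] Amax]] := @Zorn_bigcup V P.
  split=> [c x y [X FX Xx] [Y FY Yy]|[X FX Xv]]; last by have [] := FP X FX.
  have [XY|YX] := Ftot _ _ FX FY.
    by exists Y => //; apply: (FP Y FY).1 => //; apply: XY.
  by exists X => //; apply: (FP X FX).1 => //; apply: YX.
have A0 : A 0.
  apply: contrapT => nA0; apply: (Amax (fun x => x = 0)); last first.
    by split=> [c x y -> ->|//]; rewrite scaler0 addr0.
  split=> [|/(_ 0 erefl)//] x Ax; exfalso; apply: nA0.
  by rewrite -(addNr x) -scaleN1r; apply: Acl.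
have AZ c x : A x -> A (c *: x) by move=> Ax; rewrite -[_ *: _]addr0; apply: Acl.
have AD x y : A x -> A y -> A (x + y).
  by move=> ? ?; rewrite -[x]scale1r; apply: Acl.
have Adec x : exists c, A (x - c *: v).
  apply: contrapT => nx.
  pose B y := exists c, A (y - c *: x).
  have Ax : ~ A x by move=> Ax; apply: nx; exists 0; rewrite scale0r subr0.
  apply: (Amax B).
    split=> [y Ay|BA]; first by exists 0; rewrite scale0r subr0.
    by apply/Ax/BA; exists 1; rewrite scale1r subrr.
  split=> [c y z [d yd] [e ze]|[d vd]].
    exists (c * d + e); rewrite scalerDl opprD addrACA -scalerA -scalerBr.
    exact: Acl.
  have [d0|d0] := eqVneq d 0.
    by apply: Av; move: vd; rewrite d0 scale0r subr0.
  apply: nx; exists d^-1; have := AZ (- d^-1) _ vd.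
  by rewrite scalerBr scalerA !scaleNr mulNr mulVf// scaleN1r opprK addrC.
pose phi x : k^o := xget 0 (fun c => A (x - c *: v)).
have phiP x : A (x - phi x *: v).
  exact: (@xgetPex _ 0 (fun c : k^o => A (x - c *: v)) (Adec x)).
have phiE x c : A (x - c *: v) -> phi x = c.
  move=> xc; apply: contrapT => /eqP ne; apply: Av.
  have ne0 : c - phi x != 0 by rewrite subr_eq0 eq_sym.
  rewrite -[v]scale1r -(mulVf ne0) -scalerA; apply/AZ.
  have -> : (c - phi x) *: v = (x - phi x *: v) + -1 *: (x - c *: v).
    by rewrite scaleN1r opprB [RHS]addrC addrA subrK scalerBl.
  by apply/AD => //; apply/AZ.
exists phi; split=> [c x y|]; apply: phiE; last by rewrite scale1r subrr.
rewrite scalerDl opprD addrACA -scalerA -scalerBr; exact: Acl.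
Qed.

Lemma tpure_neq0 (k : fieldType) (A B : lmodType k) (a : A) (b : B) :
  a <> 0 -> b <> 0 -> a *t b <> 0.
Proof.
move=> /separating_functional[phi [phil phia]].
move=> /separating_functional[psi [psil psib]] ab0.
pose f a b : k^o := phi a * psi b.
have fP : bilin f.
  split=> [b' c x y|a' c x y]; rewrite /f /=.
    by rewrite phil mulrDl -scalerAl.
  by rewrite psil mulrDr -scalerAr.
have := tliftE fP a b; rewrite ab0 (tlift0 fP) /f phia psib mulr1 => /eqP.
by rewrite eq_sym oner_eq0.
Qed.

Lemma sparts (k : comNzRingType) (A : superAlgType k) d (x : A) :
  homogeneous d (spart d x).
Proof. by rewrite /homogeneous spartK eqxx. Qed.

Lemma homogM (k : comNzRingType) (A : superAlgType k) d d' (x y : A) :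
  homogeneous d x -> homogeneous d' y -> homogeneous (d (+) d') (x * y).
Proof. by rewrite /homogeneous => <- <-; exact: spartM. Qed.

Lemma homog_spart (k : comNzRingType) (A : superAlgType k) d d' (x : A) :
  homogeneous d x -> spart d' x = if d' == d then x else 0.
Proof. by move=> <-; rewrite spartK. Qed.

Lemma homog1 (k : comNzRingType) (A : superAlgType k) :
  homogeneous false (1 : A).
Proof.
have e0 : spart true (1 : A) = 0.
  have o x : spart true (1 : A) * spart true x = 0.
    have := spart_sum (1 : A) => e1.
    have h : spart true (spart true x) = spart true x by rewrite spartK.
    have : spart true (1 * spart true x) = 1 * spart true x by rewrite mul1r.
    rewrite -[in LHS]e1 -[in RHS]e1 !mulrDl linearD /=.
    rewrite (spartM false true (1 : A) x).
    rewrite -(spartM true true (1 : A) x) spartK /= addr0.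
    by move=> /eqP; rewrite -subr_eq0 opprD addrA subrr sub0r oppr_eq0 => /eqP.
  have e x : spart true (1 : A) * spart false x = 0.
    have e1 := spart_sum (1 : A).
    have : spart false (1 * spart false x) = 1 * spart false x.
      by rewrite mul1r spartK.
    rewrite -[in LHS]e1 -[in RHS]e1 !mulrDl linearD /=.
    rewrite (spartM false false (1 : A) x).
    rewrite -(spartM true false (1 : A) x) spartK /= addr0.
    by move=> /eqP; rewrite -subr_eq0 opprD addrA subrr sub0r oppr_eq0 => /eqP.
  by rewrite -[LHS]mulr1 -[X in _ * X](spart_sum 1) mulrDr o e addr0.
by rewrite /homogeneous -[RHS](spart_sum (1 : A)) e0 addr0.
Qed.

(* (a (x) b)(c (x) d) = (-1)^(deg b deg c) ac (x) bd for homogeneous b and c,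
   extended bilinearly; see tmul_homog. *)
Section TensorSuper.
Variables (k : fieldType) (A B : superAlgType k).
Local Notation AB := (tens A B).

Lemma tens_homog_ind (P : AB -> Prop) :
  (forall d d' a b, homogeneous d a -> homogeneous d' b -> P (a *t b)) ->
  (forall x y, P x -> P y -> P (x + y)) -> forall x, P x.
Proof.
move=> Ph PD; apply: tens_ind => // a b.
rewrite -(spart_sum a) -(spart_sum b) tpureDl !tpureDr.
have h i j : P (spart i a *t spart j b).
  by exact: Ph (sparts i a) (sparts j b).
by apply/PD; apply/PD.
Qed.

Definition tmul_pure (a : A) (b : B) (c : A) (d : B) : AB :=
  \sum_(i : bool) \sum_(j : bool)
    (-1) ^+ (i && j) *: ((a * spart j c) *t (spart i b * d)).

Definition tmul (x y : AB) : AB :=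
  tlift (fun a b => tlift (tmul_pure a b) y) x.

Lemma tmul_pure_bilin a b : bilin (tmul_pure a b).
Proof.
split=> [d l c c'|c l d d']; rewrite /tmul_pure scaler_sumr -big_split /=;
  apply: eq_bigr => i _; rewrite scaler_sumr -big_split /=;
  apply: eq_bigr => j _.
- rewrite linearP mulrDr -scalerAr tpureDl tpureZl scalerDr !scalerA.
  by rewrite (mulrC l).
- by rewrite mulrDr -scalerAr tpureDr tpureZr scalerDr !scalerA (mulrC l).
Qed.

Lemma tmul_lift_bilin y : bilin (fun a b => tlift (tmul_pure a b) y).
Proof.
split=> [b l a a'|a l b b']; elim/tens_ind: y => [c d|y z IHy IHz];
  do ?[by rewrite !(tliftD (tmul_pure_bilin _ _)) IHy IHz scalerDr addrACA];
  rewrite !(tliftE (tmul_pure_bilin _ _)) /tmul_pure scaler_sumr -big_split /=;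
  apply: eq_bigr => i _; rewrite scaler_sumr -big_split /=;
  apply: eq_bigr => j _.
- by rewrite mulrDl -scalerAl tpureDl tpureZl scalerDr !scalerA (mulrC l).
- rewrite linearP mulrDl -scalerAl tpureDr tpureZr scalerDr !scalerA.
  by rewrite (mulrC l).
Qed.

Lemma tmulDl x y z : tmul (x + y) z = tmul x z + tmul y z.
Proof. exact: tliftD (tmul_lift_bilin z) x y. Qed.

Lemma tmulZl c x y : tmul (c *: x) y = c *: tmul x y.
Proof. exact: tliftZ (tmul_lift_bilin y) c x. Qed.

Lemma tmul_pureE a b c d : tmul (a *t b) (c *t d) = tmul_pure a b c d.
Proof.
by rewrite /tmul (tliftE (tmul_lift_bilin _)) (tliftE (tmul_pure_bilin _ _)).
Qed.

Lemma tmulDr x y z : tmul x (y + z) = tmul x y + tmul x z.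
Proof.
elim/tens_ind: x => [a b|x x' IH IH']; last by rewrite !tmulDl IH IH' addrACA.
rewrite /tmul !(tliftE (tmul_lift_bilin _)).
by rewrite (tliftD (tmul_pure_bilin _ _)).
Qed.

Lemma tmulZr c x y : tmul x (c *: y) = c *: tmul x y.
Proof.
elim/tens_ind: x => [a b|x x' IH IH']; last by rewrite !tmulDl IH IH' scalerDr.
rewrite /tmul !(tliftE (tmul_lift_bilin _)).
by rewrite (tliftZ (tmul_pure_bilin _ _)).
Qed.

Lemma tmul_homogE (i j : bool) a b c d : homogeneous i b -> homogeneous j c ->
  tmul (a *t b) (c *t d) = (-1) ^+ (i && j) *: ((a * c) *t (b * d)).
Proof.
move=> bi cj; rewrite tmul_pureE /tmul_pure.
rewrite (bigD1 i)//= [X in _ + X]big1 => [|i' /negPf i'i]; last first.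
  rewrite big1 // => j' _.
  by rewrite (homog_spart _ bi) i'i mul0r tpure0r scaler0.
rewrite addr0 (bigD1 j)//= [X in _ + X]big1 => [|j' /negPf j'j]; last first.
  by rewrite (homog_spart _ cj) j'j mulr0 tpure0l scaler0.
by rewrite addr0 bi cj.
Qed.

Fact tmulA : associative tmul.
Proof.
move=> x y z; elim/tens_homog_ind: x => [da db a b ha hb|x x' IH IH'];
  last by rewrite !tmulDl IH IH'.
elim/tens_homog_ind: y => [dc dd c d hc hd|y y' IH IH'];
  last by rewrite tmulDl !tmulDr tmulDl IH IH'.
elim/tens_homog_ind: z => [de df e f he hf|z z' IH IH'];
  last by rewrite !tmulDr IH IH'.
rewrite (tmul_homogE _ _ hd he) (tmul_homogE _ _ hb hc) tmulZl tmulZr.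
rewrite (tmul_homogE _ _ hb (homogM hc he)) (tmul_homogE _ _ (homogM hb hd) he).
rewrite !scalerA !mulrA; congr (_ *: _).
rewrite -!signr_addb.
by case: db dc dd de {ha hb hc hd he hf} => [] [] [] [].
Qed.

Fact tmul1l : left_id (1 *t 1) tmul.
Proof.
move=> x; elim/tens_homog_ind: x => [da db a b ha hb|x x' IH IH'];
  last by rewrite tmulDr IH IH'.
by rewrite (tmul_homogE _ _ (homog1 B) ha) /= expr0 scale1r !mul1r.
Qed.

Fact tmul1r : right_id (1 *t 1) tmul.
Proof.
move=> x; elim/tens_homog_ind: x => [da db a b ha hb|x x' IH IH'];
  last by rewrite tmulDl IH IH'.
by rewrite (tmul_homogE _ _ hb (homog1 A)) /= andbF expr0 scale1r !mulr1.
Qed.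

Fact tens1_neq0 : (1 : A) *t (1 : B) != 0.
Proof. by apply/eqP/tpure_neq0; apply/eqP/oner_neq0. Qed.

HB.instance Definition _ := GRing.Zmodule_isNzRing.Build AB
  tmulA tmul1l tmul1r tmulDl tmulDr tens1_neq0.

Fact tens_scalerAl (c : k) (x y : AB) : c *: (x * y) = (c *: x) * y.
Proof. by rewrite -[RHS]/(tmul _ _) tmulZl. Qed.
HB.instance Definition _ := GRing.Lmodule_isLalgebra.Build k AB tens_scalerAl.
Fact tens_scalerAr (c : k) (x y : AB) : c *: (x * y) = x * (c *: y).
Proof. by rewrite -[RHS]/(tmul _ _) tmulZr. Qed.
HB.instance Definition _ := GRing.Lalgebra_isAlgebra.Build k AB tens_scalerAr.

Lemma tmul_homog (i j : bool) (a : A) (b : B) (c : A) (d : B) :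
  homogeneous i b -> homogeneous j c ->
  (a *t b) * (c *t d) = (-1) ^+ (i && j) *: ((a * c) *t (b * d)).
Proof. exact: tmul_homogE. Qed.

Definition tspart_pure (d : bool) (a : A) (b : B) : AB :=
  \sum_(i : bool) spart i a *t spart (d (+) i) b.
Definition tspart (d : bool) (x : AB) : AB := tlift (tspart_pure d) x.

Lemma tspart_bilin d : bilin (tspart_pure d).
Proof.
split=> [b l a a'|a l b b']; rewrite /tspart_pure scaler_sumr -big_split /=;
  apply: eq_bigr => i _; rewrite linearP.
- by rewrite tpureDl tpureZl.
- by rewrite tpureDr tpureZr.
Qed.

Fact tspart_is_linear d : linear (tspart d).
Proof. exact: tlift_is_linear (tspart_bilin d). Qed.

Lemma tspartD d x y : tspart d (x + y) = tspart d x + tspart d y.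
Proof. exact: tliftD (tspart_bilin d) x y. Qed.

Lemma tspart_homogE (d i j : bool) a b : homogeneous i a -> homogeneous j b ->
  tspart d (a *t b) = if d == i (+) j then a *t b else 0.
Proof.
move=> ai bj; rewrite /tspart (tliftE (tspart_bilin d)) /tspart_pure big_bool.
rewrite !(homog_spart _ ai) !(homog_spart _ bj).
by case: d i j {ai bj} => [] [] [] /=;
  rewrite ?tpure0l ?tpure0r ?addr0 ?add0r.
Qed.

Fact tspart_sum x : tspart false x + tspart true x = x.
Proof.
elim/tens_homog_ind: x => [i j a b ai bj|x y IHx IHy].
  by rewrite !(tspart_homogE _ ai bj); case: (i (+) j); rewrite ?addr0 ?add0r.
by rewrite !tspartD addrACA IHx IHy.
Qed.

Lemma tspart0 d : tspart d 0 = 0.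
Proof. exact: tlift0 (tspart_bilin d). Qed.

Fact tspartK d d' x :
  tspart d (tspart d' x) = if d == d' then tspart d' x else 0.
Proof.
elim/tens_homog_ind: x => [i j a b ai bj|x y IHx IHy]; last first.
  by rewrite !tspartD IHx IHy; case: ifP => // _; rewrite addr0.
rewrite (tspart_homogE _ ai bj); case: eqP => [->|_].
  by rewrite (tspart_homogE _ ai bj).
by rewrite tspart0 if_same.
Qed.

Fact tspartM d d' x y :
  tspart (d (+) d') (tspart d x * tspart d' y) = tspart d x * tspart d' y.
Proof.
elim/tens_homog_ind: x => [i j a b ai bj|x x' IHx IHx']; last first.
  by rewrite !tspartD !mulrDl tspartD IHx IHx'.
elim/tens_homog_ind: y => [i' j' a' b' ai' bj'|y y' IHy IHy']; last first.
  by rewrite !tspartD !mulrDr tspartD IHy IHy'.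
rewrite (tspart_homogE _ ai bj) (tspart_homogE _ ai' bj').
case: eqP => [->|_]; last by rewrite mul0r tspart0.
case: eqP => [->|_]; last by rewrite mulr0 tspart0.
rewrite (tmul_homog _ _ bj ai') -tpureZl.
have h : homogeneous (i (+) i') ((-1) ^+ (j && i') *: (a * a')).
  by rewrite /homogeneous linearZ /= (homogM ai ai').
rewrite (tspart_homogE _ h (homogM bj bj')).
by case: i j i' j' {ai bj ai' bj' h} => [] [] [] [].
Qed.

HB.instance Definition _ := Algebra_isSuper.Build k AB tspart_is_linear
  tspart_sum tspartK tspartM.
End TensorSuper.

(* Formal power series in the deformation parameter, as coefficient sequences. *)
Definition fps (V : Type) : Type := nat -> V.
Notation "{ 'fps' V }" := (fps V) (at level 0, format "{ 'fps'  V }").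

Section Convolution.
Variables (U V W : nmodType).

Definition fconv (op : U -> V -> W) (x : {fps U}) (y : {fps V}) : {fps W} :=
  fun n => \sum_(i < n.+1) op (x i) (y (n - i)%N).

Lemma fconvE_rev op x y n :
  fconv op x y n = \sum_(i < n.+1) op (x (n - i)%N) (y i).
Proof.
rewrite /fconv (reindex_inj rev_ord_inj); apply: eq_bigr => i _ /=.
by rewrite subSS subKn // -ltnS.
Qed.
End Convolution.

Lemma fconvA (U V W X Y Z : nmodType) (op1 : X -> W -> Z) (op2 : U -> V -> X)
    (op3 : U -> Y -> Z) (op4 : V -> W -> Y) :
  (forall a b c, op1 (op2 a b) c = op3 a (op4 b c)) ->
  (forall a, op1 0 a = 0) -> (forall a b c, op1 (a + b) c = op1 a c + op1 b c) ->
  (forall a, op3 a 0 = 0) -> (forall a b c, op3 a (b + c) = op3 a b + op3 a c) ->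
  forall x y z, fconv op3 x (fconv op4 y z) = fconv op1 (fconv op2 x y) z.
Proof.
move=> opA op10 op1D op30 op3D x y z; apply/funext => n.
rewrite [RHS]fconvE_rev.
transitivity (\sum_(j < n.+1) op3 (x j) (fconv op4 y z (n - j)%N)); first by [].
have sum3 a (I : finType) P (F : I -> Y) :
    op3 a (\sum_(i | P i) F i) = \sum_(i | P i) op3 a (F i).
  by apply: big_morph => [b c|]; rewrite ?op3D ?op30.
have sum1 a (I : finType) P (F : I -> X) :
    op1 (\sum_(i | P i) F i) a = \sum_(i | P i) op1 (F i) a.
  by apply: (big_morph (op1^~ a)) => [b c|]; rewrite ?op1D ?op10.
pose c3 j l := op3 (x j) (op4 (y (n - j - l)%N) (z l)).
transitivity (\sum_(j < n.+1) \sum_(l < n.+1 | (l <= n - j)%N) c3 j l).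
  apply: eq_bigr => /= j _; rewrite fconvE_rev sum3.
  by rewrite (big_ord_narrow_leq (leq_subr _ _)).
rewrite (exchange_big_dep predT) //=; apply: eq_bigr => l _.
transitivity (\sum_(j < n.+1 | (j <= n - l)%N) c3 j l).
  apply: eq_bigl => j; rewrite -ltnS -(ltnS j) -!subSn ?leq_ord //.
  by rewrite -subn_gt0 -(subn_gt0 j) -!subnDA addnC.
rewrite (big_ord_narrow_leq (leq_subr _ _)) /fconv sum1.
by apply: eq_bigr => j _; rewrite /c3 opA -!subnDA addnC.
Qed.

HB.instance Definition _ (V : Type) := gen_eqMixin (fps V).
HB.instance Definition _ (V : Type) := gen_choiceMixin (fps V).

Section FpsZmodule.
Variable V : zmodType.
Definition fps_zero : {fps V} := fun _ => 0.
Definition fps_add (x y : {fps V}) : {fps V} := fun n => x n + y n.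
Definition fps_opp (x : {fps V}) : {fps V} := fun n => - x n.
Fact fps_addA : associative fps_add.
Proof. by move=> x y z; apply/funext => n; exact: addrA. Qed.
Fact fps_addC : commutative fps_add.
Proof. by move=> x y; apply/funext => n; exact: addrC. Qed.
Fact fps_add0 : left_id fps_zero fps_add.
Proof. by move=> x; apply/funext => n; exact: add0r. Qed.
Fact fps_addN : left_inverse fps_zero fps_opp fps_add.
Proof. by move=> x; apply/funext => n; exact: addNr. Qed.
HB.instance Definition _ :=
  GRing.isZmodule.Build (fps V) fps_addA fps_addC fps_add0 fps_addN.

Lemma fps_addE (x y : {fps V}) n : (x + y) n = x n + y n. Proof. by []. Qed.
Lemma fps_oppE (x : {fps V}) n : (- x) n = - x n. Proof. by []. Qed.
Lemma fps_zeroE n : (0 : {fps V}) n = 0. Proof. by []. Qed.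

Definition fpsC (v : V) : {fps V} := fun n => if n is 0 then v else 0.
End FpsZmodule.
Notation "v %:S" := (fpsC v) (at level 2, left associativity, format "v %:S").

Section ConvolutionTheory.
Variables (U V W : zmodType) (op : U -> V -> W).
Hypotheses (opDl : forall a b c, op (a + b) c = op a c + op b c)
           (opDr : forall a b c, op a (b + c) = op a b + op a c).

Let op0l a : op 0 a = 0.
Proof. by apply: (addrI (op 0 a)); rewrite -opDl !addr0. Qed.
Let op0r a : op a 0 = 0.
Proof. by apply: (addrI (op a 0)); rewrite -opDr !addr0. Qed.

Lemma fconvDl x y z : fconv op (x + y) z = fconv op x z + fconv op y z.
Proof.
by apply/funext => n; rewrite fps_addE -big_split; apply: eq_bigr => i _; exact: opDl.
Qed.
Lemma fconvDr x y z : fconv op x (y + z) = fconv op x y + fconv op x z.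
Proof.
by apply/funext => n; rewrite fps_addE -big_split; apply: eq_bigr => i _; exact: opDr.
Qed.
Lemma fconvCl u x n : fconv op u%:S x n = op u (x n).
Proof.
by rewrite /fconv big_ord_recl subn0 big1 ?addr0 // => i _; exact: op0l.
Qed.
Lemma fconvCr x v n : fconv op x v%:S n = op (x n) v.
Proof.
by rewrite fconvE_rev big_ord_recl subn0 big1 ?addr0 // => i _; exact: op0r.
Qed.
End ConvolutionTheory.

Section FpsRing.
Variable A : nzRingType.
Local Notation mul := (fconv (@GRing.mul A)).
Fact fps_mulA : associative mul.
Proof.
apply: fconvA => *; rewrite ?mul0r ?mulr0 ?mulrDl ?mulrDr //; exact/esym/mulrA.
Qed.
Fact fps_mul1r : left_id (1 : A)%:S mul.
Proof.
by move=> x; apply/funext => n; rewrite fconvCl ?mul1r // => *; exact: mulrDl.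
Qed.
Fact fps_mulr1 : right_id (1 : A)%:S mul.
Proof.
by move=> x; apply/funext => n; rewrite fconvCr ?mulr1 // => *; exact: mulrDr.
Qed.
Fact fps_mulDl : left_distributive mul +%R.
Proof. by move=> x y z; apply: fconvDl => *; exact: mulrDl. Qed.
Fact fps_mulDr : right_distributive mul +%R.
Proof. by move=> x y z; apply: fconvDr => *; exact: mulrDr. Qed.
Fact fps_1neq0 : (1 : A)%:S != 0.
Proof. by apply/eqP => /(congr1 (@^~ 0%N)) /eqP; rewrite oner_eq0. Qed.
HB.instance Definition _ := GRing.Zmodule_isNzRing.Build (fps A)
  fps_mulA fps_mul1r fps_mulr1 fps_mulDl fps_mulDr fps_1neq0.

Lemma fps_mulE (x y : {fps A}) n :
  (x * y) n = \sum_(i < n.+1) x i * y (n - i)%N.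
Proof. by []. Qed.
End FpsRing.

Fact fps_mulC (k : comNzRingType) : commutative (@GRing.mul (fps k)).
Proof.
move=> x y; apply/funext => n; rewrite [LHS]fconvE_rev fps_mulE.
by apply: eq_bigr => i _; rewrite mulrC.
Qed.
HB.instance Definition _ (k : comNzRingType) :=
  GRing.PzRing_hasCommutativeMul.Build (fps k) (@fps_mulC k).

Section FpsLmodule.
Variables (k : comNzRingType) (V : lmodType k).
Local Notation scale := (fconv (@GRing.scale k V)).
Fact fps_scalerA (c d : {fps k}) (x : {fps V}) :
  scale c (scale d x) = scale (c * d) x.
Proof.
apply: fconvA => *; rewrite ?scale0r ?scaler0 ?scalerDl ?scalerDr //.
exact/esym/scalerA.
Qed.
Fact fps_scale1r : left_id (1 : {fps k}) scale.
Proof.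
move=> x; apply/funext => n; rewrite [LHS]fconvCl ?scale1r // => *.
exact: scalerDl.
Qed.
Fact fps_scalerDr : right_distributive scale +%R.
Proof. by move=> c x y; apply: fconvDr => *; exact: scalerDr. Qed.
Fact fps_scalerDl x : {morph scale^~ x : c d / c + d}.
Proof. by move=> c d; apply: fconvDl => *; exact: scalerDl. Qed.
HB.instance Definition _ := GRing.Zmodule_isLmodule.Build (fps k) (fps V)
  fps_scalerA fps_scale1r fps_scalerDr fps_scalerDl.

Lemma fps_scaleE (c : {fps k}) (x : {fps V}) n :
  (c *: x) n = \sum_(i < n.+1) c i *: x (n - i)%N.
Proof. by []. Qed.
End FpsLmodule.

Section FpsAlgebra.
Variables (k : comNzRingType) (A : algType k).
Fact fps_scalerAl (c : {fps k}) (x y : {fps A}) : c *: (x * y) = (c *: x) * y.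
Proof.
apply: fconvA => *; rewrite ?mul0r ?scaler0 ?mulrDl ?scalerDr //.
exact/esym/scalerAl.
Qed.
HB.instance Definition _ :=
  GRing.Lmodule_isLalgebra.Build (fps k) (fps A) fps_scalerAl.
Fact fps_scalerAr (c : {fps k}) (x y : {fps A}) : c *: (x * y) = x * (c *: y).
Proof.
have swap : c *: y = fconv (fun a b => b *: a) y c.
  by apply/funext => n; rewrite [LHS]fconvE_rev.
rewrite swap [LHS](_ : _ = fconv (fun a b => b *: a) (x * y) c); last first.
  by apply/funext => n; rewrite [LHS]fconvE_rev.
apply/esym/fconvA => *; rewrite ?mulr0 ?scaler0 ?mulrDr ?scalerDr //.
exact: scalerAr.
Qed.
HB.instance Definition _ :=
  GRing.Lalgebra_isAlgebra.Build (fps k) (fps A) fps_scalerAr.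
End FpsAlgebra.

Section FpsSuper.
Variables (k : comNzRingType) (A : superAlgType k).
Definition fps_spart d (x : {fps A}) : {fps A} := fun n => spart d (x n).
Fact fps_spart_is_linear d : linear (fps_spart d).
Proof.
move=> c x y; apply/funext => n; rewrite fps_addE /fps_spart !fps_scaleE.
by rewrite fps_addE linearD linear_sum; congr (_ + _); apply: eq_bigr => i _;
  rewrite linearZ.
Qed.
Fact fps_spart_sum x : fps_spart false x + fps_spart true x = x.
Proof. by apply/funext => n; exact: spart_sum. Qed.
Fact fps_spartK d d' x :
  fps_spart d (fps_spart d' x) = if d == d' then fps_spart d' x else 0.
Proof.
by apply/funext => n; rewrite /fps_spart spartK; case: (d == d').
Qed.
Fact fps_spartM d d' x y :
  fps_spart (d (+) d') (fps_spart d x * fps_spart d' y)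
  = fps_spart d x * fps_spart d' y.
Proof.
apply/funext => n; rewrite {1}/fps_spart !fps_mulE linear_sum.
by apply: eq_bigr => i _; exact: spartM.
Qed.
HB.instance Definition _ := Algebra_isSuper.Build (fps k) (fps A)
  fps_spart_is_linear fps_spart_sum fps_spartK fps_spartM.
End FpsSuper.

(* The deformation parameter. *)
Definition hpar {k : comNzRingType} : {fps k} := fun n => (n == 1)%:R.

(* Square root of a series with constant term 1: the coefficient of degree
   n > 0 of y is forced by y * y = x, see fps_sqrtK and fps_sqrt_unique. *)
Section Sqrt.
Variables (k : numFieldType) (A : algType k).

Fixpoint sqrt_coefs (x : {fps A}) (n : nat) : seq A :=
  if n is m.+1 then
    let s := sqrt_coefs x m in
    rcons s (if m is 0 then 1
             else 2^-1 *: (x m - \sum_(1 <= i < m) s`_i * s`_(m - i)))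
  else [::].

Definition fps_sqrt (x : {fps A}) : {fps A} := fun n => (sqrt_coefs x n.+1)`_n.

Lemma size_sqrt_coefs x n : size (sqrt_coefs x n) = n.
Proof. by elim: n => //= n IH; rewrite size_rcons IH. Qed.

Lemma nth_sqrt_coefs x n i : (i < n)%N -> (sqrt_coefs x n)`_i = fps_sqrt x i.
Proof.
elim: n => // n IH; rewrite ltnS leq_eqVlt => /orP[/eqP->//|lt_in].
by rewrite /= nth_rcons size_sqrt_coefs lt_in IH.
Qed.

Lemma fps_sqrt0 x : fps_sqrt x 0%N = 1. Proof. by []. Qed.

Lemma fps_sqrtS x n : fps_sqrt x n.+1 =
  2^-1 *: (x n.+1 - \sum_(1 <= i < n.+1) fps_sqrt x i * fps_sqrt x (n.+1 - i)%N).
Proof.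
rewrite {1}/fps_sqrt -[sqrt_coefs x n.+2]/(rcons (sqrt_coefs x n.+1) _).
rewrite nth_rcons size_sqrt_coefs ltnn eqxx; congr (_ *: (_ - _)).
apply: eq_big_nat => i /andP[i0 im].
by congr (_ * _); [apply: (@nth_sqrt_coefs x n.+1 i)
  | apply: (@nth_sqrt_coefs x n.+1 (n.+1 - i)); rewrite ltn_subrL i0].
Qed.

Lemma half2 (x : A) : 2^-1 *: (x + x) = x.
Proof.
by rewrite -mulr2n -scaler_nat scalerA mulVf ?scale1r // pnatr_eq0.
Qed.

Lemma fps_sqr_coefS (y : {fps A}) n : y 0%N = 1 ->
  (y * y) n.+1 = y n.+1 + y n.+1 + \sum_(1 <= i < n.+1) y i * y (n.+1 - i)%N.
Proof.
move=> y0; rewrite fps_mulE -(big_mkord predT (fun i => y i * y (n.+1 - i)%N)).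
rewrite big_ltn // subn0 y0 mul1r big_nat_recr //= subnn y0 mulr1 -addrA.
by congr (_ + _); rewrite addrC.
Qed.

Lemma fps_sqrtK x : x 0%N = 1 -> fps_sqrt x * fps_sqrt x = x.
Proof.
move=> x0; apply/funext => -[|n].
  by rewrite fps_mulE big_ord1 subn0 fps_sqrt0 mulr1 x0.
rewrite fps_sqr_coefS ?fps_sqrt0 // {1 2}fps_sqrtS -scalerDr half2.
exact: subrK.
Qed.

Lemma fps_sqrt_unique (x y : {fps A}) : y 0%N = 1 -> y * y = x -> y = fps_sqrt x.
Proof.
move=> y0 <-; apply/funext => n.
elim/ltn_ind: n => -[|n] IH; first by rewrite y0 fps_sqrt0.
rewrite fps_sqrtS fps_sqr_coefS //.
under [X in _ - X]eq_big_nat => i /andP[i0 i1].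
  rewrite -!IH // ?ltn_subrL ?i0 //; over.
by rewrite addrK half2.
Qed.
End Sqrt.

(* For modules over a field k, the h-adically completed tensor product of V[[h]]
   and W[[h]] is realised as (V (x) W)[[h]]. *)
Definition fps_tpure (k : comNzRingType) (V W : lmodType k)
  (x : {fps V}) (y : {fps W}) : {fps (tens V W)} := fconv tpure x y.
Notation "x *T y" := (fps_tpure x y) (at level 40, left associativity)
  : ring_scope.

Definition fps_map (V W : Type) (f : V -> W) (x : {fps V}) : {fps W} :=
  fun n => f (x n).

(* The completed tensor product of two k[[h]]-linear maps f and g: the
   k[[h]]-linear extension of a (x) b |-> f a (x) g b, for a in V and b in W. *)
Definition fps_tmap (k : comNzRingType) (V W V' W' : lmodType k)
    (f : {fps V} -> {fps V'}) (g : {fps W} -> {fps W'})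
    (x : {fps (tens V W)}) : {fps (tens V' W')} :=
  fun n => \sum_(m < n.+1)
    tlift (fun a b => (f a%:S *T g b%:S) (n - m)%N) (x m).

Definition tassoc (k : comNzRingType) (A B C : lmodType k) :
    tens (tens A B) C -> tens A (tens B C) :=
  tlift (fun x c => tlift (fun a b => a *t (b *t c)) x).

Definition tunitl (k : comNzRingType) (A : lmodType k) : tens k^o A -> A :=
  tlift (fun (c : k^o) a => (c : k) *: a).
Definition tunitr (k : comNzRingType) (A : lmodType k) : tens A k^o -> A :=
  tlift (fun a (c : k^o) => (c : k) *: a).

Definition tmult (k : comNzRingType) (A : algType k) : tens A A -> A :=
  tlift (fun a b => a * b).

Record superalg_morphism (K : comNzRingType) (A B : superAlgType K)
    (f : A -> B) : Prop := SuperalgMorphism {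
  smor_linear : linear f;
  smor_1 : f 1 = 1;
  smor_M : forall x y, f (x * y) = f x * f y;
  smor_even : forall d x, f (spart d x) = spart d (f x)
}.

Record superalg_antimorphism (K : comNzRingType) (A B : superAlgType K)
    (f : A -> B) : Prop := SuperalgAntimorphism {
  santi_linear : linear f;
  santi_1 : f 1 = 1;
  santi_M : forall (i j : bool) x y, homogeneous i x -> homogeneous j y ->
    f (x * y) = (-1) ^+ (i && j) *: (f y * f x);
  santi_even : forall d x, f (spart d x) = spart d (f x)
}.

Section Hopf.
Variables (k : fieldType) (U : superAlgType k).

Record hopf_ops := HopfOps {
  comult : {fps U} -> {fps (tens U U)};
  counit : {fps U} -> {fps k^o};
  antipode : {fps U} -> {fps U}
}.

(* Hopf superalgebras over k[[h]] with underlying superalgebra U[[h]], in the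
   h-adically completed sense; k[[h]]-linear maps between modules of series are
   automatically h-adically continuous. *)
Record is_hopf_superalgebra (H : hopf_ops) : Prop := IsHopfSuperalgebra {
  comult_morphism : superalg_morphism (comult H);
  counit_morphism : superalg_morphism (counit H);
  antipode_antimorphism : superalg_antimorphism (antipode H);
  coassoc : forall x,
    fps_map (@tassoc k U U U) (fps_tmap (comult H) id (comult H x))
    = fps_tmap id (comult H) (comult H x);
  counitl : forall x,
    fps_map (@tunitl k U) (fps_tmap (counit H) id (comult H x)) = x;
  counitr : forall x,
    fps_map (@tunitr k U) (fps_tmap id (counit H) (comult H x)) = x;
  antipodel : forall x,
    fps_map (@tmult k U) (fps_tmap (antipode H) id (comult H x))
    = (counit H x : {fps k}) *: 1;
  antipoder : forall x,
    fps_map (@tmult k U) (fps_tmap id (antipode H) (comult H x))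
    = (counit H x : {fps k}) *: 1
}.
End Hopf.

(* U(sl(2|1)): noncommutative polynomial expressions in the generators, modulo
   the smallest congruence containing the algebra axioms and the relations. *)
Inductive node := node1 | node2.
Inductive sl21_gen := gen_h of node | gen_e of node | gen_f of node.

Definition cartan (i j : node) : int :=
  match i, j with node1, node1 => 2 | node2, node2 => 0 | _, _ => -1 end.

Definition gen_odd (g : sl21_gen) : bool :=
  match g with gen_e node2 | gen_f node2 => true | _ => false end.

Section Presentation.
Variable k : comNzRingType.

Inductive uexpr :=
  | UGen of sl21_gen | UCst of k | UAdd of uexpr & uexpr | UMul of uexpr & uexpr.

(* Degree of an expression that is homogeneous. *)
Fixpoint uodd (s : uexpr) : bool :=
  match s with
  | UGen g => gen_odd g
  | UCst _ => false
  | UAdd s _ => uodd s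
  | UMul s t => uodd s (+) uodd t
  end.

Definition ucomm (s t : uexpr) : uexpr :=
  UAdd (UMul s t) (UMul (UCst (- (-1) ^+ (uodd s && uodd t))) (UMul t s)).

Local Notation h i := (UGen (gen_h i)).
Local Notation e i := (UGen (gen_e i)).
Local Notation f i := (UGen (gen_f i)).
Local Notation a i j := (UCst (cartan i j)%:~R).

Inductive sl21_rel : uexpr -> uexpr -> Prop :=
  | rel_hh i j : sl21_rel (ucomm (h i) (h j)) (UCst 0)
  | rel_he i j : sl21_rel (ucomm (h i) (e j)) (UMul (a i j) (e j))
  | rel_hf i j : sl21_rel (ucomm (h i) (f j))
                          (UMul (UCst (-1)) (UMul (a i j) (f j)))
  | rel_ef i : sl21_rel (ucomm (e i) (f i)) (h i)
  | rel_e1f2 : sl21_rel (ucomm (e node1) (f node2)) (UCst 0)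
  | rel_e2f1 : sl21_rel (ucomm (e node2) (f node1)) (UCst 0)
  | rel_e2e2 : sl21_rel (ucomm (e node2) (e node2)) (UCst 0)
  | rel_f2f2 : sl21_rel (ucomm (f node2) (f node2)) (UCst 0)
  | rel_e1e1e2 : sl21_rel (ucomm (e node1) (ucomm (e node1) (e node2))) (UCst 0)
  | rel_f1f1f2 : sl21_rel (ucomm (f node1) (ucomm (f node1) (f node2))) (UCst 0).

Inductive ueqv : uexpr -> uexpr -> Prop :=
  | ueqv_refl s : ueqv s s
  | ueqv_sym s t : ueqv s t -> ueqv t s
  | ueqv_trans s t u : ueqv s t -> ueqv t u -> ueqv s u
  | ueqv_congD s s' t t' :
      ueqv s s' -> ueqv t t' -> ueqv (UAdd s t) (UAdd s' t')
  | ueqv_congM s s' t t' :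
      ueqv s s' -> ueqv t t' -> ueqv (UMul s t) (UMul s' t')
  | ueqv_addA s t u : ueqv (UAdd s (UAdd t u)) (UAdd (UAdd s t) u)
  | ueqv_addC s t : ueqv (UAdd s t) (UAdd t s)
  | ueqv_add0 s : ueqv (UAdd (UCst 0) s) s
  | ueqv_addN s : ueqv (UAdd (UMul (UCst (-1)) s) s) (UCst 0)
  | ueqv_mulA s t u : ueqv (UMul s (UMul t u)) (UMul (UMul s t) u)
  | ueqv_mul1 s : ueqv (UMul (UCst 1) s) s
  | ueqv_mulDl s t u : ueqv (UMul (UAdd s t) u) (UAdd (UMul s u) (UMul t u))
  | ueqv_mulDr s t u : ueqv (UMul s (UAdd t u)) (UAdd (UMul s t) (UMul s u))
  | ueqv_cstC c s : ueqv (UMul (UCst c) s) (UMul s (UCst c))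
  | ueqv_cstD c d : ueqv (UCst (c + d)) (UAdd (UCst c) (UCst d))
  | ueqv_cstM c d : ueqv (UCst (c * d)) (UMul (UCst c) (UCst d))
  | ueqv_rel s t : sl21_rel s t -> ueqv s t.

Definition ueqv_equiv : equiv_rel {classic uexpr} :=
  EquivRelPack (asbool_equiv_class ueqv_refl ueqv_sym ueqv_trans).

Definition Usl21 : Type := {eq_quot ueqv_equiv}.

Definition upi (s : uexpr) : Usl21 := \pi_({eq_quot ueqv_equiv}) s.
Definition urepr (x : Usl21) : uexpr := repr (x : {eq_quot ueqv_equiv}).

Lemma ureprK : cancel urepr upi. Proof. exact: reprK. Qed.
Lemma upiP s t : upi s = upi t <-> ueqv s t.
Proof.
split; first by move=> /eqmodP/asboolP.
by move=> st; apply/eqmodP/asboolP.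
Qed.
Lemma urepr_pi s : ueqv (urepr (upi s)) s.
Proof. by apply/upiP; rewrite ureprK. Qed.

HB.instance Definition _ := Choice.on Usl21.

Definition uadd x y := locked (upi (UAdd (urepr x) (urepr y))).
Definition umul x y := locked (upi (UMul (urepr x) (urepr y))).
Definition ucst c := locked (upi (UCst c)).
Definition uopp x := umul (ucst (-1)) x.
Definition ugen (g : sl21_gen) : Usl21 := upi (UGen g).

Lemma upiD s t : upi (UAdd s t) = uadd (upi s) (upi t).
Proof.
by rewrite /uadd -lock; apply/upiP/ueqv_sym/ueqv_congD; apply: urepr_pi.
Qed.
Lemma upiM s t : upi (UMul s t) = umul (upi s) (upi t).
Proof.
by rewrite /umul -lock; apply/upiP/ueqv_sym/ueqv_congM; apply: urepr_pi.
Qed.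
Lemma upiC c : upi (UCst c) = ucst c. Proof. by rewrite /ucst -lock. Qed.

Local Ltac usolve l := repeat move=> ?; rewrite /uopp;
  repeat match goal with x : Usl21 |- _ =>
  rewrite -(ureprK x); move: (urepr x) => {}x end;
  do 3 rewrite -?upiC -?upiD -?upiM; apply/upiP; exact: l.

Fact uaddA : associative uadd. Proof. usolve ueqv_addA. Qed.
Fact uaddC : commutative uadd. Proof. usolve ueqv_addC. Qed.
Fact uadd0 : left_id (ucst 0) uadd. Proof. usolve ueqv_add0. Qed.
Fact uaddN : left_inverse (ucst 0) uopp uadd. Proof. usolve ueqv_addN. Qed.
HB.instance Definition _ :=
  GRing.isZmodule.Build Usl21 uaddA uaddC uadd0 uaddN.

Lemma uaddE (x y : Usl21) : x + y = uadd x y. Proof. by []. Qed.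

Lemma ucstC c x : umul (ucst c) x = umul x (ucst c).
Proof. usolve ueqv_cstC. Qed.

Fact umulA : associative umul. Proof. usolve ueqv_mulA. Qed.
Fact umul1l : left_id (ucst 1) umul. Proof. usolve ueqv_mul1. Qed.
Fact umul1r : right_id (ucst 1) umul.
Proof. by move=> x; rewrite -ucstC umul1l. Qed.
Fact umulDl : left_distributive umul +%R.
Proof. move=> x y z; rewrite !uaddE; usolve ueqv_mulDl. Qed.
Fact umulDr : right_distributive umul +%R.
Proof. move=> x y z; rewrite !uaddE; usolve ueqv_mulDr. Qed.

Section Eval.
Variables (A : algType k) (g : sl21_gen -> A).
Fixpoint ueval (s : uexpr) : A :=
  match s with
  | UGen x => g x
  | UCst c => c%:A
  | UAdd s t => ueval s + ueval t
  | UMul s t => ueval s * ueval t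
  end.

Hypothesis g_rel : forall s t, sl21_rel s t -> ueval s = ueval t.

Lemma ueval_ueqv s t : ueqv s t -> ueval s = ueval t.
Proof.
elim=> //=.
- by move=> {}s {}t u _ -> _ ->.
- by move=> s1 s2 t1 t2 _ -> _ ->.
- by move=> s1 s2 t1 t2 _ -> _ ->.
- by move=> *; rewrite addrA.
- by move=> *; rewrite addrC.
- by move=> *; rewrite scale0r add0r.
- by move=> *; rewrite mulr_algl scaleN1r addNr scale0r.
- by move=> *; rewrite mulrA.
- by move=> *; rewrite scale1r mul1r.
- by move=> *; rewrite mulrDl.
- by move=> *; rewrite mulrDr.
- by move=> *; rewrite mulr_algl mulr_algr.
- by move=> *; rewrite scalerDl.
- by move=> *; rewrite mulr_algl scalerA.
Qed.
End Eval.

Fact u1_neq0 : ucst 1 != 0.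
Proof.
apply/eqP; rewrite -[0]/(ucst 0) -!upiC => /upiP /(@ueval_ueqv k^o (fun=> 0)) /=.
have P s t : sl21_rel s t -> @ueval k^o (fun=> 0) s = @ueval k^o (fun=> 0) t.
  by case=> *; rewrite /= ?(mulr0, mul0r, addr0, scale0r).
by move=> /(_ P) /eqP; rewrite scale1r scale0r oner_eq0.
Qed.

HB.instance Definition _ := GRing.Zmodule_isNzRing.Build Usl21
  umulA umul1l umul1r umulDl umulDr u1_neq0.

Definition uscale c (x : Usl21) : Usl21 := ucst c * x.

Lemma ucstD c d : ucst (c + d) = ucst c + ucst d.
Proof. rewrite uaddE; usolve ueqv_cstD. Qed.
Lemma ucstM c d : ucst (c * d) = ucst c * ucst d :> Usl21.
Proof. rewrite -[RHS]/(umul _ _); usolve ueqv_cstM. Qed.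

Fact uscaleA c d x : uscale c (uscale d x) = uscale (c * d) x.
Proof. by rewrite /uscale ucstM mulrA. Qed.
Fact uscale1 : left_id 1 uscale. Proof. exact: mul1r. Qed.
Fact uscaleDr : right_distributive uscale +%R.
Proof. by move=> c x y; exact: mulrDr. Qed.
Fact uscaleDl x : {morph uscale^~ x : c d / c + d}.
Proof. by move=> c d; rewrite /uscale ucstD mulrDl. Qed.
HB.instance Definition _ := GRing.Zmodule_isLmodule.Build k Usl21
  uscaleA uscale1 uscaleDr uscaleDl.
Fact uscalerAl c (x y : Usl21) : c *: (x * y) = (c *: x) * y.
Proof. exact: mulrA. Qed.
HB.instance Definition _ := GRing.Lmodule_isLalgebra.Build k Usl21 uscalerAl.
Fact uscalerAr c (x y : Usl21) : c *: (x * y) = x * (c *: y).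
Proof.
have cC z : c *: z = z * ucst c by rewrite -[LHS]/(umul _ _) ucstC.
by rewrite !cC mulrA.
Qed.
HB.instance Definition _ := GRing.Lalgebra_isAlgebra.Build k Usl21 uscalerAr.

Lemma upi_ueval s : upi s = ueval ugen s.
Proof.
elim: s => //= [c|s <- t <-|s <- t <-].
- by rewrite upiC -[RHS]/(ucst c * 1) mulr1.
- by rewrite upiD.
- by rewrite upiM.
Qed.

Lemma ugen_rel s t : sl21_rel s t -> ueval ugen s = ueval ugen t.
Proof. by move=> st; rewrite -!upi_ueval; apply/upiP/ueqv_rel. Qed.

Section Lift.
Variables (A : algType k) (g : sl21_gen -> A).
Hypothesis g_rel : forall s t, sl21_rel s t -> ueval g s = ueval g t.

Definition ulift (x : Usl21) : A := ueval g (urepr x).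

Lemma ulift_pi s : ulift (upi s) = ueval g s.
Proof. exact: ueval_ueqv g_rel _ _ (urepr_pi s). Qed.
Lemma ulift_gen x : ulift (ugen x) = g x. Proof. exact: ulift_pi. Qed.
Lemma uliftD x y : ulift (x + y) = ulift x + ulift y.
Proof.
by rewrite -(ureprK x) -(ureprK y) uaddE -upiD !ulift_pi.
Qed.
Lemma uliftM x y : ulift (x * y) = ulift x * ulift y.
Proof.
by rewrite -(ureprK x) -(ureprK y) -[_ * _ in LHS]/(umul _ _) -upiM !ulift_pi.
Qed.
Lemma ulift_cst c : ulift (ucst c) = c%:A.
Proof. by rewrite -upiC ulift_pi. Qed.
Lemma uliftZ c x : ulift (c *: x) = c *: ulift x.
Proof. by rewrite -[c *: x]/(ucst c * x) uliftM ulift_cst mulr_algl. Qed.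
End Lift.

Lemma Usl21_ind (P : Usl21 -> Prop) :
  (forall g, P (ugen g)) -> (forall c : k, P c%:A) ->
  (forall x y, P x -> P y -> P (x + y)) ->
  (forall x y, P x -> P y -> P (x * y)) -> forall x, P x.
Proof.
move=> Pg Pc PD PM x; rewrite -(ureprK x) upi_ueval.
by elim: (urepr x) => //= [s Ps t Pt|s Ps t Pt]; [apply/PD | apply/PM].
Qed.
End Presentation.
Arguments ugen {k}.

(* The grading of U(sl(2|1)) is the one for which the generators have the degree
   given by gen_odd: x is of degree d when uparity x = (-1)^d x. *)
Section Usl21Super.
Variable k : numFieldType.
Local Notation U := (Usl21 k).

Definition parity_gen (g : sl21_gen) : U := (-1) ^+ gen_odd g *: ugen g.

Fact parity_gen_rel (s t : uexpr k) :
  sl21_rel s t -> ueval parity_gen s = ueval parity_gen t.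
Proof.
have rel := ugen_rel (k := k).
have N1 (x : U) : (-1)%:A * x = - x by rewrite mulr_algl scaleN1r.
have key s' t' (d : bool) : sl21_rel s' t' ->
    ueval parity_gen s' = (-1) ^+ d *: ueval ugen s' ->
    ueval parity_gen t' = (-1) ^+ d *: ueval ugen t' ->
    ueval parity_gen s' = ueval parity_gen t'.
  by move=> st -> ->; rewrite (rel _ _ st).
move=> st; apply: (key _ _ (uodd s)) => //; move: st => {key}.
- by case=> [[] []|[] []|[] []|[]||||||]; rewrite /= /parity_gen /=;
  rewrite ?expr0 ?expr1 ?scale1r ?scaleN1r ?scale0r ?scaler0 ?oppr0;
  rewrite ?(mulrN, mulNr, mulrDr, mulrDl, opprK, opprD).
- by case=> [[] []|[] []|[] []|[]||||||]; rewrite /= /parity_gen /=;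
  rewrite ?expr0 ?expr1 ?scale1r ?scaleN1r ?scale0r ?scaler0 ?oppr0;
  rewrite ?(mulrN, mulNr, mulrDr, mulrDl, opprK, opprD).
Qed.

Definition uparity : U -> U := ulift parity_gen.

Lemma uparity_linear : linear uparity.
Proof. by move=> c x y; rewrite /uparity (uliftD parity_gen_rel) (uliftZ parity_gen_rel). Qed.
Lemma uparityM x y : uparity (x * y) = uparity x * uparity y.
Proof. exact: (uliftM parity_gen_rel). Qed.
HB.instance Definition _ := GRing.isLinear.Build k U U *:%R uparity uparity_linear.

Lemma uparityK : involutive uparity.
Proof.
move=> x; elim/Usl21_ind: x => [g|c|x y IHx IHy|x y IHx IHy].
- have ug : uparity (ugen g) = parity_gen g by exact: ulift_gen parity_gen_rel g.
  by rewrite ug {1}/parity_gen linearZ /= ug scalerA -expr2 sqrr_sign scale1r.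
- have u1 : uparity 1 = 1 by rewrite -[1]/(ucst 1) /uparity (ulift_cst parity_gen_rel) scale1r.
  by rewrite !linearZ /= !u1.
- by rewrite !linearD /= IHx IHy.
- by rewrite !uparityM IHx IHy.
Qed.

Definition uspart (d : bool) (x : U) : U := 2^-1 *: (x + (-1) ^+ d *: uparity x).

Lemma uspart_id (d : bool) x : uparity x = (-1) ^+ d *: x -> uspart d x = x.
Proof. by move=> px; rewrite /uspart px scalerA -expr2 sqrr_sign scale1r half2. Qed.

Lemma uparity_spart d x : uparity (uspart d x) = (-1) ^+ d *: uspart d x.
Proof.
rewrite /uspart linearZ linearD linearZ /= uparityK scalerA mulrC -scalerA.
congr (_ *: _); rewrite scalerDr scalerA -expr2 sqrr_sign scale1r addrC.
by [].
Qed.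

Fact uspart_is_linear d : linear (uspart d).
Proof.
move=> c x y; rewrite /uspart linearP /= !scalerDr !scalerA [LHS]addrACA.
by rewrite (mulrC c) mulrAC.
Qed.
Fact uspart_sum x : uspart false x + uspart true x = x.
Proof.
by rewrite /uspart -scalerDr expr0 expr1 scale1r scaleN1r addrACA subrr addr0 half2.
Qed.
Fact uspartK d d' x :
  uspart d (uspart d' x) = if d == d' then uspart d' x else 0.
Proof.
case: eqP => [->|/eqP dd']; first exact/uspart_id/uparity_spart.
rewrite {1}/uspart uparity_spart scalerA -signr_addb.
have -> : d (+) d' = true by case: d d' dd' => [] [].
by rewrite expr1 scaleN1r subrr scaler0.
Qed.
Fact uspartM d d' x y :
  uspart (d (+) d') (uspart d x * uspart d' y) = uspart d x * uspart d' y.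
Proof.
apply: uspart_id; rewrite uparityM !uparity_spart -scalerAl -scalerAr scalerA.
by rewrite signr_addb.
Qed.
HB.instance Definition _ := Algebra_isSuper.Build k U uspart_is_linear
  uspart_sum uspartK uspartM.

Lemma ugen_homogeneous g : homogeneous (gen_odd g) (ugen g : U).
Proof. by apply: uspart_id; exact: (ulift_gen parity_gen_rel). Qed.
End Usl21Super.

(* dT, dTV, dTh, dTVh stand for T, T^-1, T^(1/2), T^(-1/2), with
   dW = sqrt(1 + h^2 e1^2). *)
Section DeformedGenerators.
Variable k : numFieldType.
Local Notation U := (Usl21 k).
Local Notation h := (hpar : {fps k}).

Local Notation h1 := (ugen (gen_h node1) : U).
Local Notation h2 := (ugen (gen_h node2) : U).
Local Notation e1 := (ugen (gen_e node1) : U).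
Local Notation e2 := (ugen (gen_e node2) : U).
Local Notation f1 := (ugen (gen_f node1) : U).
Local Notation f2 := (ugen (gen_f node2) : U).

Definition uh3 : U := h1 + h2.
Definition ue3 : U := e1 * e2 - e2 * e1.
Definition uf3 : U := f2 * f1 - f1 * f2.

Definition dW : {fps U} := fps_sqrt (1 + h ^+ 2 *: (e1 ^+ 2)%:S).
Definition dT : {fps U} := h *: e1%:S + dW.
Definition dTV : {fps U} := - (h *: e1%:S) + dW.
Definition dTh : {fps U} := fps_sqrt dT.
Definition dTVh : {fps U} := fps_sqrt dTV.

Definition dH1 : {fps U} := dW * h1%:S.
Definition dF1 : {fps U} :=
  f1%:S - (4^-1%:S * h ^+ 2) *: (e1 * (h1 ^+ 2 - 1))%:S.
Definition dH2 : {fps U} :=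
  h2%:S - (2^-1%:S * h ^+ 2) *: (e1 ^+ 2 * h1)%:S.
Definition dE2 : {fps U} :=
  e2%:S - (4^-1%:S * h ^+ 2) *: (e1 * ue3 * (2%:R * h1 + 1))%:S.
Definition dF2 : {fps U} := f2%:S.
Definition dH3 : {fps U} :=
  uh3%:S + (2^-1%:S * h ^+ 2) *: (e1 ^+ 2 * h1)%:S.
Definition dE3 : {fps U} := ue3%:S.
Definition dF3 : {fps U} :=
  uf3%:S + (4^-1%:S * h ^+ 2) *: (e1 * f2 * (2%:R * h1 + 1))%:S.
End DeformedGenerators.

(* Main.v *)
From Stdlib Require Import ZArith.
Require Import Defs.
From HB Require Import structures.
From mathcomp Require Import all_boot all_order all_algebra ssrZ.
From mathcomp Require Import boolp reals complex.

Set Implicit Arguments.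
Unset Strict Implicit.
Unset Printing Implicit Defensive.

Import Order.TTheory GRing.Theory Num.Theory.
Local Open Scope ring_scope.

(** Why the structure exists. Besides T^(+-1/2), H_1 and F_1, use as generators the
    element Z = h_1 + 2 h_2, which commutes with the subalgebra sl(2) spanned by e_1,
    h_1 and f_1, and the two odd highest weight vectors E_3 = e_3 and F_2 = f_2 of
    this subalgebra. The other generators are expressions in these: E_2 = [F_1, E_3],
    F_3 = [F_2, F_1], and H_2 and H_3 are combinations of Z and (T + T^-1) H_1. In
    the new generators the relations of U(sl(2|1)) are equivalent to relations that are
    polynomial in T^(+-1/2) ([deformed_to_sl21], [sl21_to_deformed]), and the
    coproduct is skew-primitive: every generator x other than the powers of T goes to
    x (x) a + b (x) x, where a and b are powers of T. The involved formulas for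
    E_2, F_3, H_2 and H_3 are consequences of these.

    A coproduct, counit or antipode with given values on the generators exists as soon
    as the values satisfy the relations ([lift_deformed]). These are finitely many
    identities between noncommutative polynomials. Orienting the relations gives a
    rewriting system, and a normaliser proved sound ([nc_derive]) checks each identity
    by computation. In the tensor square, the system consists of two copies of the
    rules and of the sign rule that orders the two factors ([tensor_rule]). The graded
    antipode is turned into an ordinary antihomomorphism, to which the same method
    applies, by multiplying its values on odd elements by a square root of -1
    ([antipode_deformed]).

    What is not polynomial is dealt with by one remark on power series: if x has
    constant term 1 and x y + y x = 0, then y = 0 ([fps_anticommutant0]). Hence a
    commutation relation with W = T + T^-1, of which the square is a polynomial in e_1,
    or with T^(1/2), of which the square is T, is implied by the one with the square.

    Coassociativity and the counit laws are equalities between morphisms, and are thus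
    checked on the generators. The antipode laws are not equalities between morphisms,
    but the elements that satisfy such a law form a subalgebra, again because the
    counit is scalar ([hopf_antipode]). The generators generate U(sl(2|1)) once division by
    the deformation parameter and inversion of even elements are allowed
    ([generation]); this also gives uniqueness, as the prescribed values determine
    the one on Z = H_2 + H_3 ([deformed_hopf]). *)

(** * Normal forms of noncommutative polynomials *)

(** [NEta] is multiplication by a central scalar eta: with eta an eighth of the
    deformation parameter, all structure constants become integers. *)
Inductive ncexpr : Type :=
  | NVar of nat | NZero | NOne | NAdd of ncexpr & ncexpr | NOpp of ncexpr
  | NMul of ncexpr & ncexpr | NMuln of ncexpr & nat | NEta of ncexpr.

Declare Scope nc_scope.
Delimit Scope nc_scope with nc.
Bind Scope nc_scope with ncexpr.
Notation "0" := NZero : nc_scope.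
Notation "1" := NOne : nc_scope.
Notation "x + y" := (NAdd x y) : nc_scope.
Notation "- x" := (NOpp x) : nc_scope.
Notation "x - y" := (NAdd x (NOpp y)) : nc_scope.
Notation "x * y" := (NMul x y) : nc_scope.
Notation "x *+ n" := (NMuln x n) : nc_scope.

Fixpoint nc_subst (s : nat -> ncexpr) (x : ncexpr) : ncexpr :=
  match x with
  | NVar i => s i
  | NZero => NZero
  | NOne => NOne
  | NAdd x y => NAdd (nc_subst s x) (nc_subst s y)
  | NOpp x => NOpp (nc_subst s x)
  | NMul x y => NMul (nc_subst s x) (nc_subst s y)
  | NMuln x n => NMuln (nc_subst s x) n
  | NEta x => NEta (nc_subst s x)
  end.

(** The triple (c, j, w) is the monomial c * eta ^ j * w, where w lists letters. *)
Definition ncterm : Type := (Z * nat * seq nat)%type.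

Section Compute.
Implicit Types (t : ncterm) (p : seq ncterm) (w : seq nat).

Definition zterm (c : Z) (j : nat) t : ncterm :=
  let: (d, i, w) := t in (Z.mul c d, (j + i)%N, w).
Definition zscale (c : Z) (j : nat) p : seq ncterm := [seq zterm c j t | t <- p].

Fixpoint insert_term t p : seq ncterm :=
  if p is t' :: p' then
    let: (c, j, w) := t in let: (d, i, v) := t' in
    if eqseq w v && (j == i) then
      let e := Z.add c d in if Z.eqb e Z0 then p' else (e, i, v) :: p'
    else t' :: insert_term t p'
  else [:: t].

Definition add_terms p q : seq ncterm := foldr insert_term q p.

(** Normal forms are computed in the left regular representation: x acts on a
    normal form through the action of its letters, so that products are never
    expanded before being reduced. *)
Fixpoint nc_act (letter : nat -> seq ncterm -> seq ncterm) (x : ncexpr) p :=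
  match x with
  | NVar i => letter i p
  | NZero => [::]
  | NOne => p
  | NAdd x y => add_terms (nc_act letter x p) (nc_act letter y p)
  | NOpp x => zscale (-1) 0 (nc_act letter x p)
  | NMul x y => nc_act letter x (nc_act letter y p)
  | NMuln x n => if n is 0 then [::] else zscale (Z.of_nat n) 0 (nc_act letter x p)
  | NEta x => zscale 1 1 (nc_act letter x p)
  end.

Variable rule : seq nat -> option (ncexpr * seq nat).

(** Since the words of p are already reduced, only a prefix of [a :: w] can be a
    redex. The fuel bounds the depth of rewriting; running out of it leaves a word
    unreduced, which does not affect soundness. *)
Fixpoint nc_letter (fuel : nat) (a : nat) p : seq ncterm :=
  foldr (fun (t : ncterm) acc =>
    let: (c, j, w) := t in
    let q := if fuel is fuel'.+1 then
        if rule (a :: w) is Some (x, r) then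
          nc_act (nc_letter fuel') x [:: (Zpos xH, 0%N, r)]
        else [:: (Zpos xH, 0%N, a :: w)]
      else [:: (Zpos xH, 0%N, a :: w)] in
    add_terms (zscale c j q) acc) [::] p.

Definition nc_eqb (fuel : nat) (r : ncexpr * ncexpr) : bool :=
  nilp (nc_act (nc_letter fuel) (r.1 - r.2)%nc [:: (Zpos xH, 0%N, [::])]).

End Compute.

Arguments add_terms : simpl never.
Arguments zscale : simpl never.

Section Soundness.
Variables (K : comNzRingType) (eta : K) (A : algType K).
Implicit Types (env : nat -> A) (x y : ncexpr) (p : seq ncterm) (w : seq nat).

Fixpoint nc_eval env x : A :=
  match x with
  | NVar i => env i
  | NZero => 0
  | NOne => 1
  | NAdd x y => nc_eval env x + nc_eval env y
  | NOpp x => - nc_eval env x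
  | NMul x y => nc_eval env x * nc_eval env y
  | NMuln x n => nc_eval env x *+ n
  | NEta x => eta *: nc_eval env x
  end.

Lemma nc_eval_subst env s x :
  nc_eval env (nc_subst s x) = nc_eval (fun i => nc_eval env (s i)) x.
Proof. by elim: x => //= [x -> y ->|x ->|x -> y ->|x -> n|x ->]. Qed.

Definition holds env (rels : seq (ncexpr * ncexpr)) : Prop :=
  foldr (fun r P => nc_eval env r.1 = nc_eval env r.2 /\ P) True rels.

Lemma holds_cat env r s : holds env (r ++ s) <-> holds env r /\ holds env s.
Proof. by elim: r => [|a r IH] /=; [tauto | rewrite IH; tauto]. Qed.

Definition weval env w : A := foldr (fun i a => env i * a) 1 w.
Definition teval env (t : ncterm) : A :=
  eta ^+ t.1.2 *: (weval env t.2 *~ int_of_Z t.1.1).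
Definition peval env p : A := foldr (fun t a => teval env t + a) 0 p.

(** A rule maps a word to the polynomial replacing some prefix of it and to the
    remaining suffix. *)
Definition sound_rule env (rule : seq nat -> option (ncexpr * seq nat)) : Prop :=
  forall w x r, rule w = Some (x, r) -> weval env w = nc_eval env x * weval env r.

Lemma teval_zterm env c j t :
  teval env (zterm c j t) = eta ^+ j *: (teval env t *~ int_of_Z c).
Proof.
case: t => [[d i] w]; rewrite /teval /= (rmorphM int_of_Z c d) mulrC exprD.
by rewrite mulrzA scalerMzr scalerA.
Qed.

Lemma peval_zscale env c j p :
  peval env (zscale c j p) = eta ^+ j *: (peval env p *~ int_of_Z c).
Proof.
elim: p => /= [|t p ->]; first by rewrite mul0rz scaler0.
by rewrite teval_zterm mulrzDl scalerDr.
Qed.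

Lemma peval_opp env p : peval env (zscale (-1) 0 p) = - peval env p.
Proof. by rewrite peval_zscale scale1r mulrN1z. Qed.

Lemma peval_insert env t p : peval env (insert_term t p) = teval env t + peval env p.
Proof.
elim: p => //= t' p IH; case: t IH => [[c j] w]; case: t' => [[d i] v] IH.
case: ifP => [/andP[/eqseqP -> /eqP ->]|_] /=; last by rewrite IH addrCA.
have e : teval env (c, i, v) + teval env (d, i, v) = teval env (Z.add c d, i, v).
  by rewrite /teval /= (rmorphD int_of_Z c d) mulrzDr scalerDr.
rewrite addrA e; case: Z.eqb_spec => [->|] //=.
by rewrite /teval /= mulr0z scaler0 add0r.
Qed.

Lemma peval_add env p q : peval env (add_terms p q) = peval env p + peval env q.
Proof. by elim: p => /= [|t p IH]; rewrite ?add0r // peval_insert IH addrA. Qed.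

Lemma nc_act_sound env letter x p :
  (forall i q, peval env (letter i q) = env i * peval env q) ->
  peval env (nc_act letter x p) = nc_eval env x * peval env p.
Proof.
move=> hl; elim: x p => //=.
- by move=> p; rewrite mul0r.
- by move=> p; rewrite mul1r.
- by move=> x IHx y IHy p; rewrite peval_add IHx IHy mulrDl.
- by move=> x IHx p; rewrite peval_opp IHx mulNr.
- by move=> x IHx y IHy p; rewrite IHx IHy mulrA.
- move=> x IHx [|n] p; first by rewrite mulr0n mul0r.
  rewrite peval_zscale scale1r IHx mulrnAl.
  by rewrite -[int_of_Z _]/(Posz (Pos.to_nat _)) SuccNat2Pos.id_succ.
- by move=> x IHx p; rewrite peval_zscale expr1 mulr1z IHx scalerAl.
Qed.

Lemma nc_letter_sound env rule n a p : sound_rule env rule ->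
  peval env (nc_letter rule n a p) = env a * peval env p.
Proof.
move=> hr; elim: n a p => [|n IHn] a; elim=> [|[[c j] w] p IH] /=;
  rewrite ?mulr0 // peval_add IH mulrDr; congr (_ + _); rewrite peval_zscale.
  by rewrite /= addr0 /teval /= expr0 scale1r mulr1z -scalerAr mulrzAr.
rewrite /teval /= -scalerAr mulrzAr; congr (_ *: (_ *~ _)).
have e w' : peval env [:: (Zpos xH, 0%N, w')] = weval env w'.
  by rewrite /= addr0 /teval /= expr0 scale1r mulr1z.
case er: rule => [[x r]|]; last by rewrite e.
by rewrite nc_act_sound // e -(hr _ _ _ er).
Qed.

Lemma nc_eqb_sound env rule n r : sound_rule env rule -> nc_eqb rule n r ->
  nc_eval env r.1 = nc_eval env r.2.
Proof.
move=> hr /nilP e; apply/eqP; rewrite -subr_eq0; apply/eqP.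
have e1 : peval env [:: (Zpos xH, 0%N, [::])] = 1.
  by rewrite /= addr0 /teval /= expr0 scale1r mulr1z.
rewrite -[LHS]/(nc_eval env (r.1 - r.2)%nc) -[LHS]mulr1 -e1.
by rewrite -(nc_act_sound _ _ (fun i q => nc_letter_sound n i q hr)) e.
Qed.

Lemma nc_all_sound env rule n rels : sound_rule env rule ->
  all (nc_eqb rule n) rels -> holds env rels.
Proof.
move=> hr; elim: rels => //= r rels IH /andP[er e]; split; last exact: IH.
exact: nc_eqb_sound hr er.
Qed.
End Soundness.

Fixpoint word_of (x : ncexpr) : option (seq nat) :=
  match x with
  | NVar i => Some [:: i]
  | NMul x y => if (word_of x, word_of y) is (Some v, Some w) then Some (v ++ w)
                else None
  | _ => None
  end.

Definition oriented (rels : seq (ncexpr * ncexpr)) : seq (seq nat * ncexpr) :=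
  pmap (fun r => omap (fun w => (w, r.2)) (word_of r.1)) rels.

Fixpoint strip_prefix (u w : seq nat) : option (seq nat) :=
  match u, w with
  | [::], _ => Some w
  | a :: u', b :: w' => if a == b then strip_prefix u' w' else None
  | _, _ => None
  end.

Fixpoint table_rule (tbl : seq (seq nat * ncexpr)) (w : seq nat) :=
  if tbl is (u, x) :: tbl' then
    if strip_prefix u w is Some r then Some (x, r) else table_rule tbl' w
  else None.

Section TableSoundness.
Variables (K : comNzRingType) (eta : K) (A : algType K) (env : nat -> A).

Lemma weval_cat u w : weval env (u ++ w) = weval env u * weval env w.
Proof. by elim: u => /= [|a u ->]; rewrite ?mul1r ?mulrA. Qed.

Lemma strip_prefixP u w r : strip_prefix u w = Some r -> w = u ++ r.
Proof.
elim: u w => [w [->]//|a u IH [|b w]] //=.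
by case: eqP => // -> /IH ->.
Qed.

Lemma word_ofP x w : word_of x = Some w -> nc_eval eta env x = weval env w.
Proof.
elim: x w => //= [i w [<-]|x IHx y IHy w]; first by rewrite /= mulr1.
case ex: (word_of x) => [u|] //; case ey: (word_of y) => [v|] // [<-].
by rewrite weval_cat (IHx _ ex) (IHy _ ey).
Qed.

Lemma table_rule_sound rels :
  holds eta env rels -> sound_rule eta env (table_rule (oriented rels)).
Proof.
elim: rels => //= -[l x] rels IH /= [e hr] w y r.
rewrite /oriented /=; case el: (word_of l) => [u|] /=; last exact: IH.
case es: strip_prefix => [r'|]; last exact: IH.
by case=> <- <-; rewrite (strip_prefixP es) weval_cat -(word_ofP el) e.
Qed.

(** Identities that follow from relations, read as rewrite rules from left to
    right, are thereby settled by computation. *)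
Lemma nc_derive rules n rels : holds eta env rules ->
  all (nc_eqb (table_rule (oriented rules)) n) rels -> holds eta env rels.
Proof. by move=> /table_rule_sound; exact: nc_all_sound. Qed.
End TableSoundness.

(** * The relations of sl(2|1) and of its deformation *)

Local Open Scope nc_scope.

(** The letters of all the presentations below. With hbar the deformation
    parameter and T the group-like generator, W and e are T + T^-1 and
    T - T^-1 = 2 hbar e_1; H, F, Z, E and G are 2 H_1, F_1, h_1 + 2 h_2, 2 hbar E_3
    and F_2; D = FE - EF and C = FG - GF are the other odd elements; t and u are
    the square roots of T and T^-1; h and f are h_1 and f_1; v is the inverse of W,
    and i a square root of -1. *)
Notation xv := (NVar 0).
Notation xW := (NVar 1).
Notation xe := (NVar 2).
Notation xH := (NVar 3).
Notation xF := (NVar 4).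
Notation xZ := (NVar 5).
Notation xE := (NVar 6).
Notation xG := (NVar 7).
Notation xD := (NVar 8).
Notation xC := (NVar 9).
Notation xt := (NVar 10).
Notation xu := (NVar 11).
Notation xh := (NVar 12).
Notation xf := (NVar 13).
Notation xi := (NVar 14).

Definition relations : Type := seq (ncexpr * ncexpr).

Definition comm (x y : ncexpr) := x * y - y * x.
Definition acomm (x y : ncexpr) := x * y + y * x.

Definition subst_rels (s : nat -> ncexpr) (rels : relations) : relations :=
  [seq (nc_subst s r.1, nc_subst s r.2) | r <- rels].

Definition assign (l : seq ncexpr) (i : nat) : ncexpr := nth (NVar i) l i.

(** As modules over the subalgebra sl(2), the odd elements are two doublets, with
    highest weight vectors E and G; hence only E and G are taken as generators. *)
Definition odd_rels : relations := [::
  (xE * xZ, xZ * xE + xE); (xG * xZ, xZ * xG - xG);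
  (xE * xE, 0); (xG * xG, 0); (xG * xE, xe - xE * xG)].

Definition sl21_swaps : relations := odd_rels ++ [::
  (xh * xe, xe * xh + xe *+ 2);
  (xf * xe, xe * xf - NEta (xh *+ 16));
  (xf * xh, xh * xf + xf *+ 2);
  (xe * xZ, xZ * xe); (xh * xZ, xZ * xh); (xf * xZ, xZ * xf);
  (xE * xe, xe * xE); (xG * xe, xe * xG);
  (xE * xh, xh * xE - xE); (xG * xh, xh * xG - xG)].

(** That D and C commute with f says that the doublets have no third member. *)
Definition sl21_descendant_rels : relations := [::
  (xD * xf, xf * xD); (xC * xf, xf * xC);
  (xG * xD, NEta ((xZ - xh) *+ 8) - xD * xG)].

Definition sl21_descendants : nat -> ncexpr :=
  assign [:: xv; xW; xe; xH; xF; xZ; xE; xG; comm xf xE; comm xf xG].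

Definition sl21_rels : relations :=
  sl21_swaps ++ subst_rels sl21_descendants sl21_descendant_rels.

Definition deformed_swaps : relations := odd_rels ++ [::
  (xe * xW, xW * xe); (xW * xW, xe * xe + 1 *+ 4);
  (xH * xe, xe * xH + (xe * xW) *+ 2);
  (xH * xW, xW * xH + (xe * xe) *+ 2);
  (xF * xe, xe * xF - NEta (acomm xH xW *+ 2));
  (xF * xW, xW * xF - NEta (acomm xH xe *+ 2));
  (xF * xH, xH * xF + acomm xF xW);
  (xe * xZ, xZ * xe); (xW * xZ, xZ * xW); (xH * xZ, xZ * xH); (xF * xZ, xZ * xF);
  (xE * xe, xe * xE); (xG * xe, xe * xG); (xE * xW, xW * xE); (xG * xW, xW * xG);
  (xE * xH, xH * xE - xW * xE); (xG * xH, xH * xG - xW * xG)].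

(** The double commutator [F, [F, X]] no longer vanishes after deformation; this is
    its value for X = E and X = G. *)
Definition deformed_serre (X : ncexpr) : ncexpr :=
  NEta (NEta (((xH * xH + xW * xH) *+ 4 - xe * xe) * X)) - NEta ((xe * acomm xF X) *+ 2).

Definition deformed_descendant_rels : relations := [::
  (xD * xF, xF * xD - deformed_serre xE);
  (xC * xF, xF * xC - deformed_serre xG);
  (xG * xD, NEta (xZ *+ 8 - (xW * xH) *+ 2 - xe * xe - (xe * xE * xG) *+ 2) - xD * xG)].

Definition descendants : nat -> ncexpr :=
  assign [:: xv; xW; xe; xH; xF; xZ; xE; xG; comm xF xE; comm xF xG].

Definition deformed_rels : relations :=
  deformed_swaps ++ subst_rels descendants deformed_descendant_rels.

(** The fourth rule is W ^ 2 = e ^ 2 + 4 divided by W. *)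
Definition inverse_rules : relations := [::
  (xv * xW, 1); (xW * xv, 1); (xe * xv, xv * xe); (xv * xe * xe, xW - xv *+ 4);
  (xv * xZ, xZ * xv); (xE * xv, xv * xE); (xG * xv, xv * xG)].

(** ** From the deformed to the undeformed relations *)

Definition undeform : nat -> ncexpr :=
  assign [:: xv; xW; xe; xH; xF; xZ; xE; xG; xD; xC; xt; xu;
    xv * xH; xF + NEta (xe * (xv * xH * (xv * xH) - 1))].

(** Rules that move D and C past the other letters. They follow from the relations
    between the generators once D and C are expanded, but keeping D and C as
    letters lets the relations for D and C be used in the normalisation. *)
Definition deformed_descendant_swaps : relations :=
  let swaps X Y := [::
    (Y * X, - (X * Y));
    (Y * xe, xe * Y - NEta ((xW * xW * X) *+ 4));
    (Y * xW, xW * Y - NEta ((xe * xW * X) *+ 4));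
    (Y * xH, xH * Y + comm (acomm xF xW) X - comm xF (xW * X))] in
  [:: (xD * xZ, xZ * xD + xD); (xC * xZ, xZ * xC - xC)] ++ swaps xE xD ++ swaps xG xC.

Definition descendant_defs : relations :=
  [:: (xE * xF, xF * xE - xD); (xG * xF, xF * xG - xC)].

Definition deformed_inverse_swaps : relations := [::
  (xH * xv, xv * xH - xv * (xe * xe) * xv *+ 2);
  (xF * xv, xv * xF + xv * NEta (acomm xH xe *+ 2) * xv)].

Definition descendant_inverse_swaps : relations := [::
  (xD * xv, xv * xD + NEta ((xv * xe * xE) *+ 4));
  (xC * xv, xv * xC + NEta ((xv * xe * xG) *+ 4))].

(** ** From the undeformed to the deformed relations *)

Definition deform : nat -> ncexpr :=
  assign [:: xv; xW; xe; xW * xh; xf - NEta (xe * (xh * xh - 1))].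

Definition sl21_W_swaps : relations := [::
  (xe * xW, xW * xe); (xW * xW, xe * xe + 1 *+ 4);
  (xh * xW, xW * xh + (xv * xe * xe) *+ 2);
  (xW * xZ, xZ * xW); (xE * xW, xW * xE); (xG * xW, xW * xG)].

(** This is W f - f W, computed from F_1 W - W F_1. *)
Definition fW_comm : ncexpr :=
  NEta ((xW * xh * xe + xe * xW * xh) *+ 2) + NEta (xe * comm xW (xh * xh)).

Definition sl21_f_swaps : relations := [::
  (xf * xW, xW * xf - fW_comm);
  (xh * xv, xv * xh - xv * (xv * xe * xe) * xv *+ 2);
  (xf * xv, xv * xf + xv * fW_comm * xv)].

Definition sl21_descendant_defs : relations :=
  [:: (xE * xf, xf * xE - xD); (xG * xf, xf * xG - xC)].

Definition sl21_descendant_swaps : relations :=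
  let swaps X Y := [::
    (Y * X, - (X * Y)); (Y * xe, xe * Y - NEta (X *+ 16)); (Y * xh, xh * Y + Y)] in
  [:: (xD * xZ, xZ * xD + xD); (xC * xZ, xZ * xC - xC)] ++ swaps xE xD ++ swaps xG xC.

Definition sl21_descendant_W_swaps : relations :=
  let swaps X Y := [::
    (Y * xW, xW * Y - comm fW_comm X); (Y * xv, xv * Y + xv * comm fW_comm X * xv)] in
  swaps xE xD ++ swaps xG xC.

(** ** Square roots of T, the coproduct and the antipode *)

Definition square_roots : nat -> ncexpr :=
  assign [:: xv; xt * xt + xu * xu; xt * xt - xu * xu].

Definition root_swaps : relations := [::
  (xt * xu, 1); (xu * xt, 1);
  (xH * xt, xt * xH + xt * xt * xt - xu);
  (xH * xu, xu * xH + xu * xu * xu - xt);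
  (xF * xt, xt * xF - NEta (acomm xH xt));
  (xF * xu, xu * xF + NEta (acomm xH xu));
  (xt * xZ, xZ * xt); (xu * xZ, xZ * xu);
  (xE * xt, xt * xE); (xE * xu, xu * xE); (xG * xt, xt * xG); (xG * xu, xu * xG)].

Definition root_core : relations :=
  root_swaps ++ subst_rels square_roots (odd_rels ++ [::
    (xF * xH, xH * xF + acomm xF xW); (xH * xZ, xZ * xH); (xF * xZ, xZ * xF);
    (xE * xH, xH * xE - xW * xE); (xG * xH, xH * xG - xW * xG)]).

Definition root_descendant_swaps : relations :=
  let swaps X Y := [::
    (Y * xt, xt * Y - comm (NEta (acomm xH xt)) X);
    (Y * xu, xu * Y + comm (NEta (acomm xH xu)) X)] in
  swaps xE xD ++ swaps xG xC.

Definition root_rules : relations :=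
  descendant_defs ++ root_descendant_swaps ++ root_core ++
  subst_rels square_roots (deformed_descendant_swaps ++ deformed_descendant_rels).

(** The letter [nletters + i] is the letter i of the second tensor factor. *)
Definition nletters : nat := 14%N.

Definition shift (x : ncexpr) : ncexpr := nc_subst (fun i => NVar (nletters + i)) x.

Definition coproduct : nat -> ncexpr :=
  let t' := shift xt in let u' := shift xu in
  assign [:: xv;
    (xt * xt) * (t' * t') + (xu * xu) * (u' * u');
    (xt * xt) * (t' * t') - (xu * xu) * (u' * u');
    xH * (t' * t') + (xu * xu) * shift xH;
    xF * (t' * t') + (xu * xu) * shift xF;
    xZ + shift xZ;
    xE * u' + xt * shift xE;
    xG * u' + xt * shift xG].

Definition coproduct_descendants : relations :=
  let rel X Y := (comm (coproduct 4%N) (nc_subst coproduct X),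
    Y * shift xt + xu * shift Y
    + NEta ((xu * xu * X) * shift (acomm xH xu))
    - NEta (acomm xH xt * shift (xt * xt * X))) in
  [:: rel xE xD; rel xG xC].

(** The letters E, G, D and C. *)
Definition odd_letter (i : nat) : bool := (5 < i < 10)%N.

(** The sign rule of the graded tensor product, which brings the letters of the
    first factor to the left. *)
Definition cross_rule (w : seq nat) : option (ncexpr * seq nat) :=
  if w is a :: b :: r then
    if ((nletters <= a) && (b < nletters))%N then
      Some (if odd_letter (a - nletters)%N && odd_letter b then - (NVar b * NVar a)
            else NVar b * NVar a, r)
    else None
  else None.

Definition tensor_rule (w : seq nat) : option (ncexpr * seq nat) :=
  if cross_rule w is Some x then Some x
  else table_rule (oriented (root_rules ++
    subst_rels (fun i => NVar (nletters + i)) root_rules)) w.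

Fixpoint nc_rev (x : ncexpr) : ncexpr :=
  match x with
  | NAdd x y => NAdd (nc_rev x) (nc_rev y)
  | NOpp x => NOpp (nc_rev x)
  | NMul x y => NMul (nc_rev y) (nc_rev x)
  | NMuln x n => NMuln (nc_rev x) n
  | NEta x => NEta (nc_rev x)
  | _ => x
  end.

Definition antipode_images : nat -> ncexpr :=
  assign [:: xv; xt * xt + xu * xu; xu * xu - xt * xt;
    - (xt * xt * xH * (xu * xu)); - (xt * xt * xF * (xu * xu)); - xZ; xi * xE; xi * xG].

Definition antipode_rules : relations :=
  (xi * xi, NOpp 1) :: [seq (x * xi, xi * x)%nc | x <- [:: xt; xu; xH; xF; xZ; xE; xG; xD; xC]]
  ++ root_rules.

Local Close Scope nc_scope.
Local Open Scope ring_scope.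

Section Relations.
Variables (K : comNzRingType) (eta : K) (A : algType K).
Implicit Types (rels : relations).

Lemma holds_subst (env : nat -> A) s rels :
  holds eta env (subst_rels s rels) <-> holds eta (fun i => nc_eval eta env (s i)) rels.
Proof. by elim: rels => //= r rels IH; rewrite !nc_eval_subst IH. Qed.

Lemma holds_catI (env : nat -> A) rels rels' :
  holds eta env rels -> holds eta env rels' -> holds eta env (rels ++ rels').
Proof. by move=> h h'; apply/holds_cat. Qed.

Lemma inverse_swap (x w v : A) : v * w = 1 -> w * v = 1 ->
  x * v = v * x + v * (w * x - x * w) * v.
Proof.
move=> vw wv; rewrite mulrBr mulrBl !mulrA vw mul1r -!mulrA wv mulr1.
by rewrite addrC subrK.
Qed.

Lemma inverse_commute (x w v : A) : v * w = 1 -> w * v = 1 ->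
  x * w = w * x -> x * v = v * x.
Proof. by move=> vw wv c; rewrite (inverse_swap x vw wv) c subrr mulr0 mul0r addr0. Qed.

Definition env_of (s : seq A) (i : nat) : A := nth 0 s i.

Lemma deformed_WW (v W e H F Z E G : A) :
  holds eta (env_of [:: v; W; e; H; F; Z; E; G]) deformed_rels ->
  W * W = e * e + 1 *+ 4.
Proof. by case=> _ [_ [_ [_ [_ [_ [WW _]]]]]]. Qed.

Section Undeform.
Variables (v0 v W e H F Z E G : A).
Hypotheses (vW : v * W = 1) (Wv : W * v = 1).
Let env := env_of [:: v; W; e; H; F; Z; E; G; F * E - E * F; F * G - G * F].
Hypothesis rels8 : holds eta (env_of [:: v0; W; e; H; F; Z; E; G]) deformed_rels.
Let rels : holds eta env deformed_rels. Proof. exact: rels8. Qed.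

Let swaps : holds eta env deformed_swaps.
Proof. by case/holds_cat: rels. Qed.

Let inverse : holds eta env inverse_rules.
Proof.
have [_ [_ [_ [_ [_ [eW [WW [_ [_ [_ [_ [_ [_ [WZ [_ [_ [_ [_ [EW [GW _]]]]]]]]]]]]]]]]]]]] :=
  swaps.
split=> //; split=> //; rewrite /= in eW WW WZ EW GW *.
have vC x : x * W = W * x -> x * v = v * x by exact: inverse_commute.
do ![split]; do ?[exact: vC]; last by rewrite vC.
have -> : v * e * e = v * (W * W - 1 *+ 4) by rewrite WW addrK mulrA.
by rewrite mulrBr mulrA vW mul1r mulrnAr mulr1.
Qed.

Let inverse_swaps : holds eta env deformed_inverse_swaps.
Proof.
have [_ [_ [_ [_ [_ [_ [_ [_ [HW [_ [FW _]]]]]]]]]]] := swaps.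
rewrite /= in HW FW *; split; [|split] => //.
  by rewrite (inverse_swap H vW Wv) HW opprD addNKr mulrN mulNr mulrnAr mulrnAl.
by rewrite (inverse_swap F vW Wv) FW subKr.
Qed.

Let descend : holds eta env (deformed_descendant_rels ++ deformed_descendant_swaps).
Proof.
apply/holds_cat; split.
  have [_ h] := (holds_cat _ _ _ _).1 rels.
  exact: ((holds_subst env descendants _).1 h).
have h : holds eta env (subst_rels descendants deformed_descendant_swaps).
  by apply: (nc_derive (n := 60%N) swaps); vm_compute.
exact: ((holds_subst env descendants _).1 h).
Qed.

(** Solving H = W h and F = f - eta e (h ^ 2 - 1) for h and f turns the deformed
    relations into those of sl(2|1). *)
Lemma deformed_to_sl21 : holds eta (env_of [:: v; W; e; 0; 0; Z; E; G; 0; 0; 0; 0;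
  v * H; F + eta *: (e * (v * H * (v * H) - 1))]) sl21_rels.
Proof.
pose rules := deformed_swaps ++ (deformed_descendant_rels ++ deformed_descendant_swaps)
  ++ inverse_rules ++ deformed_inverse_swaps ++ descendant_defs.
have defs : holds eta env descendant_defs by rewrite /= !subKr.
have h1 : holds eta env (deformed_swaps ++ inverse_rules ++ deformed_inverse_swaps).
  exact: (holds_catI swaps (holds_catI inverse inverse_swaps)).
have h2 : holds eta env descendant_inverse_swaps.
  have h : holds eta env (subst_rels descendants descendant_inverse_swaps).
    by apply: (nc_derive (n := 60%N) h1); vm_compute.
  exact: ((holds_subst env descendants _).1 h).
have h3 : holds eta env (rules ++ descendant_inverse_swaps).
  exact: (holds_catI (holds_catI swaps (holds_catI descend
    (holds_catI inverse (holds_catI inverse_swaps defs)))) h2).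
have h : holds eta env (subst_rels undeform sl21_rels).
  by apply: (nc_derive (n := 100%N) h3); vm_compute.
exact: ((holds_subst env undeform _).1 h).
Qed.
End Undeform.

Section Deform.
Variables (v W e h f Z E G : A).
Hypotheses (vW : v * W = 1) (Wv : W * v = 1).
Hypothesis (WW : W * W = e * e + 1 *+ 4).
Hypotheses (eW : e * W = W * e) (WZ : W * Z = Z * W) (EW : E * W = W * E)
  (GW : G * W = W * G).
Hypothesis kill : forall y, W * y + y * W = 0 -> y = 0.
Let env := env_of [:: v; W; e; 0; 0; Z; E; G; f * E - E * f; f * G - G * f; 0; 0; h; f].
Hypothesis rels : holds eta env sl21_rels.

Let swaps : holds eta env sl21_swaps.
Proof. by case/holds_cat: rels. Qed.

Let inverse : holds eta env inverse_rules.
Proof.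
have vC x : x * W = W * x -> x * v = v * x by exact: inverse_commute.
do ![split] => //; do ?[exact: vC]; last by rewrite /= vC.
rewrite /=.
have -> : v * e * e = v * (W * W - 1 *+ 4) by rewrite WW addrK mulrA.
by rewrite mulrBr mulrA vW mul1r mulrnAr mulr1.
Qed.

(* The commutator of x with W is found from the one with W ^ 2 = e ^ 2 + 4: the
   difference y between x W and its expected value satisfies W y + y W = 0. *)
Let h_W : h * W = W * h + (v * e * e) *+ 2.
Proof.
have [_ [_ [_ [_ [_ [he _]]]]]] := swaps; rewrite /= in he.
apply/eqP; rewrite -subr_eq0; apply/eqP/kill.
have rules : holds eta env (inverse_rules ++ [:: (xe * xW, xW * xe);
    (xW * xW, xe * xe + 1 *+ 4); (xh * xe, xe * xh + xe *+ 2)]%nc).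
  by apply: holds_catI inverse _.
have : holds eta env [:: (acomm xW (xh * xW - (xW * xh + (xv * xe * xe) *+ 2)), 0)]%nc.
  by apply: (nc_derive (n := 60%N) rules); vm_compute.
by case.
Qed.

Let W_swaps : holds eta env sl21_W_swaps.
Proof. by do ![split]; rewrite //= h_W. Qed.

Let rules1 : holds eta env (sl21_swaps ++ inverse_rules ++ sl21_W_swaps).
Proof. exact: (holds_catI swaps (holds_catI inverse W_swaps)). Qed.

Let F := f - eta *: (e * (h * h - 1)).
Let H := W * h.

Let F_W : F * W = W * F - eta *: ((H * e + e * H) *+ 2).
Proof.
apply/eqP; rewrite -subr_eq0; apply/eqP/kill.
have Fe : F * e = e * F - eta *: ((H * W + W * H) *+ 2).
  have : holds eta env (subst_rels deform [:: (xF * xe, xe * xF - NEta (acomm xH xW *+ 2))]%nc).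
    by apply: (nc_derive (n := 60%N) rules1); vm_compute.
  by case.
have rules : holds eta (env_of [:: v; W; e; H; F]) [:: (xe * xW, xW * xe);
    (xW * xW, xe * xe + 1 *+ 4); (xF * xe, xe * xF - NEta (acomm xH xW *+ 2))]%nc by [].
have : holds eta (env_of [:: v; W; e; H; F])
    [:: (acomm xW (xF * xW - (xW * xF - NEta (acomm xH xe *+ 2))), 0)]%nc.
  by apply: (nc_derive (n := 60%N) rules); vm_compute.
by case.
Qed.

Let f_swaps : holds eta env sl21_f_swaps.
Proof.
have fW : f * W = W * f - nc_eval eta env fW_comm.
  have [X [fE XW]] : exists X, f = F + X /\
      X * W - eta *: ((H * e + e * H) *+ 2) = W * X - nc_eval eta env fW_comm.
    exists (eta *: (e * (h * h - 1))); split; first by rewrite subrK.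
    have : holds eta env [:: (NEta (xe * (xh * xh - 1)) * xW
        - NEta ((xW * xh * xe + xe * (xW * xh)) *+ 2),
        xW * NEta (xe * (xh * xh - 1)) - fW_comm)]%nc.
      by apply: (nc_derive (n := 60%N) rules1); vm_compute.
    by case.
  have -> : f * W = F * W + X * W by rewrite [in LHS]fE mulrDl.
  have -> : W * f = W * F + W * X by rewrite [in LHS]fE mulrDr.
  by rewrite F_W -addrA -[RHS]addrA -XW [- _ + _]addrC.
split=> //; split; [|split] => //=; rewrite (inverse_swap _ vW Wv).
  by rewrite h_W opprD addNKr mulrN mulNr mulrnAr mulrnAl.
by rewrite fW subKr.
Qed.

Lemma sl21_to_deformed : holds eta (env_of [:: v; W; e; H; F; Z; E; G]) deformed_rels.
Proof.
have defs : holds eta env sl21_descendant_defs by rewrite /= !subKr.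
have h1 : holds eta env sl21_descendant_swaps.
  have d : holds eta env (subst_rels sl21_descendants sl21_descendant_swaps).
    by apply: (nc_derive (n := 60%N) swaps); vm_compute.
  exact: ((holds_subst env sl21_descendants _).1 d).
have h2 : holds eta env sl21_descendant_rels.
  have [_ d] := (holds_cat _ _ _ _).1 rels.
  exact: ((holds_subst env sl21_descendants _).1 d).
have h3 : holds eta env sl21_descendant_W_swaps.
  have d : holds eta env (subst_rels sl21_descendants sl21_descendant_W_swaps).
    by apply: (nc_derive (n := 60%N) (holds_catI rules1 f_swaps)); vm_compute.
  exact: ((holds_subst env sl21_descendants _).1 d).
have d : holds eta env (subst_rels deform deformed_rels).
  apply: (nc_derive (n := 100%N) (holds_catI (holds_catI rules1 f_swaps)
    (holds_catI defs (holds_catI h1 (holds_catI h2 h3))))); by vm_compute.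
exact: ((holds_subst env deform _).1 d).
Qed.
End Deform.

Section SquareRoots.
Variables (v t u H F Z E G : A).
Hypotheses (tu : t * u = 1) (ut : u * t = 1).
Let W := t * t + u * u.
Let e := t * t - u * u.
Hypothesis kill : forall y, t * y + y * t = 0 -> y = 0.
Hypothesis cancel2 : forall y : A, y *+ 2 = 0 -> y = 0.
Let env := env_of [:: 0; W; e; H; F; Z; E; G; F * E - E * F; F * G - G * F; t; u].
Hypothesis rels8 : holds eta (env_of [:: v; W; e; H; F; Z; E; G]) deformed_rels.
Let rels : holds eta env deformed_rels. Proof. exact: rels8. Qed.

Let swaps : holds eta env deformed_swaps.
Proof. by case/holds_cat: rels. Qed.

Let T2 : (t * t) *+ 2 = W + e.
Proof. by rewrite /W /e addrACA subrr addr0. Qed.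

Let from2 (x y : A) : x *+ 2 = y *+ 2 -> x = y.
Proof.
by move=> xy; apply/eqP; rewrite -subr_eq0; apply/eqP/cancel2; rewrite mulrnBl xy subrr.
Qed.

(* The relations of t follow from those of t ^ 2 in the way those of W follow from
   those of W ^ 2. *)
Let t_comm x : x * e = e * x -> x * W = W * x -> x * t = t * x.
Proof.
move=> xe xW; apply/eqP; rewrite -subr_eq0; apply/eqP/kill.
rewrite mulrBr mulrBl !mulrA addrC addrA subrK -(mulrA x).
apply/eqP; rewrite subr_eq0; apply/eqP/from2.
by rewrite -mulrnAr T2 -mulrnAl T2 mulrDr mulrDl xe xW.
Qed.

Let root_relations : holds eta env root_swaps.
Proof.
have [_ [_ [_ [_ [_ [_ [_ [He [HW [Fe [FW [_ [eZ [WZ [_ [_ [Ee [Ge [EW [GW _]]]]]]]]]]]]]]]]]]]] :=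
  swaps.
rewrite /= in He HW Fe FW eZ WZ Ee Ge EW GW.
have uC x : x * t = t * x -> x * u = u * x by exact: inverse_commute.
have Zt : Z * t = t * Z by apply: t_comm.
have Et : E * t = t * E by apply: t_comm.
have Gt : G * t = t * G by apply: t_comm.
have HT : H * (t * t) = t * t * H + (t * t * (t * t)) *+ 2 - 1 *+ 2.
  have hT : H * (W + e) = (W + e) * H + (e * (W + e)) *+ 2.
    rewrite (mulrDr H W) HW He (mulrDl W e H) addrACA (mulrDr e W) mulrnDl.
    by congr (_ + _); rewrite addrC.
  have uutt : u * u * (t * t) = 1 by rewrite mulrA -(mulrA u u t) ut mulr1 ut.
  have eT : e * (t * t) = t * t * (t * t) - 1 by rewrite [LHS]mulrBl uutt.
  apply: from2; rewrite -(mulrnAr H (t * t)) T2 hT -T2.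
  have -> : e * ((t * t) *+ 2) = (t * t * (t * t)) *+ 2 - 1 *+ 2.
    by rewrite mulrnAr eT mulrnBl.
  by rewrite mulrnAl -mulrnDl addrA.
have FT : F * (t * t) = t * t * F - eta *: ((H * (t * t) + t * t * H) *+ 2).
  have hT : F * (W + e) = (W + e) * F - eta *: ((H * (W + e) + (W + e) * H) *+ 2).
    rewrite (mulrDr F W) FW Fe (mulrDl W e F) (mulrDr H W) (mulrDl W e H) addrACA.
    rewrite -opprD -scalerDr -mulrnDl; congr (_ - eta *: (_ *+ 2)).
    by rewrite addrACA; congr (_ + _); rewrite addrC.
  apply: from2; rewrite -(mulrnAr F (t * t)) T2 hT -T2 mulrnAl mulrnBl; congr (_ - _).
  by rewrite mulrnAr mulrnAl -mulrnDl scalerMnr.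
have Ht : H * t = t * H + t * t * t - u.
  have hr : holds eta env [:: (xt * xu, 1); (xu * xt, 1);
    (xH * xt * xt, xt * xt * xH + (xt * xt * (xt * xt)) *+ 2 - 1 *+ 2)]%nc.
    by split=> //; split=> //; split=> //=; rewrite -HT mulrA.
  apply/eqP; rewrite -subr_eq0; apply/eqP/kill.
  have : holds eta env [:: (acomm xt (xH * xt - (xt * xH + xt * xt * xt - xu)), 0)]%nc.
    by apply: (nc_derive (n := 60%N) hr); vm_compute.
  by case.
have Hu : H * u = u * H + u * u * u - t.
  rewrite (inverse_swap H ut tu) Ht.
  have hr : holds eta env [:: (xt * xu, 1); (xu * xt, 1)]%nc by [].
  have : holds eta env [:: (xu * xH + xu * (xt * xH - (xt * xH + xt * xt * xt - xu)) * xu,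
    xu * xH + xu * xu * xu - xt)]%nc.
    by apply: (nc_derive (n := 60%N) hr); vm_compute.
  by case.
have Ft : F * t = t * F - eta *: (H * t + t * H).
  have hr : holds eta env [:: (xt * xu, 1); (xu * xt, 1);
    (xH * xt, xt * xH + xt * xt * xt - xu);
    (xF * xt * xt, xt * xt * xF - NEta ((xH * (xt * xt) + xt * xt * xH) *+ 2))]%nc.
    by split=> //; split=> //; split=> //; split=> //=; rewrite -FT mulrA.
  apply/eqP; rewrite -subr_eq0; apply/eqP/kill.
  have : holds eta env [:: (acomm xt (xF * xt - (xt * xF - NEta (acomm xH xt))), 0)]%nc.
    by apply: (nc_derive (n := 60%N) hr); vm_compute.
  by case.
have Fu : F * u = u * F + eta *: (H * u + u * H).
  rewrite (inverse_swap F ut tu) Ft subKr.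
  have hr : holds eta env [:: (xt * xu, 1); (xu * xt, 1)]%nc by [].
  have : holds eta env [:: (xu * xF + xu * NEta (acomm xH xt) * xu,
    xu * xF + NEta (acomm xH xu))]%nc.
    by apply: (nc_derive (n := 60%N) hr); vm_compute.
  by case.
by do ![split] => //=; rewrite uC.
Qed.

Lemma root_rules_hold : holds eta env root_rules.
Proof.
have defs : holds eta env descendant_defs by rewrite /= !subKr.
have core : holds eta env root_core.
  have [EZ [GZ [EE [GG [GE [_ [_ [_ [_ [_ [_ [FH [_ [_ [HZ [FZ [_ [_ [_ [_ [EH [GH _]]]]]]]]]]]]]]]]]]]]]] :=
    swaps.
  by apply: holds_catI root_relations _; do ![split].
have h1 : holds eta env root_descendant_swaps.
  have d : holds eta env (subst_rels descendants root_descendant_swaps).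
    by apply: (nc_derive (n := 60%N) core); vm_compute.
  exact: ((holds_subst env descendants _).1 d).
have h2 : holds eta env (deformed_descendant_swaps ++ deformed_descendant_rels).
  apply: holds_catI; last first.
    have [_ d] := (holds_cat _ _ _ _).1 rels.
    exact: ((holds_subst env descendants _).1 d).
  have d : holds eta env (subst_rels descendants deformed_descendant_swaps).
    by apply: (nc_derive (n := 60%N) swaps); vm_compute.
  exact: ((holds_subst env descendants _).1 d).
have h3 : holds eta env (subst_rels square_roots
    (deformed_descendant_swaps ++ deformed_descendant_rels)).
  by apply/(holds_subst env square_roots); exact: h2.
exact: (holds_catI defs (holds_catI h1 (holds_catI core h3))).
Qed.
End SquareRoots.

Section Coproduct.
Variables env1 env2 : nat -> A.
Hypothesis rules1 : holds eta env1 root_rules.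
Hypothesis rules2 : holds eta env2 root_rules.
Hypothesis cross : forall i j, env2 i * env1 j
  = if odd_letter i && odd_letter j then - (env1 j * env2 i) else env1 j * env2 i.

Let env (i : nat) : A :=
  if (i < nletters)%N then env1 i else env2 (i - nletters)%N.

(** Both factors satisfy the rules, and the cross rule orders their letters, so the
    union of the three systems is sound in the tensor product. *)
Lemma tensor_rule_sound : sound_rule eta env tensor_rule.
Proof.
have left : holds eta env root_rules by exact: rules1.
have right : holds eta (fun i => env (nletters + i)%N) root_rules by exact: rules2.
move=> w x r; rewrite /tensor_rule.
case ec: (cross_rule w) => [[y s]|]; last first.
  apply: table_rule_sound; apply: holds_catI left _.
  exact: ((holds_subst env (fun i => NVar (nletters + i)%N) _).2 right).
case=> <- <-; case: w ec => [|a [|b w]] //=; case: ifP => // /andP[na nb] [<- <-].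
have ea : env a = env2 (a - nletters)%N by rewrite /env ltnNge na.
have eb : env b = env1 b by rewrite /env nb.
rewrite /= mulrA ea eb cross.
by case: ifP => _ /=; rewrite ?mulNr ?mulrA ea eb ?mulNr ?mulrA.
Qed.

Let T1 := env1 10%N * env1 10%N.
Let V1 := env1 11%N * env1 11%N.
Let T2 := env2 10%N * env2 10%N.
Let V2 := env2 11%N * env2 11%N.

(** By the universal property of the generators, this makes the coproduct exist. *)
Lemma coproduct_deformed v : holds eta (env_of [:: v; T1 * T2 + V1 * V2;
  T1 * T2 - V1 * V2; env1 3%N * T2 + V1 * env2 3%N; env1 4%N * T2 + V1 * env2 4%N;
  env1 5%N + env2 5%N; env1 6%N * env2 11%N + env1 10%N * env2 6%N;
  env1 7%N * env2 11%N + env1 10%N * env2 7%N]) deformed_rels.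
Proof.
have d : holds eta env (subst_rels coproduct deformed_rels).
  by apply: (nc_all_sound (n := 100%N) tensor_rule_sound); vm_compute.
exact: ((holds_subst env coproduct _).1 d).
Qed.

Lemma coproduct_descendants_hold :
  let F := env1 4%N * T2 + V1 * env2 4%N in
  let X x := env1 x * env2 11%N + env1 10%N * env2 x in
  let Y x y := env1 y * env2 10%N + env1 11%N * env2 y
    + eta *: (V1 * env1 x * (env2 3%N * env2 11%N + env2 11%N * env2 3%N))
    - eta *: ((env1 3%N * env1 10%N + env1 10%N * env1 3%N) * (T2 * env2 x)) in
  F * X 6%N - X 6%N * F = Y 6%N 8%N /\ F * X 7%N - X 7%N * F = Y 7%N 9%N.
Proof.
have d : holds eta env coproduct_descendants.
  by apply: (nc_all_sound (n := 100%N) tensor_rule_sound); vm_compute.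
by case: d => d1 [d2 _].
Qed.

Lemma coproduct_H2_hold :
  (env1 5%N + env2 5%N) *+ 4
    - (T1 * T2 + V1 * V2) * (env1 3%N * T2 + V1 * env2 3%N)
  = (env1 5%N *+ 4 - (T1 + V1) * env1 3%N) + (env2 5%N *+ 4 - (T2 + V2) * env2 3%N)
    + T1 * env1 3%N * (1 - T2 * T2) + (1 - V1 * V1) * (V2 * env2 3%N).
Proof.
have d : holds eta env [:: (
  (xZ + shift xZ) *+ 4 - ((xt * xt) * shift (xt * xt) + (xu * xu) * shift (xu * xu))
    * (xH * shift (xt * xt) + (xu * xu) * shift xH),
  (xZ *+ 4 - (xt * xt + xu * xu) * xH) + shift (xZ *+ 4 - (xt * xt + xu * xu) * xH)
  + xt * xt * xH * (1 - shift (xt * xt * (xt * xt)))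
  + (1 - xu * xu * (xu * xu)) * shift (xu * xu * xH))]%nc.
  by apply: (nc_all_sound (n := 100%N) tensor_rule_sound); vm_compute.
by case: d.
Qed.
End Coproduct.

Definition rev_rels (rels : relations) : relations :=
  [seq (nc_rev r.1, nc_rev r.2) | r <- rels].

Section RootConsequences.
Variable env : nat -> A.
Hypothesis rules : holds eta env root_rules.
Let T := env 10%N * env 10%N.
Let V := env 11%N * env 11%N.

Lemma antipode_descendants_hold :
  env 6%N * (T * env 4%N * V) - T * env 4%N * V * env 6%N
    = - (env 4%N * env 6%N - env 6%N * env 4%N) - eta *: ((T + V) * env 6%N) *+ 4
  /\ env 7%N * (T * env 4%N * V) - T * env 4%N * V * env 7%N
    = - (env 4%N * env 7%N - env 7%N * env 4%N) - eta *: ((T + V) * env 7%N) *+ 4.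
Proof.
have d : holds eta env (subst_rels descendants [::
  (xE * (xt * xt * xF * (xu * xu)) - xt * xt * xF * (xu * xu) * xE,
   - comm xF xE - NEta ((xt * xt + xu * xu) * xE) *+ 4);
  (xG * (xt * xt * xF * (xu * xu)) - xt * xt * xF * (xu * xu) * xG,
   - comm xF xG - NEta ((xt * xt + xu * xu) * xG) *+ 4)]%nc).
  by apply: (nc_derive (n := 100%N) rules); vm_compute.
by case: d => d1 [d2 _].
Qed.

Lemma antipode_H2_hold :
  T * env 3%N * V * (T + V) = (T + V) * env 3%N + (V * V - 1) *+ 4.
Proof.
have d : holds eta env [:: (xt * xt * xH * (xu * xu) * (xt * xt + xu * xu),
   (xt * xt + xu * xu) * xH + (xu * xu * (xu * xu) - 1) *+ 4)]%nc.
  by apply: (nc_derive (n := 100%N) rules); vm_compute.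
by case: d.
Qed.
End RootConsequences.

Section Antipode.
Variables (env : nat -> A) (i : A).
Hypothesis rules : holds eta env root_rules.
Hypothesis imaginary : i * i = -1.
Hypothesis central : forall x, x * i = i * x.

(** A graded antihomomorphism becomes an ordinary one when its values on odd elements
    are multiplied by i, for then a product of two odd elements acquires the sign
    i ^ 2 = -1. So the relations, read backwards, are checked for the twisted
    images. *)
Lemma antipode_deformed v :
  let T := env 10%N * env 10%N in let V := env 11%N * env 11%N in
  holds eta (env_of [:: v; T + V; V - T; - (T * env 3%N * V); - (T * env 4%N * V);
    - env 5%N; i * env 6%N; i * env 7%N]) (rev_rels deformed_rels).
Proof.
pose env' (j : nat) := if j == 14%N then i else env j.
have rules' : holds eta env' antipode_rules.
  split; first exact: imaginary.
  have h : holds eta env' root_rules by exact: rules.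
  by do 9?[split; first exact: central].
have d : holds eta env' (subst_rels antipode_images (rev_rels deformed_rels)).
  by apply: (nc_derive (n := 100%N) rules'); vm_compute.
exact: ((holds_subst env' antipode_images _).1 d).
Qed.
End Antipode.

Lemma trivial_deformed v : holds eta (env_of [:: v; 1 *+ 2; 0; 0; 0; 0; 0; 0 : A]) deformed_rels.
Proof.
have rules : holds eta (env_of [:: v; 1 *+ 2; 0; 0; 0; 0; 0; 0 : A])
    [:: (xW, 1 *+ 2); (xe, 0); (xH, 0); (xF, 0); (xZ, 0); (xE, 0); (xG, 0)]%nc by [].
by apply: (nc_derive (n := 60%N) rules); vm_compute.
Qed.
End Relations.

(** * Formal power series in the deformation parameter *)

Section FpsCoefficients.
Variables (k : comNzRingType) (V : lmodType k).
Implicit Types (x y : {fps V}) (c : {fps k}).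

Lemma fps_scale_coef0 c x : (c *: x) 0%N = c 0%N *: x 0%N.
Proof. by rewrite fps_scaleE big_ord1 subn0. Qed.

Lemma fps_scaleC_coef (c : k) x n : (c%:S *: x) n = c *: x n.
Proof. by rewrite [LHS]fconvCl // => *; exact: scalerDl. Qed.

Lemma hpar_coef0 x : (hpar *: x) 0%N = 0.
Proof. by rewrite fps_scale_coef0 scale0r. Qed.

Lemma hpar_coefS x n : (hpar *: x) n.+1 = x n.
Proof.
rewrite fps_scaleE 2!big_ord_recl big1 => [|i _]; last by rewrite scale0r.
by rewrite /= scale0r add0r scale1r addr0 subSS subn0.
Qed.

Lemma hpar_inj : injective (fun x => hpar *: x).
Proof. by move=> x y /= e; apply/funext => n; rewrite -(hpar_coefS x) e hpar_coefS. Qed.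

Lemma fps_decomp x : x = (x 0%N)%:S + hpar *: ((fun n => x n.+1) : {fps V}).
Proof.
by apply/funext=> -[|n]; rewrite fps_addE ?hpar_coef0 ?hpar_coefS ?addr0 ?add0r.
Qed.

Lemma fpsCD (a b : V) : (a + b)%:S = a%:S + b%:S.
Proof. by apply/funext => -[|n] //; rewrite fps_addE addr0. Qed.

Lemma fpsC0 : (0 : V)%:S = 0. Proof. by apply/funext => -[]. Qed.

Lemma fpsCN (a : V) : (- a)%:S = - a%:S.
Proof. by apply/eqP; rewrite -addr_eq0 -fpsCD addNr fpsC0. Qed.

Lemma fpsCZ (c : k) (a : V) : (c *: a)%:S = c%:S *: a%:S.
Proof. by apply/funext => -[|n]; rewrite fps_scaleC_coef //= scaler0. Qed.

Lemma fpsCMn (a : V) n : (a *+ n)%:S = a%:S *+ n.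
Proof. by elim: n => [|n IH]; rewrite ?mulr0n ?fpsC0 // !mulrS fpsCD IH. Qed.
End FpsCoefficients.

Section FpsProduct.
Variables (k : comNzRingType) (A : algType k).
Implicit Types (x y : {fps A}).

Lemma fps_mul_coef0 x y : (x * y) 0%N = x 0%N * y 0%N.
Proof. by rewrite fps_mulE big_ord1 subn0. Qed.

Lemma fpsCM (a b : A) : (a * b)%:S = a%:S * b%:S.
Proof.
apply/funext => n; rewrite [RHS]fconvCl; last by move=> *; exact: mulrDl.
by case: n => //= n; rewrite mulr0.
Qed.

(** The geometric series in 1 - x, whose partial sums stabilise in each degree. *)
Lemma fps_right_inverse x : x 0%N = 1 -> exists2 y, x * y = 1 & y 0%N = 1.
Proof.
move=> x0; pose s N : {fps A} := \sum_(i < N) (1 - x) ^+ i.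
have low N : forall n, (n < N)%N -> ((1 - x) ^+ N) n = 0.
  elim: N => // N IH n nN; rewrite exprS fps_mulE big1 // => -[[|i] /= iN] _.
    by rewrite fps_addE fps_oppE x0 subrr mul0r.
  rewrite IH ?mulr0 //.
  by case: n nN iN => // n nN iN; rewrite subSS (leq_ltn_trans (leq_subr _ _)).
have sE N M n : (n < N)%N -> (N <= M)%N -> s M n = s N n.
  move=> nN /subnK <-; elim: (M - N)%N => // d IH.
  by rewrite addSn /s big_ord_recr /= -/(s _) fps_addE IH low ?addr0 // ltn_addl.
exists (fun n => s n.+1 n); last by rewrite /s big_ord1 expr0.
apply/funext => n.
have -> : (x * ((fun n => s n.+1 n) : {fps A})) n = (x * s n.+1) n.
  apply: eq_bigr => i _; congr (_ * _); apply/esym/sE => //.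
  by rewrite ltnS leq_subr.
have -> : x * s n.+1 = 1 - (1 - x) ^+ n.+1.
  elim: n.+1 => [|N IH]; first by rewrite /s big_ord0 mulr0 expr0 subrr.
  rewrite /s big_ord_recr /= mulrDr IH exprS mulrBl mul1r opprB.
  by rewrite -addrA [- _ + _]addrC.
by rewrite fps_addE fps_oppE low // subr0.
Qed.

Lemma fps_inverse x : x 0%N = 1 -> exists y, [/\ x * y = 1, y * x = 1 & y 0%N = 1].
Proof.
move=> /fps_right_inverse[y xy y0].
have [z yz _] := fps_right_inverse y0.
exists y; split=> //.
suff -> : x = z by [].
by rewrite -[x]mulr1 -yz mulrA xy mul1r.
Qed.
End FpsProduct.

Section SquareRoot.
Variables (k : numFieldType) (A : algType k).
Implicit Types (x y : {fps A}).

(** The coefficient of degree n reads 2 y_n = 0 once the lower ones vanish. For y a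
    commutator [z, x], this shows that what commutes with x ^ 2 commutes with x. *)
Lemma fps_anticommutant0 x y : x 0%N = 1 -> x * y + y * x = 0 -> y = 0.
Proof.
move=> x0 xy; apply/funext => n; elim/ltn_ind: n => n IH.
have := congr1 (@^~ n) xy; rewrite fps_addE !fps_mulE.
rewrite big_ord_recl big_ord_recr /= subn0 subnn x0 mul1r mulr1.
rewrite big1 => [|i _]; last by rewrite IH ?mulr0 // /bump /= ltn_subrL; case: n i {IH} => [[]|].
rewrite big1 => [|i _]; last by rewrite IH ?mul0r.
rewrite addr0 add0r -mulr2n -scaler_nat => /eqP.
by rewrite scaler_eq0 pnatr_eq0 /= => /eqP.
Qed.

(** The commutator of y with the square root anticommutes with the square root. *)
Lemma fps_sqrt_commute x y : x 0%N = 1 -> y * x = x * y ->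
  y * fps_sqrt x = fps_sqrt x * y.
Proof.
move=> x0 yx; apply/eqP; rewrite -subr_eq0; apply/eqP.
apply: (fps_anticommutant0 (x := fps_sqrt x)) => //.
rewrite mulrBr mulrBl !mulrA addrC addrA subrK -(mulrA y) fps_sqrtK // yx.
by rewrite subrr.
Qed.

Lemma fps_sqrt_inverse x y : x 0%N = 1 -> y 0%N = 1 -> x * y = 1 -> y * x = 1 ->
  fps_sqrt x * fps_sqrt y = 1 /\ fps_sqrt y * fps_sqrt x = 1.
Proof.
move=> x0 y0 xy yx.
have c1 : y * fps_sqrt x = fps_sqrt x * y by apply: fps_sqrt_commute x0 _; rewrite xy.
have c2 : fps_sqrt x * fps_sqrt y = fps_sqrt y * fps_sqrt x.
  by apply: fps_sqrt_commute y0 _; rewrite c1.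
suff e1 : fps_sqrt x * fps_sqrt y = 1 by rewrite -c2.
have r0 : (fps_sqrt x * fps_sqrt y) 0%N = 1 by rewrite fps_mul_coef0 mulr1.
rewrite (fps_sqrt_unique r0 erefl) [RHS](@fps_sqrt_unique k A 1 1) ?mulr1 //.
congr fps_sqrt; rewrite -mulrA (mulrA (fps_sqrt y)) -c2 -(mulrA (fps_sqrt x)).
by rewrite fps_sqrtK // mulrA fps_sqrtK.
Qed.
End SquareRoot.

Section LinearMaps.
Variables (k : comNzRingType) (V W : lmodType k).

(** Linearity over series forces continuity, so constant series determine a map. *)
Lemma linear_fps_eq (f g : {fps V} -> {fps W}) : linear f -> linear g ->
  (forall a, f a%:S = g a%:S) -> f =1 g.
Proof.
move=> lf lg fg x; apply/funext => n; elim: n x => [|n IH] x;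
  rewrite (fps_decomp x) addrC lf lg fg !fps_addE ?hpar_coef0 // !hpar_coefS.
by rewrite IH.
Qed.

Definition fps_extend (phi : V -> {fps W}) (x : {fps V}) : {fps W} :=
  fconv (fun a (j : nat) => phi a j) x id.

Lemma fps_extend_linear phi : linear_for (fun (c : k) (y : {fps W}) => c%:S *: y) phi ->
  linear (fps_extend phi).
Proof.
move=> lphi.
have pD a b : phi (a + b) = phi a + phi b.
  by have := lphi 1 a b; rewrite !scale1r.
have p0 : phi 0 = 0 by apply: (addrI (phi 0)); rewrite -pD !addr0.
have pZ c a : phi (c *: a) = c%:S *: phi a by rewrite -[c *: a]addr0 lphi p0 addr0.
move=> c x y.
have -> : c *: fps_extend phi x = fps_extend phi (c *: x).
  pose ap (a : V) (j : nat) := phi a j.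
  refine (@fconvA k V nat V W W ap *:%R *:%R ap _ _ _ _ _ c x id)
    => [d a j|j|a b j|d|d u w]; rewrite /ap.
  - by rewrite pZ fps_scaleC_coef.
  - by rewrite p0.
  - by rewrite pD.
  - by rewrite scaler0.
  - by rewrite scalerDr.
apply/funext => n; rewrite fps_addE -big_split; apply: eq_bigr => i _.
by rewrite /= fps_addE pD.
Qed.

Lemma fps_extendC phi a : phi 0 = 0 -> fps_extend phi a%:S = phi a.
Proof.
move=> p0; apply/funext => n; rewrite /fps_extend /fconv big_ord_recl /= subn0.
by rewrite big1 ?addr0 // => i _; rewrite p0.
Qed.
End LinearMaps.

(** * Completed tensor products of superalgebras *)

Section CompletedTensor.
Variables (k : comNzRingType) (V W : lmodType k).
Implicit Types (x : {fps V}) (y : {fps W}) (c : {fps k}).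

Lemma fps_tpurePl y c x x' : (c *: x + x') *T y = c *: (x *T y) + x' *T y.
Proof.
rewrite {1}/fps_tpure fconvDl; last by move=> *; exact: tpureDl.
congr (_ + _); apply/esym.
apply: (@fconvA k V W V (tens V W) (tens V W) tpure *:%R *:%R tpure).
- by move=> *; rewrite tpureZl.
- by move=> *; rewrite tpure0l.
- by move=> *; rewrite tpureDl.
- by move=> *; rewrite scaler0.
- by move=> *; rewrite scalerDr.
Qed.

Lemma fps_tpurePr x c y y' : x *T (c *: y + y') = c *: (x *T y) + x *T y'.
Proof.
rewrite {1}/fps_tpure fconvDr; last by move=> *; exact: tpureDr.
congr (_ + _); apply/funext => n.
have swap (v : {fps V}) (w : {fps W}) : v *T w = fconv (fun b a => tpure a b) w v.
  by apply/funext => i; rewrite [LHS]fconvE_rev.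
rewrite -/(x *T _) !swap; congr (_ n); apply/esym.
apply: (@fconvA k W V W (tens V W) (tens V W) (fun b a => tpure a b) *:%R *:%R
  (fun b a => tpure a b)).
- by move=> *; rewrite tpureZr.
- by move=> *; rewrite tpure0r.
- by move=> *; rewrite tpureDr.
- by move=> *; rewrite scaler0.
- by move=> *; rewrite scalerDr.
Qed.

Lemma fps_tpureC (a : V) (b : W) : a%:S *T b%:S = (a *t b)%:S.
Proof.
apply/funext => n; rewrite /fps_tpure fconvCl; last by move=> *; exact: tpureDl.
by case: n => //= n; rewrite tpure0r.
Qed.
End CompletedTensor.

Section CompletedTensorAdditive.
Variables (k : comNzRingType) (V W : lmodType k).
Implicit Types (x : {fps V}) (y : {fps W}) (c : {fps k}).

Lemma fps_tpureDl x x' y : (x + x') *T y = x *T y + x' *T y.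
Proof. by rewrite -[x]scale1r fps_tpurePl !scale1r. Qed.

Lemma fps_tpureDr x y y' : x *T (y + y') = x *T y + x *T y'.
Proof. by rewrite -[y]scale1r fps_tpurePr !scale1r. Qed.

Lemma fps_tpure0l y : (0 : {fps V}) *T y = 0.
Proof. by apply: (addrI (0 *T y)); rewrite -fps_tpureDl !addr0. Qed.

Lemma fps_tpure0r x : x *T (0 : {fps W}) = 0.
Proof. by apply: (addrI (x *T 0)); rewrite -fps_tpureDr !addr0. Qed.

Lemma fps_tpureZl c x y : (c *: x) *T y = c *: (x *T y).
Proof. by rewrite -[c *: x]addr0 fps_tpurePl fps_tpure0l addr0. Qed.

Lemma fps_tpureZr c x y : x *T (c *: y) = c *: (x *T y).
Proof. by rewrite -[c *: y]addr0 fps_tpurePr fps_tpure0r addr0. Qed.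

Lemma fps_tpureNl x y : (- x) *T y = - (x *T y).
Proof. by rewrite -scaleN1r fps_tpureZl scaleN1r. Qed.

Lemma fps_tpureNr x y : x *T (- y) = - (x *T y).
Proof. by rewrite -scaleN1r fps_tpureZr scaleN1r. Qed.
End CompletedTensorAdditive.

Lemma linear_mull (K : comNzRingType) (A : algType K) (a : A) c x y :
  a * (c *: x + y) = c *: (a * x) + a * y.
Proof. by rewrite mulrDr -scalerAr. Qed.

Lemma linear_mulr (K : comNzRingType) (A : algType K) (a : A) c x y :
  (c *: x + y) * a = c *: (x * a) + y * a.
Proof. by rewrite mulrDl -scalerAl. Qed.

Lemma fps_spartC (k : comNzRingType) (A : superAlgType k) d (a : A) :
  spart d a%:S = (spart d a)%:S :> {fps A}.
Proof. by apply/funext => -[|n] //; exact: linear0. Qed.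

Section CompletedTensorSuper.
Variables (k : fieldType) (A B : superAlgType k).
Implicit Types (x : {fps A}) (y : {fps B}).

(** Both sides are linear in each of the four series, which reduces the sign rule to
    constants; the other identities of this part are proved in the same way. *)
Lemma fps_tmul_spart (i j : bool) x y x' y' :
  (x *T spart i y) * (spart j x' *T y')
  = (-1) ^+ (i && j) *: ((x * spart j x') *T (spart i y * y')) :> {fps tens A B}.
Proof.
have hC (e : bool) (V : lmodType k) (v : V) :
    (-1) ^+ e *: v%:S = ((-1) ^+ e *: v)%:S :> {fps V}.
  by rewrite fpsCZ; congr (_ *: _); case: e => //; exact/esym/(@fpsCN k k^o).
pose lin := (@linear_mull, @linear_mulr, @fps_tpurePl, @fps_tpurePr, scalerDr).
have sw (c d : {fps k}) (u : {fps tens A B}) : c *: (d *: u) = d *: (c *: u).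
  by rewrite !scalerA mulrC.
move: x; apply: linear_fps_eq => [c u w|c u w|a].
- by rewrite fps_tpurePl linear_mulr.
- by rewrite linear_mulr fps_tpurePl scalerDr sw.
move: y; apply: linear_fps_eq => [c u w|c u w|b].
- by rewrite linearP fps_tpurePr linear_mulr.
- by rewrite linearP linear_mulr fps_tpurePr scalerDr sw.
move: x'; apply: linear_fps_eq => [c u w|c u w|a'].
- by rewrite linearP fps_tpurePl linear_mull.
- by rewrite linearP linear_mull fps_tpurePl scalerDr sw.
move: y'; apply: linear_fps_eq => [c u w|c u w|b'].
- by rewrite fps_tpurePr linear_mull.
- by rewrite linear_mull fps_tpurePr scalerDr sw.
rewrite !fps_spartC -!fpsCM !fps_tpureC -fpsCM hC; congr (_%:S).
by apply: tmul_homog; exact: sparts.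
Qed.

Lemma fps_tmul_homog (i j : bool) x y x' y' : homogeneous i y -> homogeneous j x' ->
  (x *T y) * (x' *T y') = (-1) ^+ (i && j) *: ((x * x') *T (y * y')) :> {fps tens A B}.
Proof. by move=> hy hx; have := fps_tmul_spart i j x y x' y'; rewrite hy hx. Qed.

Lemma fps_tpure1 : (1 : {fps A}) *T (1 : {fps B}) = 1.
Proof. exact: fps_tpureC. Qed.

Lemma fps_tmul_even x y x' y' : homogeneous false y \/ homogeneous false x' ->
  (x *T y) * (x' *T y') = (x * x') *T (y * y') :> {fps tens A B}.
Proof.
case=> h.
  rewrite -[x']spart_sum fps_tpureDl !mulrDr fps_tpureDl.
  by rewrite !(fps_tmul_homog _ _ h (sparts _ _)) !scale1r.
rewrite -[y]spart_sum fps_tpureDr !mulrDl fps_tpureDr.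
by rewrite !(fps_tmul_homog _ _ (sparts _ _) h) andbF !scale1r.
Qed.

Lemma homog_tpure (i j : bool) x y : homogeneous i x -> homogeneous j y ->
  homogeneous (i (+) j) (x *T y : {fps tens A B}).
Proof.
move=> <- <-; rewrite /homogeneous.
move: x; apply: linear_fps_eq => [c u w|c u w|a].
- by rewrite linearP fps_tpurePl linearP.
- by rewrite linearP fps_tpurePl.
move: y; apply: linear_fps_eq => [c u w|c u w|b].
- by rewrite linearP fps_tpurePr linearP.
- by rewrite linearP fps_tpurePr.
rewrite !fps_spartC fps_tpureC fps_spartC; congr (_%:S).
have := tspart_homogE (i (+) j) (sparts i a) (sparts j b).
by rewrite eqxx.
Qed.

Lemma fps_tpure_1r_linear : linear (fun x : {fps A} => x *T (1 : {fps B})).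
Proof. by move=> c u w; rewrite fps_tpurePl. Qed.

Lemma fps_tpure_1l_linear : linear (fun y : {fps B} => (1 : {fps A}) *T y).
Proof. by move=> c u w; rewrite fps_tpurePr. Qed.
End CompletedTensorSuper.

Section TensorMap.
Variables (k : fieldType).

Lemma bilin_fps (V W V' W' : lmodType k) (f : {fps V} -> {fps V'})
    (g : {fps W} -> {fps W'}) n : linear f -> linear g ->
  bilin (fun a b => (f a%:S *T g b%:S) n).
Proof.
move=> lf lg; split=> [b c a a'|a c b b'].
- by rewrite fpsCD fpsCZ lf fps_tpurePl fps_addE fps_scaleC_coef.
- by rewrite fpsCD fpsCZ lg fps_tpurePr fps_addE fps_scaleC_coef.
Qed.

Variables (V W V' W' : lmodType k).
Variables (f : {fps V} -> {fps V'}) (g : {fps W} -> {fps W'}).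
Hypotheses (lf : linear f) (lg : linear g).

Let phi (z : tens V W) : {fps tens V' W'} :=
  fun n => tlift (fun a b => (f a%:S *T g b%:S) n) z.

Let phi_pure a b : phi (a *t b) = f a%:S *T g b%:S.
Proof. by apply/funext => n; rewrite /phi (tliftE (bilin_fps n lf lg)). Qed.

Let phi_linear : linear_for (fun (c : k) (y : {fps tens V' W'}) => c%:S *: y) phi.
Proof.
move=> c u w; apply/funext => n.
by rewrite fps_addE fps_scaleC_coef /phi (tlift_is_linear (bilin_fps n lf lg)).
Qed.

Lemma fps_tmap_linear : linear (fps_tmap f g).
Proof. exact: (fps_extend_linear phi_linear). Qed.

Lemma fps_tmap_pure x y : fps_tmap f g (x *T y) = f x *T g y.
Proof.
move: x; apply: linear_fps_eq => [c u w|c u w|a].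
- by rewrite fps_tpurePl fps_tmap_linear.
- by rewrite lf fps_tpurePl.
move: y; apply: linear_fps_eq => [c u w|c u w|b].
- by rewrite fps_tpurePr fps_tmap_linear.
- by rewrite lg fps_tpurePr.
rewrite fps_tpureC -phi_pure; apply: (@fps_extendC k (tens V W)).
by apply/funext => n; exact: tlift0 (bilin_fps n lf lg).
Qed.
End TensorMap.

Section TensorMapMorphism.
Variables (k : fieldType) (A B A' B' : superAlgType k).
Variables (f : {fps A} -> {fps A'}) (g : {fps B} -> {fps B'}).
Hypotheses (fm : superalg_morphism f) (gm : superalg_morphism g).

Lemma fps_tmap_1 : fps_tmap f g 1 = 1.
Proof.
rewrite -fps_tpure1 (fps_tmap_pure (smor_linear fm) (smor_linear gm)).
by rewrite (smor_1 fm) (smor_1 gm) fps_tpure1.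
Qed.

Lemma fps_tmap_M x y : fps_tmap f g (x * y) = fps_tmap f g x * fps_tmap f g y.
Proof.
have lm := fps_tmap_linear (smor_linear fm) (smor_linear gm).
move: x; apply: linear_fps_eq => [c u w|c u w|x].
- by rewrite linear_mulr lm.
- by rewrite lm linear_mulr.
move: y; apply: linear_fps_eq => [c u w|c u w|y].
- by rewrite linear_mull lm.
- by rewrite lm linear_mull.
have mD u w : fps_tmap f g (u + w) = fps_tmap f g u + fps_tmap f g w.
  by rewrite -[u]scale1r lm !scale1r.
elim/tens_homog_ind: x => [i j a b ai bj|u w IHu IHw]; last first.
  by rewrite fpsCD mulrDl !mD IHu IHw mulrDl.
elim/tens_homog_ind: y => [i' j' a' b' ai' bj'|u w IHu IHw]; last first.
  by rewrite fpsCD mulrDr !mD IHu IHw mulrDr.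
rewrite -!fps_tpureC.
have hC (C : superAlgType k) d (c : C) : homogeneous d c -> homogeneous d (c%:S : {fps C}).
  by rewrite /homogeneous fps_spartC => ->.
have hf : homogeneous i' (f a'%:S) by rewrite /homogeneous -(smor_even fm) hC.
have hg : homogeneous j (g b%:S) by rewrite /homogeneous -(smor_even gm) hC.
rewrite (fps_tmul_homog _ _ (hC _ _ _ bj) (hC _ _ _ ai')).
rewrite !(fps_tmap_pure (smor_linear fm) (smor_linear gm)) (fps_tmul_homog _ _ hg hf).
have mZ c u : fps_tmap f g (c *: u) = c *: fps_tmap f g u.
  have m0 : fps_tmap f g 0 = 0 by apply: (addrI (fps_tmap f g 0)); rewrite -mD !addr0.
  by rewrite -[c *: u]addr0 lm m0 addr0.
rewrite mZ (fps_tmap_pure (smor_linear fm) (smor_linear gm)).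
by rewrite (smor_M fm) (smor_M gm).
Qed.
End TensorMapMorphism.

Section FpsMap.
Variables (k : comNzRingType) (V W : lmodType k) (l : V -> W).
Hypothesis ll : linear l.

Lemma fps_map_linear : linear (fps_map l).
Proof.
have lD a b : l (a + b) = l a + l b by rewrite -[a]scale1r ll !scale1r.
have l0 : l 0 = 0 by apply: (addrI (l 0)); rewrite -lD !addr0.
have lZ c a : l (c *: a) = c *: l a by rewrite -[c *: a]addr0 ll l0 addr0.
move=> c x y; apply/funext => n; rewrite /fps_map !fps_addE lD; congr (_ + _).
rewrite !fps_scaleE (big_morph l lD l0); apply: eq_bigr => i _; exact: lZ.
Qed.

Lemma fps_mapC a : fps_map l a%:S = (l a)%:S.
Proof.
have l0 : l 0 = 0.
  by apply: (addrI (l 0)); rewrite -[X in X + _]scale1r -ll scale1r !addr0.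
by apply/funext => -[|n].
Qed.
End FpsMap.

Section StructureMaps.
Variables (k : fieldType) (U : superAlgType k).
Implicit Types (x y z : {fps U}).

Lemma tassoc_pure_bilin (c : U) :
  bilin (fun a b : U => a *t (b *t c) : tens U (tens U U)).
Proof.
by split=> [b d a a'|a d b b']; rewrite !(tpureDl, tpureDr, tpureZl, tpureZr).
Qed.

Lemma tassoc_bilin : bilin (fun (x : tens U U) (c : U) =>
  tlift (fun a b => a *t (b *t c) : tens U (tens U U)) x).
Proof.
split=> [c|x d c c']; first exact: tlift_is_linear (tassoc_pure_bilin c).
elim/tens_ind: x => [a b|x y IHx IHy].
  by rewrite !(tliftE (tassoc_pure_bilin _)) !(tpureDr, tpureZr).
by rewrite !(tliftD (tassoc_pure_bilin _)) IHx IHy scalerDr addrACA.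
Qed.

Lemma tassoc_linear : linear (@tassoc k U U U).
Proof. exact: tlift_is_linear tassoc_bilin. Qed.

Lemma tassoc_pure (a b c : U) : tassoc ((a *t b) *t c) = a *t (b *t c).
Proof. by rewrite /tassoc (tliftE tassoc_bilin) (tliftE (tassoc_pure_bilin c)). Qed.

Lemma tunitl_bilin : bilin (fun (c : k^o) (a : U) => (c : k) *: a).
Proof.
split=> [b c a a'|a c b b'].
  by rewrite scalerDl scalerA.
by rewrite scalerDr !scalerA mulrC.
Qed.

Lemma tunitr_bilin : bilin (fun (a : U) (c : k^o) => (c : k) *: a).
Proof.
split=> [b c a a'|a c b b'].
  by rewrite scalerDr !scalerA mulrC.
by rewrite scalerDl scalerA.
Qed.

Lemma tmult_bilin : bilin (fun a b : U => a * b).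
Proof. by split=> [b c a a'|a c b b']; rewrite ?linear_mulr ?linear_mull. Qed.

Lemma fps_assoc_linear : linear (fps_map (@tassoc k U U U)).
Proof. exact: fps_map_linear tassoc_linear. Qed.

Lemma fps_unitl_linear : linear (fps_map (@tunitl k U)).
Proof. exact: fps_map_linear (tlift_is_linear tunitl_bilin). Qed.

Lemma fps_unitr_linear : linear (fps_map (@tunitr k U)).
Proof. exact: fps_map_linear (tlift_is_linear tunitr_bilin). Qed.

Lemma fps_mult_linear : linear (fps_map (@tmult k U)).
Proof. exact: fps_map_linear (tlift_is_linear tmult_bilin). Qed.

Lemma fps_assoc_pure x y z : fps_map (@tassoc k U U U) ((x *T y) *T z) = x *T (y *T z).
Proof.
move: x; apply: linear_fps_eq => [c u w|c u w|x].
- by rewrite !fps_tpurePl fps_assoc_linear.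
- by rewrite fps_tpurePl.
move: y; apply: linear_fps_eq => [c u w|c u w|y].
- by rewrite fps_tpurePr fps_tpurePl fps_assoc_linear.
- by rewrite fps_tpurePl fps_tpurePr.
move: z; apply: linear_fps_eq => [c u w|c u w|z].
- by rewrite fps_tpurePr fps_assoc_linear.
- by rewrite !fps_tpurePr.
by rewrite !fps_tpureC (fps_mapC tassoc_linear) tassoc_pure.
Qed.

Lemma fps_unitl_pure (c : {fps k^o}) x :
  fps_map (@tunitl k U) (c *T x) = (c : {fps k}) *: x.
Proof.
move: c; apply: linear_fps_eq => [c u w|c u w|c].
- by rewrite fps_tpurePl fps_unitl_linear.
- by rewrite scalerDl scalerA.
move: x; apply: linear_fps_eq => [d u w|d u w|x].
- by rewrite fps_tpurePr fps_unitl_linear.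
- by rewrite scalerDr !scalerA mulrC.
rewrite fps_tpureC (fps_mapC (tlift_is_linear tunitl_bilin)).
by rewrite /tunitl (tliftE tunitl_bilin) fpsCZ.
Qed.

Lemma fps_unitr_pure x (c : {fps k^o}) :
  fps_map (@tunitr k U) (x *T c) = (c : {fps k}) *: x.
Proof.
move: c; apply: linear_fps_eq => [c u w|c u w|c].
- by rewrite fps_tpurePr fps_unitr_linear.
- by rewrite scalerDl scalerA.
move: x; apply: linear_fps_eq => [d u w|d u w|x].
- by rewrite fps_tpurePl fps_unitr_linear.
- by rewrite scalerDr !scalerA mulrC.
rewrite fps_tpureC (fps_mapC (tlift_is_linear tunitr_bilin)).
by rewrite /tunitr (tliftE tunitr_bilin) fpsCZ.
Qed.

Lemma fps_mult_pure x y : fps_map (@tmult k U) (x *T y) = x * y.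
Proof.
move: x; apply: linear_fps_eq => [c u w|c u w|x].
- by rewrite fps_tpurePl fps_mult_linear.
- by rewrite linear_mulr.
move: y; apply: linear_fps_eq => [c u w|c u w|y].
- by rewrite fps_tpurePr fps_mult_linear.
- by rewrite linear_mull.
rewrite fps_tpureC (fps_mapC (tlift_is_linear tmult_bilin)).
by rewrite /tmult (tliftE tmult_bilin) fpsCM.
Qed.
End StructureMaps.

Section StructureMorphisms.
Variables (k : fieldType) (U : superAlgType k).

Lemma fps_map_M (A B : algType k) (l : A -> B) : linear l ->
  (forall x y, l (x * y) = l x * l y) ->
  forall x y, fps_map l (x * y) = fps_map l x * fps_map l y.
Proof.
move=> ll lM x y; apply/funext => n; rewrite fps_mulE /fps_map fps_mulE.
have lD a b : l (a + b) = l a + l b by rewrite -[a]scale1r ll !scale1r.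
have l0 : l 0 = 0 by apply: (addrI (l 0)); rewrite -lD !addr0.
by rewrite (big_morph l lD l0); apply: eq_bigr => i _.
Qed.

Lemma tens3_homog_ind (P : tens (tens U U) U -> Prop) :
  (forall (i j l : bool) a b c, homogeneous i a -> homogeneous j b ->
     homogeneous l c -> P ((a *t b) *t c)) ->
  (forall x y, P x -> P y -> P (x + y)) -> forall x, P x.
Proof.
move=> Pp PD x; elim/tens_ind: x => [x c|]; last exact: PD.
rewrite -[c]spart_sum tpureDr.
have h l : P (x *t spart l c).
  elim/tens_homog_ind: x => [i j a b ai bj|x y IHx IHy]; first exact: Pp ai bj (sparts l c).
  by rewrite tpureDl; apply: PD.
exact: PD.
Qed.

Lemma homog_tpure_const (i j : bool) (a b : U) : homogeneous i a -> homogeneous j b ->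
  homogeneous (i (+) j) (a *t b : tens U U).
Proof.
by move=> ai bj; have := tspart_homogE (i (+) j) ai bj; rewrite eqxx.
Qed.

Lemma tassoc_M x y : @tassoc k U U U (x * y) = tassoc x * tassoc y.
Proof.
have tD u w : @tassoc k U U U (u + w) = tassoc u + tassoc w.
  by rewrite -[u]scale1r (tassoc_linear (U := U)) !scale1r.
have t0 : @tassoc k U U U 0 = 0 by apply: (addrI (tassoc 0)); rewrite -tD !addr0.
have tZ c u : @tassoc k U U U (c *: u) = c *: tassoc u.
  by rewrite -[c *: u]addr0 (tassoc_linear (U := U)) t0 addr0.
elim/tens3_homog_ind: x => [i j l a b c ai bj cl|u w IHu IHw]; last first.
  by rewrite mulrDl !tD IHu IHw mulrDl.
elim/tens3_homog_ind: y => [i' j' l' a' b' c' ai' bj' cl'|u w IHu IHw]; last first.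
  by rewrite mulrDr !tD IHu IHw mulrDr.
rewrite (tmul_homog _ _ cl (homog_tpure_const ai' bj')) (tmul_homog _ _ bj ai').
rewrite tpureZl !tZ !tassoc_pure.
rewrite (tmul_homog _ _ (homog_tpure_const bj cl) ai') (tmul_homog _ _ cl bj').
rewrite tpureZr !scalerA -!signr_addb; congr (_ *: _).
by case: j l i' j' {ai bj cl ai' bj' cl'} => [] [] [] [].
Qed.

Lemma odd_regular0 (c : k^o) : homogeneous true c -> c = 0.
Proof. by move=> <-. Qed.

Lemma tunitl_M x y : @tunitl k U (x * y) = tunitl x * tunitl y.
Proof.
have tD u w : @tunitl k U (u + w) = tunitl u + tunitl w.
  exact: (tliftD (tunitl_bilin U)).
have t0 : @tunitl k U 0 = 0 by exact: tlift0 (tunitl_bilin U).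
elim/tens_homog_ind: x => [i j c a ci aj|u w IHu IHw]; last first.
  by rewrite mulrDl !tD IHu IHw mulrDl.
elim/tens_homog_ind: y => [i' j' c' a' ci' aj'|u w IHu IHw]; last first.
  by rewrite mulrDr !tD IHu IHw mulrDr.
case: i' ci' => ci'; first rewrite (odd_regular0 ci') tpure0l mulr0.
  by rewrite t0 mulr0.
rewrite (tmul_homog _ _ aj ci') andbF scale1r.
rewrite /tunitl !(tliftE (tunitl_bilin U)).
by rewrite -scalerAl -scalerAr scalerA.
Qed.

Lemma tunitr_M x y : @tunitr k U (x * y) = tunitr x * tunitr y.
Proof.
have tD u w : @tunitr k U (u + w) = tunitr u + tunitr w.
  exact: (tliftD (tunitr_bilin U)).
have t0 : @tunitr k U 0 = 0 by exact: tlift0 (tunitr_bilin U).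
elim/tens_homog_ind: x => [j i a c aj ci|u w IHu IHw]; last first.
  by rewrite mulrDl !tD IHu IHw mulrDl.
elim/tens_homog_ind: y => [j' i' a' c' aj' ci'|u w IHu IHw]; last first.
  by rewrite mulrDr !tD IHu IHw mulrDr.
case: i ci => ci; first rewrite (odd_regular0 ci) tpure0r mul0r.
  by rewrite t0 mul0r.
rewrite (tmul_homog _ _ ci aj') scale1r.
rewrite /tunitr !(tliftE (tunitr_bilin U)).
by rewrite -scalerAl -scalerAr scalerA.
Qed.

Lemma fps_assoc_M x y : fps_map (@tassoc k U U U) (x * y)
  = fps_map (@tassoc k U U U) x * fps_map (@tassoc k U U U) y.
Proof. exact: fps_map_M (tassoc_linear (U := U)) tassoc_M _ _. Qed.

Lemma fps_unitl_M x y :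
  fps_map (@tunitl k U) (x * y) = fps_map (@tunitl k U) x * fps_map (@tunitl k U) y.
Proof. exact: fps_map_M (tlift_is_linear (tunitl_bilin U)) tunitl_M _ _. Qed.

Lemma fps_unitr_M x y :
  fps_map (@tunitr k U) (x * y) = fps_map (@tunitr k U) x * fps_map (@tunitr k U) y.
Proof. exact: fps_map_M (tlift_is_linear (tunitr_bilin U)) tunitr_M _ _. Qed.
End StructureMorphisms.

(** * Changing scalars and reversing products *)

Section Restriction.
Variables (k : comNzRingType) (C : algType k).

(** Series over C form an algebra over k alone, and it is as such that they are the
    target of morphisms from U(sl(2|1)). *)
Definition fps_restr : Type := {fps C}.
HB.instance Definition _ := GRing.NzRing.on fps_restr.

Definition restr_scale (c : k) (x : fps_restr) : fps_restr := c%:S *: (x : {fps C}).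
Fact restr_scaleA c d x : restr_scale c (restr_scale d x) = restr_scale (c * d) x.
Proof. by apply/funext => n; rewrite /restr_scale !fps_scaleC_coef scalerA. Qed.
Fact restr_scale1 : left_id 1 restr_scale.
Proof. by move=> x; apply/funext => n; rewrite /restr_scale !fps_scaleC_coef scale1r. Qed.
Fact restr_scaleDr : right_distributive restr_scale +%R.
Proof. by move=> c x y; exact: scalerDr. Qed.
Fact restr_scaleDl x : {morph restr_scale^~ x : c d / c + d}.
Proof.
by move=> c d; apply/funext => n; rewrite fps_addE /restr_scale !fps_scaleC_coef scalerDl.
Qed.
HB.instance Definition _ := GRing.Zmodule_isLmodule.Build k fps_restr
  restr_scaleA restr_scale1 restr_scaleDr restr_scaleDl.
Fact restr_scalerAl (c : k) (x y : fps_restr) : c *: (x * y) = (c *: x) * y.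
Proof. exact: (@scalerAl _ {fps C}). Qed.
HB.instance Definition _ := GRing.Lmodule_isLalgebra.Build k fps_restr restr_scalerAl.
Fact restr_scalerAr (c : k) (x y : fps_restr) : c *: (x * y) = x * (c *: y).
Proof. exact: (@scalerAr _ {fps C}). Qed.
HB.instance Definition _ := GRing.Lalgebra_isAlgebra.Build k fps_restr restr_scalerAr.
End Restriction.

Section Opposite.
Variables (k : comNzRingType) (A : algType k).
(** Antihomomorphisms are handled as morphisms into the converse algebra. *)
HB.instance Definition _ := GRing.Zmodule_isLmodule.Build k (A^c)
  (@scalerA k A) (@scale1r k A) (@scalerDr k A) (@scalerDl k A).
Fact converse_scalerAl (c : k) (x y : A^c) : c *: (x * y) = (c *: x) * y.
Proof. exact: (@scalerAr k A). Qed.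
HB.instance Definition _ := GRing.Lmodule_isLalgebra.Build k (A^c) converse_scalerAl.
Fact converse_scalerAr (c : k) (x y : A^c) : c *: (x * y) = x * (c *: y).
Proof. exact: (@scalerAl k A). Qed.
HB.instance Definition _ := GRing.Lalgebra_isAlgebra.Build k (A^c) converse_scalerAr.
End Opposite.

(** * A presentation of U(sl(2|1)) by its sl(2) and two highest weight vectors *)

(** Here Z = h_1 + 2 h_2 commutes with the subalgebra sl(2) spanned by e, h and f,
    and E = e_3 and G = f_2 are the odd highest weight vectors for it; the generator
    e_2 is recovered as [f, E]. *)
Record sl21_data (A : nzRingType) (e h f Z E G h2 : A) : Prop := Sl21Data {
  dat_Z : Z = h + h2 *+ 2;
  dat_he : h * e = e * h + e *+ 2;
  dat_fe : f * e = e * f - h;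
  dat_fh : f * h = h * f + f *+ 2;
  dat_eZ : e * Z = Z * e;
  dat_hZ : h * Z = Z * h;
  dat_fZ : f * Z = Z * f;
  dat_Ee : E * e = e * E;
  dat_Ge : G * e = e * G;
  dat_Eh : E * h = h * E - E;
  dat_Gh : G * h = h * G - G;
  dat_EZ : E * Z = Z * E + E;
  dat_GZ : G * Z = Z * G - G;
  dat_EE : E * E = 0;
  dat_GG : G * G = 0;
  dat_GE : G * E = e - E * G;
  dat_Df : (f * E - E * f) * f = f * (f * E - E * f);
  dat_Cf : (f * G - G * f) * f = f * (f * G - G * f);
  dat_GD : G * (f * E - E * f) = h2 - (f * E - E * f) * G
}.

Section Presentation.
Variables (k : numFieldType) (A : algType k) (e h f Z E G h2 : A).
Hypothesis dat : sl21_data e h f Z E G h2.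

Definition presentation_map (g : sl21_gen) : A :=
  match g with
  | gen_h node1 => h | gen_h node2 => h2
  | gen_e node1 => e | gen_e node2 => f * E - E * f
  | gen_f node1 => f | gen_f node2 => G
  end.

Let cancel2 (x y : A) : x *+ 2 = y *+ 2 -> x = y.
Proof.
move=> xy; rewrite -[x](half2 x) -[y]half2 -!mulr2n.
by rewrite xy.
Qed.

Let D := f * E - E * f.

Let hD : h * D = D * h - D.
Proof.
have rules : @holds k 0 A (env_of [:: 0; 0; e; 0; 0; Z; E; G; D; 0; 0; 0; h; f])
    [:: (xE * xh, xh * xE - xE); (xf * xh, xh * xf + xf *+ 2)]%nc.
  by split; [exact: dat_Eh dat | split; [exact: dat_fh dat|]].
have : @holds k 0 A (env_of [:: 0; 0; e; 0; 0; Z; E; G; D; 0; 0; 0; h; f])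
    [:: (xh * comm xf xE, comm xf xE * xh - comm xf xE)]%nc.
  by apply: (nc_derive (n := 60%N) rules); vm_compute.
by case.
Qed.

Let eD : e * D - D * e = E.
Proof.
have rules : @holds k 0 A (env_of [:: 0; 0; e; 0; 0; Z; E; G; D; 0; 0; 0; h; f])
    [:: (xE * xe, xe * xE); (xE * xh, xh * xE - xE); (xf * xe, xe * xf - xh)]%nc.
  by split; [exact: dat_Ee dat | split; [exact: dat_Eh dat| split; [exact: dat_fe dat|]]].
have : @holds k 0 A (env_of [:: 0; 0; e; 0; 0; Z; E; G; D; 0; 0; 0; h; f])
    [:: (xe * comm xf xE - comm xf xE * xe, xE)]%nc.
  by apply: (nc_derive (n := 60%N) rules); vm_compute.
by case.
Qed.

Let ZD : Z * D = D * Z - D.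
Proof.
have rules : @holds k 0 A (env_of [:: 0; 0; e; 0; 0; Z; E; G; D; 0; 0; 0; h; f])
    [:: (xE * xZ, xZ * xE + xE); (xf * xZ, xZ * xf)]%nc.
  by split; [exact: dat_EZ dat | split; [exact: dat_fZ dat|]].
have : @holds k 0 A (env_of [:: 0; 0; e; 0; 0; Z; E; G; D; 0; 0; 0; h; f])
    [:: (xZ * comm xf xE, comm xf xE * xZ - comm xf xE)]%nc.
  by apply: (nc_derive (n := 60%N) rules); vm_compute.
by case.
Qed.

(* Commuting f twice with E * E = 0 gives DE + ED = 0 and then 2 D * D = 0. *)
Let DD : D * D = 0.
Proof.
have rules : @holds k 0 A (env_of [:: 0; 0; e; 0; 0; Z; E; G; D; 0; 0; 0; h; f])
    [:: (xE * xE, 0); (xD * xf, xf * xD); (xE * xf, xf * xE - xD)]%nc.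
  split; [exact: dat_EE dat | split; [exact: dat_Df dat| split => //=]].
  by rewrite subKr.
have DE : D * E = - (E * D).
  have : @holds k 0 A (env_of [:: 0; 0; e; 0; 0; Z; E; G; D; 0; 0; 0; h; f])
      [:: (comm xf xE * xE, - (xE * comm xf xE))]%nc.
    apply: (nc_derive (rules := [:: (xE * xE, 0)]%nc) (n := 60%N)); last by vm_compute.
    by split; first exact: dat_EE dat.
  by case.
have rules' : @holds k 0 A (env_of [:: 0; 0; e; 0; 0; Z; E; G; D; 0; 0; 0; h; f])
    [:: (xD * xE, - (xE * xD)); (xD * xf, xf * xD); (xE * xf, xf * xE - xD)]%nc.
  by case: rules => _ h'; split.
have : @holds k 0 A (env_of [:: 0; 0; e; 0; 0; Z; E; G; D; 0; 0; 0; h; f])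
    [:: (xD * xD *+ 2, xf * (xD * xE + xE * xD) - (xD * xE + xE * xD) * xf)]%nc.
  by apply: (nc_derive (n := 60%N) rules'); vm_compute.
case=> /= e1 _; apply: cancel2; rewrite mul0rn.
by move: e1; rewrite /env_of /= DE addNr mulr0 mul0r subrr.
Qed.

(* Since 2 h_2 = Z - h, commutators with h_2 come from those with Z and h. *)
Let h2_comm x a b : Z * x - x * Z = a -> h * x - x * h = b ->
  (h2 * x - x * h2) *+ 2 = a - b.
Proof.
move=> <- <-; rewrite (dat_Z dat) mulrDl mulrDr mulrnAl mulrnAr opprD addrACA.
by rewrite addrC addrK mulrnBl.
Qed.

Lemma presentation_rel s t : sl21_rel s t ->
  ueval presentation_map s = ueval presentation_map t.
Proof.
have N1 (x : A) : (-1)%:A * x = - x by rewrite mulr_algl scaleN1r.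
have P1 (x : A) : 1%:A * x = x by rewrite mulr_algl scale1r.
have Z0 : 0%:A = 0 :> A by rewrite scale0r.
have P2 (x : A) : 2%:A * x = x *+ 2 by rewrite mulr_algl scaler_nat.
have O0 (x : A) : 0%:A * x = 0 by rewrite scale0r mul0r.
have hh2 : h2 * h - h * h2 = 0.
  apply: cancel2; rewrite (@h2_comm h 0 0) ?subrr ?mul0rn //.
  by rewrite (dat_hZ dat) subrr.
have h2e : h2 * e - e * h2 = - e.
  apply: cancel2; rewrite (@h2_comm e 0 (e *+ 2)) ?sub0r ?mulNrn //.
    by rewrite (dat_eZ dat) subrr.
  by rewrite (dat_he dat) addrC addKr.
have h2f : h2 * f - f * h2 = f.
  apply: cancel2; rewrite (@h2_comm f 0 (- (f *+ 2))) ?sub0r ?opprK //.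
    by rewrite (dat_fZ dat) subrr.
  by rewrite (dat_fh dat) opprD addrA subrr sub0r.
have h2D : h2 * D - D * h2 = 0.
  apply: cancel2; rewrite (@h2_comm D (- D) (- D)) ?subrr ?mul0rn //.
    by rewrite ZD addrC addKr.
  by rewrite hD addrC addKr.
have h2G : h2 * G - G * h2 = 0.
  apply: cancel2; rewrite (@h2_comm G G G) ?subrr ?mul0rn //.
    by rewrite (dat_GZ dat) subKr.
  by rewrite (dat_Gh dat) subKr.
case=> [[] []|[] []|[] []|[]||||||] /=;
  rewrite -?/D ?(expr0, expr1, oppr0, opprK, mulr1z, mulrN1z, mulr0z);
  rewrite ?N1 ?P1 ?Z0 ?P2 ?O0 ?N1 ?subrr //.
- by rewrite -[RHS]oppr0 -hh2 opprB.
- by rewrite (dat_he dat) addrC addKr.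
- by rewrite hD addrC addKr.
- by rewrite h2D mul0r.
- by rewrite (dat_fh dat) opprD addrA subrr sub0r.
- by rewrite (dat_Gh dat) subKr opprK.
- by rewrite h2f opprK.
- by rewrite h2G mul0r oppr0.
- by rewrite (dat_fe dat) subKr.
- by rewrite (dat_GD dat) addrC subrK.
- by rewrite (dat_Ge dat) subrr.
- by rewrite (dat_Df dat) subrr.
- by rewrite DD addr0.
- by rewrite (dat_GG dat) addr0.
- by rewrite eD (dat_Ee dat) subrr.
- by rewrite (dat_Cf dat) subrr.
Qed.

Lemma sl21_morphism : exists phi : Usl21 k -> A,
  [/\ linear phi, phi 1 = 1, forall x y, phi (x * y) = phi x * phi y &
      forall g, phi (ugen g) = presentation_map g].
Proof.
exists (ulift presentation_map); split.
- by move=> c x y; rewrite (uliftD presentation_rel) (uliftZ presentation_rel).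
- by rewrite -[1]/(ucst 1) (ulift_cst presentation_rel) scale1r.
- exact: uliftM presentation_rel.
- exact: ulift_gen presentation_rel.
Qed.

Lemma presentation_eD : e * (f * E - E * f) - (f * E - E * f) * e = E.
Proof. exact: eD. Qed.
End Presentation.

Section Usl21Data.
Variable k : numFieldType.
Local Notation U := (Usl21 k).
Local Notation h1 := (ugen (gen_h node1) : U).
Local Notation h2 := (ugen (gen_h node2) : U).
Local Notation e1 := (ugen (gen_e node1) : U).
Local Notation e2 := (ugen (gen_e node2) : U).
Local Notation f1 := (ugen (gen_f node1) : U).
Local Notation f2 := (ugen (gen_f node2) : U).
Definition uZ : U := h1 + h2 *+ 2.

Local Notation E := (ue3 k).

Let env := env_of [:: 0; 0; e1; h2; 0; 0; E; f2; e2; 0; 0; 0; h1; f1].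

(** The defining relations; the letters H and D stand here for h_2 and e_2. *)
Definition chevalley_rels : relations := [::
  (xH * xh, xh * xH);
  (xh * xe, xe * xh + xe *+ 2); (xh * xD, xD * xh - xD);
  (xH * xe, xe * xH - xe); (xH * xD, xD * xH);
  (xh * xf, xf * xh - xf *+ 2); (xh * xG, xG * xh + xG);
  (xH * xf, xf * xH + xf); (xH * xG, xG * xH);
  (xe * xf, xf * xe + xh); (xD * xG, xH - xG * xD);
  (xe * xG, xG * xe); (xD * xf, xf * xD); (xD * xD, 0); (xG * xG, 0);
  (xe * comm xe xD, comm xe xD * xe); (xf * comm xf xG, comm xf xG * xf)]%nc.

Let cancel2 (x y : U) : x *+ 2 = y *+ 2 -> x = y.
Proof.
by move=> xy; rewrite -[x](half2 x) -[y]half2 -!mulr2n xy.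
Qed.

Lemma chevalley_hold : @holds k 0 U env chevalley_rels.
Proof.
have r := @ugen_rel k.
have N1 (x : U) : (-1)%:A * x = - x by rewrite mulr_algl scaleN1r.
have P1 (x : U) : 1%:A * x = x by rewrite mulr_algl scale1r.
have Z0 : 0%:A = 0 :> U by rewrite scale0r.
have P2 (x : U) : 2%:A * x = x *+ 2 by rewrite mulr_algl scaler_nat.
have sw (x y z : U) : x - y = z -> x = y + z by move=> <-; rewrite addrC subrK.
pose simp := (expr0, expr1, oppr0, opprK, mulr1z, mulrN1z, mulr0z, N1, P1, Z0, P2, mul0r).
have c s t : sl21_rel s t -> ueval ugen s = ueval ugen t by exact: ugen_rel.
do ![split] => /=.
- by have := r _ _ (rel_hh k node2 node1); rewrite /= !simp => /sw; rewrite addr0.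
- by have := r _ _ (rel_he k node1 node1); rewrite /= !simp => /sw.
- by have := r _ _ (rel_he k node1 node2); rewrite /= !simp => /sw.
- by have := r _ _ (rel_he k node2 node1); rewrite /= !simp => /sw.
- by have := r _ _ (rel_he k node2 node2); rewrite /= !simp => /sw; rewrite addr0.
- by have := r _ _ (rel_hf k node1 node1); rewrite /= !simp => /sw.
- by have := r _ _ (rel_hf k node1 node2); rewrite /= !simp => /sw.
- by have := r _ _ (rel_hf k node2 node1); rewrite /= !simp => /sw.
- by have := r _ _ (rel_hf k node2 node2); rewrite /= !simp => /sw; rewrite addr0.
- by have := r _ _ (rel_ef k node1); rewrite /= !simp => /sw.
- by have := r _ _ (rel_ef k node2); rewrite /= !simp => /(canRL (addrK _)).
- by have := r _ _ (rel_e1f2 k); rewrite /= !simp => /sw; rewrite addr0.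
- by have := r _ _ (rel_e2f1 k); rewrite /= !simp => /sw; rewrite addr0.
- by have := r _ _ (rel_e2e2 k); rewrite /= !simp -mulr2n => e; apply: cancel2; rewrite e mul0rn.
- by have := r _ _ (rel_f2f2 k); rewrite /= !simp -mulr2n => e; apply: cancel2; rewrite e mul0rn.
- by have := r _ _ (rel_e1e1e2 k); rewrite /= !simp => /sw; rewrite addr0.
- by have := r _ _ (rel_f1f1f2 k); rewrite /= !simp => /sw; rewrite addr0.
Qed.

(* The letters Z and E are replaced by their definitions before normalisation. *)
Let derived : relations := [::
  (xf * xe, xe * xf - xh); (xf * xh, xh * xf + xf *+ 2);
  (xe * xZ, xZ * xe); (xh * xZ, xZ * xh); (xf * xZ, xZ * xf);
  (xG * xe, xe * xG); (xE * xh, xh * xE - xE); (xG * xh, xh * xG - xG);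
  (xE * xZ, xZ * xE + xE); (xG * xZ, xZ * xG - xG); (xG * xE, xe - xE * xG);
  (comm xf xE, xD); (xG * xD, xH - xD * xG); (xD * xE, - (xE * xD))]%nc.

Lemma usl21_data : sl21_data e1 h1 f1 uZ E f2 h2.
Proof.
have ch := chevalley_hold.
have [_ [he [_ [_ [_ [_ [_ [_ [_ [_ [_ [_ [Df [_ [GG [Ee [Cf _]]]]]]]]]]]]]]]]] := ch.
pose s := assign [:: xv; xW; xe; xH; xF; xh + xH *+ 2; comm xe xD]%nc.
have d : @holds k 0 U env (subst_rels s derived).
  by apply: (nc_derive (n := 60%N) ch); vm_compute.
have [fe [fh [eZ [hZ [fZ [Ge [Eh [Gh [EZ [GZ [GE [fE [GD [DE _]]]]]]]]]]]]]] :=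
  (holds_subst 0 env s derived).1 d.
rewrite /env_of /= in he fe fh eZ hZ fZ Ge Eh Gh EZ GZ GE fE GD DE Df GG Ee Cf.
have EE : E * E = 0.
  have rules : @holds k 0 U env [:: (xE * xe, xe * xE); (xD * xe, xe * xD - xE)]%nc.
    by split; [exact: (esym Ee) | split => //=; rewrite /env_of /= subKr].
  have : @holds k 0 U env [:: (xE * xE *+ 2,
      xe * (xD * xE + xE * xD) - (xD * xE + xE * xD) * xe)]%nc.
    by apply: (nc_derive (n := 60%N) rules); vm_compute.
  case=> /= e2' _; apply: cancel2; rewrite mul0rn.
  by move: e2'; rewrite /env /env_of /= DE addNr mulr0 mul0r subrr.
have fE' : f1 * E - E * f1 = e2 by exact: fE.
have Df' : (f1 * E - E * f1) * f1 = f1 * (f1 * E - E * f1) by rewrite fE'; exact: Df.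
have GD' : f2 * (f1 * E - E * f1) = h2 - (f1 * E - E * f1) * f2 by rewrite fE'; exact: GD.
exact: (Sl21Data erefl he fe fh eZ hZ fZ (esym Ee) Ge Eh Gh EZ GZ EE GG GE Df'
  (esym Cf) GD').
Qed.

Lemma usl21_descendant : f1 * E - E * f1 = e2.
Proof.
have : @holds k 0 U env [:: (comm xf (comm xe xD), xD)]%nc.
  by apply: (nc_derive (n := 60%N) chevalley_hold); vm_compute.
by case.
Qed.
End Usl21Data.

Section Scaling.
Variables (K : comNzRingType) (eta : K) (A : algType K) (e h f Z E G h2 : A).
Let s (x : A) : A := (eta *: x) *+ 16.

Let sl x y : s x * y = s (x * y). Proof. by rewrite /s mulrnAl -scalerAl. Qed.

Let sr x y : x * s y = s (x * y). Proof. by rewrite /s mulrnAr -scalerAr. Qed.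

Let sD x y : s (x + y) = s x + s y. Proof. by rewrite /s scalerDr mulrnDl. Qed.

Let sN x : s (- x) = - s x. Proof. by rewrite /s scalerN mulNrn. Qed.

Let s0 : s 0 = 0. Proof. by rewrite /s scaler0 mul0rn. Qed.

Let s2 x : s (x *+ 2) = s x *+ 2. Proof. by rewrite /s -scalerMnr mulrnAC. Qed.

Let sC x : f * s x - s x * f = s (f * x - x * f).
Proof. by rewrite sl sr -sN -sD. Qed.

(** The relations are computed with the multiples 2 hbar e_1 and 2 hbar E_3 only. As
    hbar is not a zero divisor on series, nothing is lost. *)
Lemma sl21_scale v W D C : sl21_data e h f Z E G h2 ->
  holds eta (env_of [:: v; W; s e; 0; 0; Z; s E; G; D; C; 0; 0; h; f]) sl21_rels.
Proof.
move=> d.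
have h16 : eta *: ((Z - h) *+ 8) = s h2.
  by rewrite (dat_Z d) addrC addKr /s -mulrnA -scalerMnr.
do ![split]; rewrite /= /env_of /=; rewrite ?sC ?sl ?sr ?sl.
- by rewrite (dat_EZ d) sD.
- exact: dat_GZ d.
- by rewrite (dat_EE d) !s0.
- exact: dat_GG d.
- by rewrite (dat_GE d) sD sN.
- by rewrite (dat_he d) sD s2.
- by rewrite (dat_fe d) sD sN -scalerMnr.
- exact: dat_fh d.
- by rewrite (dat_eZ d).
- exact: dat_hZ d.
- exact: dat_fZ d.
- by rewrite (dat_Ee d).
- by rewrite (dat_Ge d).
- by rewrite (dat_Eh d) sD sN.
- exact: dat_Gh d.
- by rewrite (dat_Df d).
- by rewrite (dat_Cf d).
- by rewrite (dat_GD d) h16 sD sN.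
Qed.

Hypothesis s_inj : injective s.

Lemma sl21_unscale v W : Z = h + h2 *+ 2 ->
  holds eta (env_of [:: v; W; s e; 0; 0; Z; s E; G; 0; 0; 0; 0; h; f]) sl21_rels ->
  sl21_data e h f Z E G h2.
Proof.
move=> Zh.
have h16 : eta *: ((Z - h) *+ 8) = s h2.
  by rewrite Zh addrC addKr /s -mulrnA -scalerMnr.
case=> EZ [GZ [EE [GG [GE [he [fe [fh [eZ [hZ [fZ [Ee [Ge [Eh [Gh [Df [Cf [GD _]]]]]]]]]]]]]]]]].
rewrite /= /env_of /= ?sC ?sl ?sr ?sl in EZ GZ EE GG GE he fe fh eZ hZ fZ Ee Ge Eh Gh Df Cf GD.
split=> //; apply: s_inj.
- by rewrite sD s2.
- by rewrite sD sN fe -scalerMnr.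
- by rewrite eZ.
- by apply: s_inj; rewrite Ee.
- by rewrite Ge.
- by rewrite Eh sD sN.
- by rewrite EZ sD.
- by apply: s_inj; rewrite EE !s0.
- by rewrite GE sD sN.
- by rewrite Df.
- by rewrite GD sD sN h16.
Qed.
End Scaling.

(** * Morphisms out of the deformed algebra *)

Record alg_morphism (K : comNzRingType) (A B : algType K) (f : A -> B) : Prop :=
  AlgMorphism {
    amor_linear : linear f;
    amor_1 : f 1 = 1;
    amor_M : forall x y, f (x * y) = f x * f y
  }.

Section AlgMorphism.
Variables (K : comNzRingType) (A B : algType K) (f : A -> B).
Hypothesis fm : alg_morphism f.
Lemma amorD x y : f (x + y) = f x + f y.
Proof. by rewrite -[x]scale1r (amor_linear fm) !scale1r. Qed.

Lemma amor0 : f 0 = 0. Proof. by apply: (addrI (f 0)); rewrite -amorD !addr0. Qed.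

Lemma amorZ c x : f (c *: x) = c *: f x.
Proof. by rewrite -[c *: x]addr0 (amor_linear fm) amor0 addr0. Qed.

Lemma amorN x : f (- x) = - f x. Proof. by rewrite -scaleN1r amorZ scaleN1r. Qed.

Lemma amorB x y : f (x - y) = f x - f y. Proof. by rewrite amorD amorN. Qed.

Lemma amorMn x n : f (x *+ n) = f x *+ n.
Proof. by rewrite -scaler_nat amorZ scaler_nat. Qed.

Lemma nc_eval_morphism (eta : K) env x :
  f (nc_eval eta env x) = nc_eval eta (fun i => f (env i)) x.
Proof.
elim: x => //= [|||||x IH n|x IH].
- exact: amor0.
- exact: amor_1 fm.
- by move=> x <- y <-; exact: amorD.
- by move=> x <-; exact: amorN.
- by move=> x <- y <-; exact: amor_M fm _ _.
- by rewrite amorMn IH.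
- by rewrite amorZ IH.
Qed.

Lemma holds_morphism (eta : K) env rels :
  holds eta env rels -> holds eta (fun i => f (env i)) rels.
Proof. by elim: rels => //= r rels IH [e h]; rewrite -!nc_eval_morphism e; split; auto. Qed.
End AlgMorphism.

Section Eta.
Variable k : numFieldType.
(** The scalar that [NEta] denotes. *)
Definition fps_eta : {fps k} := 8^-1%:S * hpar.

Lemma fps_scale_natK (V : lmodType k) (n : nat) (y : {fps V}) :
  ((n.+1%:R^-1)%:S *: y) *+ n.+1 = y.
Proof.
have e1 : (n.+1%:R^-1 : k) *+ n.+1 = 1 by rewrite -[LHS]mulr_natr mulVf ?pnatr_eq0.
by rewrite scalerMnl -(@fpsCMn k k^o) -[X in X%:S]/((n.+1%:R^-1 : k) *+ n.+1) e1 scale1r.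
Qed.

Lemma fps_eta16 (V : lmodType k) (x : {fps V}) : (fps_eta *: x) *+ 16 = (hpar *: x) *+ 2.
Proof.
by rewrite /fps_eta -scalerA -[16%N]/(8 * 2)%N mulrnA (fps_scale_natK 7).
Qed.

Lemma fps_mul2_inj (V : lmodType k) (x y : {fps V}) : x *+ 2 = y *+ 2 -> x = y.
Proof.
by move=> xy; rewrite -[x](fps_scale_natK 1) -[y](fps_scale_natK 1) !scalerMnr xy.
Qed.

Lemma fps_eta16_inj (V : lmodType k) : injective (fun x : {fps V} => (fps_eta *: x) *+ 16).
Proof. by move=> x y; rewrite !fps_eta16 => /fps_mul2_inj /hpar_inj. Qed.

Lemma fps_eta16_commute (A : algType k) (x y : {fps A}) :
  ((fps_eta *: x) *+ 16) * y = y * ((fps_eta *: x) *+ 16) -> x * y = y * x.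
Proof. by rewrite mulrnAl mulrnAr -scalerAl -scalerAr => /fps_eta16_inj. Qed.
End Eta.

Section EtaSquare.
Variable k : numFieldType.
Local Notation eta := (fps_eta k).
Lemma fps_eta_e (V : lmodType k) (y : {fps V}) :
  eta *: ((eta *: y) *+ 16) = (4^-1%:S * hpar ^+ 2) *: y.
Proof.
apply: fps_mul2_inj; apply: fps_mul2_inj; apply: fps_mul2_inj.
have x8 (x : {fps V}) : x *+ 2 *+ 2 *+ 2 = x *+ 8 by rewrite -!mulrnA.
rewrite fps_eta16 !x8 /fps_eta -!scalerA (fps_scale_natK 7).
have x42 (x : {fps V}) : x *+ 8 = x *+ 4 *+ 2 by rewrite -mulrnA.
rewrite x42 (fps_scale_natK 3).
by rewrite -scalerMnr.
Qed.
End EtaSquare.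

Section Lifting.
Variables (k : numFieldType) (C : algType k).
Local Notation U := (Usl21 k).
Local Notation eta := (fps_eta k).
Local Notation h1 := (ugen (gen_h node1) : U).
Local Notation h2 := (ugen (gen_h node2) : U).
Local Notation e1 := (ugen (gen_e node1) : U).
Local Notation e2 := (ugen (gen_e node2) : U).
Local Notation f1 := (ugen (gen_f node1) : U).
Local Notation f2 := (ugen (gen_f node2) : U).

(** A morphism on U extends to series coefficientwise, by continuity. *)
Lemma extend_morphism (phi : U -> fps_restr C) : linear phi -> phi 1 = 1 ->
  (forall x y, phi (x * y) = phi x * phi y) ->
  exists2 f : {fps U} -> {fps C}, alg_morphism f & forall a, f a%:S = phi a.
Proof.
move=> pl p1 pM.
have p0 : phi 0 = 0.
  by have := pl (-1) 0 0; rewrite scaler0 addr0 scaleN1r addNr.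
have fC a : fps_extend phi a%:S = phi a by exact: fps_extendC.
have fl : linear (fps_extend phi) by exact: fps_extend_linear pl.
exists (fps_extend phi) => //; split=> //.
  by rewrite fC.
move=> x y.
move: x; apply: linear_fps_eq => [c u w|c u w|x].
- by rewrite linear_mulr fl.
- by rewrite fl linear_mulr.
move: y; apply: linear_fps_eq => [c u w|c u w|y].
- by rewrite linear_mull fl.
- by rewrite fl linear_mull.
by rewrite -fpsCM !fC pM.
Qed.

Lemma alg_morphism_coef0 (f : {fps U} -> {fps C}) x : alg_morphism f -> x 0%N = 1 ->
  f x 0%N = 1.
Proof.
move=> fm x0; rewrite (fps_decomp x) x0 (amorD fm) (amorZ fm) fps_addE hpar_coef0.
by rewrite addr0 -[1%:S]/(1 : {fps U}) (amor_1 fm).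
Qed.

Variables (W e H F Z E G e0 : {fps C}).
Hypothesis W0 : W 0%N = 1 *+ 2.
Hypothesis ee0 : e = (eta *: e0) *+ 16.
Hypothesis rels :
  holds eta (env_of [:: 0; W; e; H; F; Z; (eta *: E) *+ 16; G]) deformed_rels.

(** The universal property of the deformed generators. The images of h_1 and f_1 are
    forced, and the images of the relations of sl(2|1) hold by [deformed_to_sl21];
    W is then mapped to W because square roots with constant term 1 are unique.
    The image of e must be divisible by hbar, since it determines that of e_1. *)
Lemma lift_deformed : exists2 f : {fps U} -> {fps C}, alg_morphism f &
  [/\ f (dW k *+ 2) = W, f e1%:S = e0, f (dH1 k *+ 2) = H & f (dF1 k) = F]
  /\ [/\ f (uZ k)%:S = Z, f (dE3 k) = E & f (dF2 k) = G].
Proof.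
pose W' : {fps C} := 2^-1%:S *: W.
have W'2 : W' *+ 2 = W by exact: (fps_scale_natK 1).
have W'0 : W' 0%N = 1
  by rewrite /W' fps_scaleC_coef W0 -scalerMnr scalerMnl -mulr_natl mulfV ?scale1r ?pnatr_eq0.
have [v' [Wv' v'W _]] := fps_inverse W'0.
pose v : {fps C} := 2^-1%:S *: v'.
have v2 : v *+ 2 = v' by exact: (fps_scale_natK 1).
have vW : v * W = 1 by rewrite -W'2 mulrnAr -mulrnAl v2.
have Wv : W * v = 1 by rewrite -W'2 mulrnAl -mulrnAr v2.
have WW := deformed_WW rels.
have := deformed_to_sl21 vW Wv rels.
pose h := v * H.
pose f := F + eta *: (e * (h * h - 1)).
pose z2 : {fps C} := 2^-1%:S *: (Z - h).
have Zh : Z = h + z2 *+ 2 by rewrite /z2 (fps_scale_natK 1) addrC subrK.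
rewrite -/h -/f ee0 => /(sl21_unscale (@fps_eta16_inj _ C) Zh) dat.
have [phi [pl p1 pM pg]] := sl21_morphism (A := fps_restr C)
  (dat : @sl21_data (fps_restr C) _ _ _ _ _ _ _).
have [g gm gC] := extend_morphism pl p1 pM.
have ge1 : g e1%:S = e0 by rewrite gC pg.
have gh1 : g h1%:S = h by rewrite gC pg.
have gf1 : g f1%:S = f by rewrite gC pg.
have gf2 : g f2%:S = G by rewrite gC pg.
have gW : g (dW k) = W'.
  have e12 : (1 + hpar ^+ 2 *: (e1 ^+ 2)%:S : {fps U}) 0%N = 1.
    by rewrite fps_addE expr2 -scalerA hpar_coef0 addr0.
  rewrite (fps_sqrt_unique (alg_morphism_coef0 gm (fps_sqrt0 _)) erefl).
  rewrite [in RHS](fps_sqrt_unique W'0 erefl); congr fps_sqrt.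
  rewrite -(amor_M gm) fps_sqrtK // (amorD gm) (amor_1 gm) (amorZ gm).
  rewrite (expr2 e1) fpsCM (amor_M gm) ge1.
  apply: fps_mul2_inj; apply: fps_mul2_inj.
  have -> : W' * W' *+ 2 *+ 2 = W * W by rewrite -mulrnAl W'2 -mulrnAr W'2.
  rewrite WW ee0 fps_eta16 mulrnAl mulrnAr -scalerAl -scalerAr scalerA -expr2.
  by rewrite -!mulrnA mulrnDl addrC.
have gH1 : g (dH1 k *+ 2) = H.
  by rewrite (amorMn gm) (amor_M gm) gW gh1 -mulrnAl W'2 mulrA Wv mul1r.
exists g => //; split; split => //.
- by rewrite (amorMn gm) gW.
- rewrite /dF1 (amorB gm) (amorZ gm) gf1 fpsCM (amor_M gm) ge1 fpsCD fpsCN.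
  rewrite (amorB gm) (amor_1 gm) expr2 fpsCM (amor_M gm) gh1 -fps_eta_e.
  by rewrite /f ee0 mulrnAl -scalerAl addrK.
- by rewrite /uZ fpsCD fpsCMn (amorD gm) (amorMn gm) gh1 Zh gC pg.
- rewrite /dE3 /ue3 fpsCD fpsCN !fpsCM (amorB gm) !(amor_M gm) ge1.
  by rewrite gC pg; exact: (@presentation_eD k (fps_restr C) _ _ _ _ _ _ _ dat).
Qed.
End Lifting.

(** * The deformed generators *)

Section Homogeneous.
Variables (k : comNzRingType) (A : superAlgType k).
Implicit Types (x y : A) (d : bool).
Lemma homogD d x y : homogeneous d x -> homogeneous d y -> homogeneous d (x + y).
Proof. by rewrite /homogeneous linearD /= => -> ->. Qed.

Lemma homogN d x : homogeneous d x -> homogeneous d (- x).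
Proof. by rewrite /homogeneous linearN /= => ->. Qed.

Lemma homogB d x y : homogeneous d x -> homogeneous d y -> homogeneous d (x - y).
Proof. by move=> hx hy; apply: homogD => //; apply: homogN. Qed.

Lemma homogZ d c x : homogeneous d x -> homogeneous d (c *: x).
Proof. by rewrite /homogeneous linearZ /= => ->. Qed.

Lemma homogMn d x n : homogeneous d x -> homogeneous d (x *+ n).
Proof. by move=> hx; rewrite -scaler_nat; apply: homogZ. Qed.

Lemma homog0 d : homogeneous d (0 : A).
Proof. exact: linear0. Qed.

(** Taking odd parts in x * y = 1 gives x * spart true y = 0. *)
Lemma homog_inverse_even x y : homogeneous false x -> x * y = 1 -> y * x = 1 ->
  homogeneous false y.
Proof.
move=> hx xy yx; have := spart_sum y => e; rewrite /homogeneous -[RHS]e.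
suff -> : spart true y = 0 by rewrite addr0.
rewrite -[LHS]mul1r -yx -mulrA.
have : spart true (x * y) = x * spart true y.
  have s1 : spart true (x * spart true y) = x * spart true y.
    by have := spartM false true x y; rewrite hx.
  have s0 : spart true (x * spart false y) = 0.
    by have := spartM false false x y; rewrite hx => <-; rewrite spartK.
  by rewrite -{1}e mulrDr linearD /= s0 s1 add0r.
by rewrite xy (homog_spart true (homog1 A)) => <-; rewrite mulr0.
Qed.

Lemma homogC d x : homogeneous d x -> homogeneous d (x%:S : {fps A}).
Proof. by rewrite /homogeneous fps_spartC => ->. Qed.

Lemma homog_fpsP d (x : {fps A}) : (forall n, homogeneous d (x n)) -> homogeneous d x.
Proof. by move=> h; apply/funext => n; exact: h. Qed.
End Homogeneous.

Lemma homog_sqrt (k : numFieldType) (A : superAlgType k) (x : {fps A}) :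
  homogeneous false x -> homogeneous false (fps_sqrt x).
Proof.
move=> hx; apply: homog_fpsP => n; elim/ltn_ind: n => -[|n] IH; first exact: homog1.
rewrite fps_sqrtS; apply/homogZ/homogB; first exact: (congr1 (@^~ n.+1) hx).
rewrite big_nat_cond; elim/big_ind: _ => [||]; first exact: homog0.
  exact: homogD.
move=> i /andP[/andP[i0 i1] _]; apply: (@homogM _ _ false false); apply: IH => //.
by rewrite ltn_subrL i0.
Qed.

Section DeformedData.
Variables (K : comNzRingType) (eta : K) (A : algType K) (v W e h f Z E G h2 : A).
Let s (x : A) : A := (eta *: x) *+ 16.
Hypothesis d : sl21_data e h f Z E G h2.
Hypotheses (vW : v * W = 1) (Wv : W * v = 1) (WW : W * W = s e * s e + 1 *+ 4).
Hypothesis kill : forall y, W * y + y * W = 0 -> y = 0.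
Hypothesis W_comm : forall x, x * e = e * x -> x * W = W * x.

(** All commutators with W are found from the ones with e, as W ^ 2 = e ^ 2 + 4. *)
Lemma sl21_data_deformed : holds eta (env_of [:: 0; W; s e; W * h;
  f - eta *: (s e * (h * h - 1)); Z; s E; G]) deformed_rels.
Proof.
have sW x : x * W = W * x -> s x * W = W * s x.
  by move=> xW; rewrite /s mulrnAl -scalerAl xW scalerAr mulrnAr.
have eW : s e * W = W * s e by apply/sW/W_comm.
have WZ : W * Z = Z * W by apply/esym/W_comm; rewrite (dat_eZ d).
have EW : s E * W = W * s E by apply/sW/W_comm; rewrite (dat_Ee d).
have GW : G * W = W * G by apply/W_comm; rewrite (dat_Ge d).
have r := sl21_scale eta v W (f * s E - s E * f) (f * G - G * f) d.
exact: (sl21_to_deformed vW Wv WW eW WZ EW GW kill r).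
Qed.
End DeformedData.

Section DeformedU.
Variable k : numFieldType.
Local Notation U := (Usl21 k).
Local Notation eta := (fps_eta k).
Local Notation h1 := (ugen (gen_h node1) : U).
Local Notation h2 := (ugen (gen_h node2) : U).
Local Notation e1 := (ugen (gen_e node1) : U).
Local Notation f1 := (ugen (gen_f node1) : U).
Local Notation f2 := (ugen (gen_f node2) : U).
Local Notation T := (dT k).
Local Notation TV := (dTV k).
Local Notation Th := (dTh k).
Local Notation TVh := (dTVh k).

(** The elements T - T^-1 = 2 hbar e_1 and 2 hbar E_3 in which the relations are
    stated. *)
Definition scaled_e : {fps U} := (eta *: e1%:S) *+ 16.
Definition scaled_E : {fps U} := (eta *: dE3 k) *+ 16.
Local Notation e := scaled_e.
Local Notation W := (dW k *+ 2).

Lemma dTD : T + TV = W.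
Proof. by rewrite /dT /dTV addrACA subrr add0r. Qed.

Lemma dTB : T - TV = e.
Proof. by rewrite /dT /dTV /scaled_e fps_eta16 opprD opprK addrACA subrr addr0. Qed.

Lemma dWW : dW k * dW k = 1 + hpar ^+ 2 *: (e1 ^+ 2)%:S.
Proof. by apply: fps_sqrtK; rewrite fps_addE expr2 -scalerA hpar_coef0 addr0. Qed.

Lemma scaled_WW : W * W = e * e + 1 *+ 4.
Proof.
rewrite mulrnAl mulrnAr dWW /scaled_e fps_eta16 mulrnAl mulrnAr -scalerAl -scalerAr.
by rewrite scalerA -expr2 (expr2 e1) fpsCM -!mulrnA mulrnDl addrC.
Qed.

Lemma W_anticommutant0 (y : {fps U}) : W * y + y * W = 0 -> y = 0.
Proof.
rewrite mulrnAl mulrnAr -mulrnDl => h; apply: (fps_anticommutant0 (x := dW k)) => //.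
by apply: fps_mul2_inj; rewrite h mul0rn.
Qed.

Lemma W_commute (x : {fps U}) : x * e = e * x -> x * W = W * x.
Proof.
move=> xe; apply/eqP; rewrite -subr_eq0; apply/eqP/W_anticommutant0.
rewrite mulrBr mulrBl !mulrA addrC addrA subrK -(mulrA x) scaled_WW.
have xee : x * (e * e) = e * e * x by rewrite mulrA xe -mulrA xe mulrA.
by rewrite (mulrDr x (e * e)) (mulrDl (e * e)) xee mulrnAr mulrnAl mulr1 mul1r subrr.
Qed.

Lemma dW_inverse : exists v : {fps U}, v * W = 1 /\ W * v = 1.
Proof.
have [v [Wv vW _]] := fps_inverse (erefl : dW k 0%N = 1).
exists (2^-1%:S *: v); split.
  by rewrite mulrnAr -mulrnAl (fps_scale_natK 1).
by rewrite mulrnAl -mulrnAr (fps_scale_natK 1).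
Qed.

Lemma fps_sl21_data :
  sl21_data (e1%:S : {fps U}) h1%:S f1%:S (uZ k)%:S (dE3 k) f2%:S h2%:S.
Proof.
have d := usl21_data k.
rewrite /dE3; split; rewrite -?fpsCM -?fpsCMn -?fpsCN -?fpsCD -?fpsCM -?fpsCMn -?fpsCN -?fpsCD.
- by rewrite (dat_Z d).
- by rewrite (dat_he d).
- by rewrite (dat_fe d).
- by rewrite (dat_fh d).
- by rewrite (dat_eZ d).
- by rewrite (dat_hZ d).
- by rewrite (dat_fZ d).
- by rewrite (dat_Ee d).
- by rewrite (dat_Ge d).
- by rewrite (dat_Eh d).
- by rewrite (dat_Gh d).
- by rewrite (dat_EZ d).
- by rewrite (dat_GZ d).
- by rewrite (dat_EE d) fpsC0.
- by rewrite (dat_GG d) fpsC0.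
- by rewrite (dat_GE d).
- by rewrite (dat_Df d).
- by rewrite (dat_Cf d).
- by rewrite (dat_GD d).
Qed.

Lemma dH1E : dH1 k *+ 2 = W * h1%:S.
Proof. by rewrite mulrnAl. Qed.

Lemma dF1E : dF1 k = f1%:S - eta *: (e * (h1%:S * h1%:S - 1)).
Proof.
rewrite /dF1 /scaled_e mulrnAl -scalerAl fps_eta_e expr2.
by rewrite fpsCM fpsCD fpsCN fpsCM.
Qed.

Lemma commute_e (x : {fps U}) : x * e1%:S = e1%:S * x -> x * e = e * x.
Proof. by move=> xe; rewrite /scaled_e mulrnAr mulrnAl -scalerAl -scalerAr xe. Qed.

Lemma deformed_relations : holds eta
  (env_of [:: 0; W; e; dH1 k *+ 2; dF1 k; (uZ k)%:S; scaled_E; dF2 k]) deformed_rels.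
Proof.
have [v [vW Wv]] := dW_inverse.
have := sl21_data_deformed fps_sl21_data vW Wv scaled_WW W_anticommutant0
  (fun x xe => W_commute (commute_e xe)).
by rewrite dH1E dF1E; exact.
Qed.

Lemma dT0 : T 0%N = 1.
Proof. by rewrite /dT fps_addE hpar_coef0 add0r. Qed.

Lemma dTV0 : TV 0%N = 1.
Proof. by rewrite /dTV fps_addE fps_oppE hpar_coef0 oppr0 add0r. Qed.

Lemma dThK : Th * Th = T. Proof. exact: fps_sqrtK dT0. Qed.

Lemma dTVhK : TVh * TVh = TV. Proof. exact: fps_sqrtK dTV0. Qed.

Lemma e_dW : e1%:S * dW k = dW k * e1%:S.
Proof.
  apply: fps_sqrt_commute; first by rewrite fps_addE expr2 -scalerA hpar_coef0 addr0.
  by rewrite mulrDr mulrDl mulr1 mul1r -scalerAl -scalerAr (expr2 e1) -!fpsCM mulrA.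
Qed.

Lemma dT_TV : T * TV = 1 /\ TV * T = 1.
Proof.
have cA : dW k * (hpar *: e1%:S) = (hpar *: e1%:S) * dW k.
  by rewrite -scalerAr -scalerAl e_dW.
rewrite /dT /dTV; split.
  rewrite mulrDl !mulrDr !mulrN cA dWW addrA -(addrA (- _)) subrr addr0.
  by rewrite -scalerAl -scalerAr scalerA -expr2 (expr2 e1) fpsCM addrC addrK.
rewrite mulrDl !mulrDr !mulNr cA dWW addrA -(addrA (- _)) addNr addr0.
by rewrite -scalerAl -scalerAr scalerA -expr2 (expr2 e1) fpsCM addrC addrK.
Qed.

Lemma dTh_TVh : Th * TVh = 1 /\ TVh * Th = 1.
Proof. by have [TTV TVT] := dT_TV; exact: fps_sqrt_inverse dT0 dTV0 TTV TVT. Qed.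

Lemma root_relations : holds eta (env_of [:: 0; W; e; dH1 k *+ 2; dF1 k; (uZ k)%:S;
   scaled_E; dF2 k; dF1 k * scaled_E - scaled_E * dF1 k; dF1 k * dF2 k - dF2 k * dF1 k;
   Th; TVh]) root_rules.
Proof.
have [tu ut] := dTh_TVh.
have WE : W = Th * Th + TVh * TVh by rewrite dThK dTVhK dTD.
have eE : e = Th * Th - TVh * TVh by rewrite dThK dTVhK dTB.
have kill (y : {fps U}) : Th * y + y * Th = 0 -> y = 0 by exact: fps_anticommutant0.
have cancel2 (y : {fps U}) : y *+ 2 = 0 -> y = 0.
  by move=> y2; apply: fps_mul2_inj; rewrite y2 mul0rn.
have := deformed_relations; rewrite WE eE => rels.
exact: (root_rules_hold tu ut kill cancel2 rels).
Qed.
End DeformedU.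

(** * Skew-primitive coproducts *)

Section TensorEmbeddings.
Variables (k : fieldType) (A B : superAlgType k).
Lemma tpure_1r_morphism : alg_morphism (fun x : {fps A} => x *T (1 : {fps B})).
Proof.
split; [exact: fps_tpure_1r_linear | exact: fps_tpure1 | move=> x y].
by rewrite fps_tmul_even ?mulr1 //; left; exact: homog1.
Qed.

Lemma tpure_1l_morphism : alg_morphism (fun y : {fps B} => (1 : {fps A}) *T y).
Proof.
split; [exact: fps_tpure_1l_linear | exact: fps_tpure1 | move=> x y].
by rewrite fps_tmul_even ?mulr1 //; right; exact: homog1.
Qed.

Lemma tpure_split (x : {fps A}) (y : {fps B}) : (x *T 1) * (1 *T y) = x *T y.
Proof. by rewrite fps_tmul_even ?mulr1 ?mul1r //; left; exact: homog1. Qed.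
End TensorEmbeddings.

Section TensorMultiples.
Variables (k : fieldType) (A B : lmodType k).
Implicit Types (x : {fps A}) (y : {fps B}).
Lemma fps_tpure_double x y x' y' :
  (x *+ 2) *T y + x' *T (y' *+ 2) = (x *T y + x' *T y') *+ 2.
Proof. by rewrite !mulr2n fps_tpureDl fps_tpureDr addrACA. Qed.

Lemma fps_tpure_difference x x' y y' :
  (x - x') *T y' + x *T (y - y') = x *T y - x' *T y'.
Proof.
by rewrite fps_tpureDl fps_tpureNl fps_tpureDr fps_tpureNr addrC addrA subrK.
Qed.

Lemma fps_tpure_scale (c : {fps k}) n x y x' y' :
  ((c *: x) *+ n) *T y + x' *T ((c *: y') *+ n) = (c *: (x *T y + x' *T y')) *+ n.
Proof.
by rewrite -!scaler_nat 2!fps_tpureZl 2!fps_tpureZr -!scalerDr.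
Qed.
End TensorMultiples.

Section TensorHomogeneous.
Variables (k : fieldType) (A B : superAlgType k).
Implicit Types (x z : {fps A}) (y t : {fps B}).

Lemma homog_tpure_even x y : homogeneous false x -> homogeneous false y ->
  homogeneous false (x *T y : {fps tens A B}).
Proof. exact: (@homog_tpure k A B false false). Qed.

Lemma homog_tpure_even2 x y z t : homogeneous false x -> homogeneous false y ->
  homogeneous false z -> homogeneous false t ->
  homogeneous false (x *T y + z *T t : {fps tens A B}).
Proof. by move=> hx hy hz ht; apply: homogD; apply: homog_tpure_even. Qed.

Lemma homog_tpure_odd x y z t : homogeneous true x -> homogeneous false y ->
  homogeneous false z -> homogeneous true t ->
  homogeneous true (x *T y + z *T t : {fps tens A B}).
Proof.
move=> hx hy hz ht; apply: homogD; first exact: (@homog_tpure k A B true false).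
exact: (@homog_tpure k A B false true).
Qed.

Lemma fps_tpure_coef0 x y : x 0%N = 1 -> y 0%N = 1 -> (x *T y : {fps tens A B}) 0%N = 1.
Proof. by move=> x0 y0; rewrite /fps_tpure /fconv big_ord1 subnn x0 y0. Qed.
End TensorHomogeneous.

Section Parity.
Variables (K : comNzRingType) (A : superAlgType K).
Lemma spart_mul d (x y : A) :
  spart d (x * y) = spart false x * spart d y + spart true x * spart (~~ d) y.
Proof.
rewrite -{1}(spart_sum x) -{1}(spart_sum y) !mulrDl !mulrDr !linearD /=.
rewrite !(homog_spart d (homogM (sparts _ _) (sparts _ _))).
by case: d; rewrite /= ?addr0 ?add0r.
Qed.

Lemma spart_mulV d (x y : A) :
  spart d (x * y) = spart d x * spart false y + spart (~~ d) x * spart true y.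
Proof.
rewrite -{1}(spart_sum x) -{1}(spart_sum y) !mulrDl !mulrDr !linearD /=.
rewrite !(homog_spart d (homogM (sparts _ _) (sparts _ _))).
by case: d; rewrite /= ?addr0 ?add0r // addrC.
Qed.
End Parity.

(** The coproduct is first computed in any algebra A that receives two copies of B
    whose elements commute up to the sign rule; [pure x y] stands for x (x) y. *)
Section AbstractCoproduct.
Variables (K : comNzRingType) (eta : K) (B A : algType K).
Variables (i1 i2 : B -> A) (pure : B -> B -> A).
Hypotheses (i1m : alg_morphism i1) (i2m : alg_morphism i2).
Hypothesis pureE : forall x y, i1 x * i2 y = pure x y.
Hypotheses (i1E : forall x, i1 x = pure x 1) (i2E : forall y, i2 y = pure 1 y).
Hypothesis scale_inj : injective (fun x : A => (eta *: x) *+ 16).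
Variables (t u T V W e H H1 F Z E E0 G : B).
Hypotheses (tT : t * t = T) (uV : u * u = V) (HH : H = H1 *+ 2)
  (EE : E = (eta *: E0) *+ 16).
Let env := env_of [:: 0; W; e; H; F; Z; E; G; F * E - E * F; F * G - G * F; t; u].
Hypothesis rules1 : holds eta (fun i => i1 (env i)) root_rules.
Hypothesis rules2 : holds eta (fun i => i2 (env i)) root_rules.
Hypothesis cross : forall i j, i2 (env i) * i1 (env j)
  = if odd_letter i && odd_letter j then - (i1 (env j) * i2 (env i))
    else i1 (env j) * i2 (env i).

Lemma abstract_coproduct : holds eta (env_of [:: 0;
  pure T T + pure V V; pure T T - pure V V;
  (pure H1 T + pure V H1) *+ 2; pure F T + pure V F; pure Z 1 + pure 1 Z;
  (eta *: (pure E0 u + pure t E0)) *+ 16; pure G u + pure t G]) deformed_rels.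
Proof.
have := coproduct_deformed rules1 rules2 cross 0.
rewrite /env /env_of /= -!(amor_M i1m) -!(amor_M i2m) tT uV !pureE i1E i2E.
have -> : pure H T + pure V H = (pure H1 T + pure V H1) *+ 2.
  by rewrite -!pureE HH (amorMn i1m) (amorMn i2m) mulrnAl mulrnAr mulrnDl.
have -> // : pure E u + pure t E = (eta *: (pure E0 u + pure t E0)) *+ 16.
rewrite -!pureE EE (amorMn i1m) (amorMn i2m) (amorZ i1m) (amorZ i2m).
by rewrite mulrnAl mulrnAr -scalerAl -scalerAr scalerDr mulrnDl.
Qed.

Let F' := pure F T + pure V F.

Let descendants : forall X Y, (X, Y) = (E, F * E - E * F) \/ (X, Y) = (G, F * G - G * F) ->
  F' * (pure X u + pure t X) - (pure X u + pure t X) * F'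
  = pure Y t + pure u Y + eta *: pure (V * X) (H * u + u * H)
    - eta *: pure (H * t + t * H) (T * X).
Proof.
have := coproduct_descendants_hold rules1 rules2 cross.
rewrite /env /env_of /= -!(amor_M i1m) -!(amor_M i2m) tT uV.
rewrite -!(amorD i1m) -!(amorD i2m) -?(amor_M i1m) -?(amor_M i2m) !pureE => -[hE hG] X Y.
by case=> -[-> ->].
Qed.

Let dbl X : eta *: pure (V * X) (H * u + u * H) = (eta *+ 2) *: pure (V * X) (u * H1 + H1 * u)
  /\ eta *: pure (H * t + t * H) (T * X) = (eta *+ 2) *: pure (t * H1 + H1 * t) (T * X).
Proof.
rewrite HH -!pureE !mulrnAl !mulrnAr -!mulrnDl (amorMn i1m) (amorMn i2m).
rewrite mulrnAl mulrnAr -!scalerMnr -!scalerMnl.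
by rewrite [H1 * u + _]addrC [H1 * t + _]addrC.
Qed.

Lemma abstract_coproduct_descendant X : X = E0 \/ X = G ->
  F' * (pure X u + pure t X) - (pure X u + pure t X) * F'
  = pure (F * X - X * F) t + pure u (F * X - X * F)
    + (eta *+ 2) *: pure (V * X) (u * H1 + H1 * u)
    - (eta *+ 2) *: pure (t * H1 + H1 * t) (T * X).
Proof.
case=> ->; last first.
  by have [<- <-] := dbl G; exact: (descendants (or_intror erefl)).
have := descendants (or_introl erefl); have [-> ->] := dbl E.
pose s (C : algType K) (x : C) : C := (eta *: x) *+ 16.
have sB (C : algType K) (x y : C) : s C (x - y) = s C x - s C y.
  by rewrite /s scalerBr mulrnBl.
have sD (C : algType K) (x y : C) : s C (x + y) = s C x + s C y.
  by rewrite /s scalerDr mulrnDl.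
have sl (C : algType K) (x y : C) : s C x * y = s C (x * y).
  by rewrite /s mulrnAl -scalerAl.
have sr (C : algType K) (x y : C) : x * s C y = s C (x * y).
  by rewrite /s mulrnAr -scalerAr.
have sZ (c : K) (x : A) : c *: s A x = s A (c *: x).
  by rewrite /s -scalerMnr !scalerA mulrC.
have s1 x : i1 (s B x) = s A (i1 x) by rewrite /s (amorMn i1m) (amorZ i1m).
have s2 x : i2 (s B x) = s A (i2 x) by rewrite /s (amorMn i2m) (amorZ i2m).
have pl x y : pure (s B x) y = s A (pure x y) by rewrite -!pureE s1 sl.
have pr x y : pure x (s B y) = s A (pure x y) by rewrite -!pureE s2 sr.
rewrite EE -/(s B E0) !sl !sr -!sB !pl !pr -!sD !sl !sr !sZ -!sD -!sB -?sD -?sB.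
exact: scale_inj.
Qed.

Lemma abstract_coproduct_H2 :
  (pure Z 1 + pure 1 Z) *+ 4 - (pure T T + pure V V) * (pure H T + pure V H)
  = pure (Z *+ 4 - (T + V) * H) 1 + pure 1 (Z *+ 4 - (T + V) * H)
    + pure (T * H) (1 - T * T) + pure (1 - V * V) (V * H).
Proof.
have := coproduct_H2_hold rules1 rules2 cross.
rewrite /env /env_of /= -!(amor_M i1m) -!(amor_M i2m) tT uV => h.
rewrite -!i1E -!i2E -!pureE !(amorB i1m) !(amorB i2m) !(amorMn i1m) !(amorMn i2m).
rewrite (amor_M i1m (T + V)) (amor_M i2m (T + V)) (amorD i1m T) (amorD i2m T).
by rewrite (amor_1 i1m) (amor_1 i2m).
Qed.
End AbstractCoproduct.

(** * The Hopf structure from generators and relations *)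

(** Closing under division by the deformation parameter and under inverses of even
    elements makes the deformed generators generate U: e_1 is a quotient of T - T^-1,
    and h_1 a product of H_1 with an inverse. Equality of two morphisms, the antipode
    law and preservation of parity are all closed in this sense. *)
Record hclosed (k : comNzRingType) (U : superAlgType k) (P : {fps U} -> Prop) : Prop :=
  Hclosed {
  hclosedD : forall x y, P x -> P y -> P (x + y);
  hclosedZ : forall (c : {fps k}) x, P x -> P (c *: x);
  hclosedM : forall x y, P x -> P y -> P (x * y);
  hclosed_div : forall x, P (hpar *: x) -> P x;
  hclosedV : forall x y, homogeneous false x -> homogeneous false y ->
    x * y = 1 -> y * x = 1 -> P x -> P y
}.

Lemma hclosed_agree (k : comNzRingType) (U : superAlgType k) (C : algType k)
    (f g : {fps U} -> {fps C}) :
  alg_morphism f -> alg_morphism g -> hclosed (fun x => f x = g x).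
Proof.
move=> fm gm; split.
- by move=> x y fx fy; rewrite (amorD fm) (amorD gm) fx fy.
- by move=> c x fx; rewrite (amorZ fm) (amorZ gm) fx.
- by move=> x y fx fy; rewrite (amor_M fm) (amor_M gm) fx fy.
- by move=> x; rewrite (amorZ fm) (amorZ gm) => /hpar_inj.
- move=> x y _ _ xy yx fx.
  rewrite -[f y]mulr1 -(amor_1 gm) -xy (amor_M gm) mulrA -fx -(amor_M fm) yx.
  by rewrite (amor_1 fm) mul1r.
Qed.

Lemma superalg_alg_morphism (K : comNzRingType) (A B : superAlgType K) (f : A -> B) :
  superalg_morphism f -> alg_morphism f.
Proof. by case. Qed.

Lemma spart_preserved (K : comNzRingType) (A B : superAlgType K) (f : A -> B) (d : bool) x :
  f 0 = 0 -> homogeneous d x -> homogeneous d (f x) ->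
  forall d', f (spart d' x) = spart d' (f x).
Proof.
move=> f0 hx hf d'; rewrite (homog_spart d' hx) (homog_spart d' hf).
by case: ifP.
Qed.

Lemma linear_coef0 (k : comNzRingType) (A B : algType k) (f : {fps A} -> {fps B}) x :
  linear f -> f 1 = 1 -> x 0%N = 1 -> f x 0%N = 1.
Proof.
move=> fl f1 x0; rewrite (fps_decomp x) x0 addrC fl fps_addE hpar_coef0 add0r.
by rewrite -[1%:S]/(1 : {fps A}) f1.
Qed.

Section Converse.
Variables (k : comNzRingType) (C : algType k) (eta : {fps k}).

Lemma fps_converse_mul (x y : {fps C}) : @GRing.mul {fps C^c} x y = y * x.
Proof. by apply/funext => n; rewrite [LHS]fconvE_rev. Qed.

Lemma nc_eval_converse (env : nat -> {fps C}) x :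
  @nc_eval _ eta {fps C^c} env x = nc_eval eta env (nc_rev x).
Proof.
elim: x => //= [x -> y ->|x ->|x IHx y IHy|x -> n|x ->] //.
by rewrite IHx IHy fps_converse_mul.
Qed.

Lemma holds_converse (env : nat -> {fps C}) rels :
  @holds _ eta {fps C^c} env rels <-> holds eta env (rev_rels rels).
Proof. by elim: rels => //= r rels IH; rewrite !nc_eval_converse IH. Qed.
End Converse.

(** The rest of the construction uses only the following properties of the series
    algebra over U(sl(2|1)): relations, parities, generation and lifting. The letters
    are those of the relations, except that H is H_1 itself and E is E_3; V is T^-1,
    and e0 stands for e_1. *)
Section HopfStructure.
Variables (k : numFieldType) (U : superAlgType k).
Local Notation eta := (fps_eta k).
Variables (T V t u H F Z E G : {fps U}) (e0 : {fps U}).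
Hypotheses (tt : t * t = T) (uu : u * u = V) (tu : t * u = 1) (ut : u * t = 1).
Hypotheses (t0 : t 0%N = 1) (u0 : u 0%N = 1).
Hypothesis Te : T - V = (eta *: e0) *+ 16.
Local Notation Es := ((eta *: E) *+ 16).
Let env := env_of [:: 0; T + V; T - V; H *+ 2; F; Z; Es; G; F * Es - Es * F;
  F * G - G * F; t; u].
Hypothesis rules : holds eta env root_rules.
Hypotheses (homog_t : homogeneous false t) (homog_u : homogeneous false u)
  (homog_H : homogeneous false H) (homog_F : homogeneous false F)
  (homog_Z : homogeneous false Z) (homog_E : homogeneous true E)
  (homog_G : homogeneous true G).

Definition on_generators (P : {fps U} -> Prop) : Prop :=
  [/\ P T, P V, P H & P F] /\ [/\ P Z, P E & P G].

Hypothesis generated : forall P : {fps U} -> Prop, hclosed P -> on_generators P ->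
  forall a : U, P a%:S.

Hypothesis lift : forall (C : algType k) (T' V' H' F' Z' E' G' e0' : {fps C}),
  T' 0%N = 1 -> V' 0%N = 1 -> T' - V' = (eta *: e0') *+ 16 ->
  holds eta (env_of [:: 0; T' + V'; T' - V'; H' *+ 2; F'; Z'; (eta *: E') *+ 16; G'])
    deformed_rels ->
  exists2 D : {fps U} -> {fps C}, alg_morphism D &
    [/\ D T = T', D V = V', D H = H' & D F = F'] /\ [/\ D Z = Z', D E = E' & D G = G'].

Let homog_T : homogeneous false T.
Proof. by rewrite -tt; apply: (@homogM _ _ false false). Qed.

Let homog_V : homogeneous false V.
Proof. by rewrite -uu; apply: (@homogM _ _ false false). Qed.

Let T0 : T 0%N = 1. Proof. by rewrite -tt fps_mul_coef0 t0 mulr1. Qed.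

Let V0 : V 0%N = 1. Proof. by rewrite -uu fps_mul_coef0 u0 mulr1. Qed.

Let TV : T * V = 1. Proof. by rewrite -tt -uu mulrA -(mulrA t) tu mulr1 tu. Qed.

Let VT : V * T = 1. Proof. by rewrite -tt -uu mulrA -(mulrA u) ut mulr1 ut. Qed.

Lemma agree_on_generators (C : algType k) (f g : {fps U} -> {fps C}) :
  alg_morphism f -> alg_morphism g -> on_generators (fun x => f x = g x) -> f =1 g.
Proof.
move=> fm gm gen; apply: linear_fps_eq (amor_linear fm) (amor_linear gm) _.
exact: generated (hclosed_agree fm gm) gen.
Qed.

Lemma parity_on_generators (C : superAlgType k) (f : {fps U} -> {fps C}) : linear f ->
  on_generators (fun x => forall d, f (spart d x) = spart d (f x)) ->
  hclosed (fun x => forall d, f (spart d x) = spart d (f x)) ->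
  forall d x, f (spart d x) = spart d (f x).
Proof.
move=> fl gen cl d; apply: linear_fps_eq => [c x y|c x y|a].
- by rewrite linearP fl.
- by rewrite fl linearP.
exact: (generated cl gen).
Qed.

Lemma generator_parities (C : superAlgType k) (f : {fps U} -> {fps C}) : f 0 = 0 ->
  [/\ homogeneous false (f T), homogeneous false (f V),
      homogeneous false (f H) & homogeneous false (f F)] ->
  [/\ homogeneous false (f Z), homogeneous true (f E) & homogeneous true (f G)] ->
  on_generators (fun x => forall d, f (spart d x) = spart d (f x)).
Proof.
move=> f0 [fT fV fH fF] [fZ fE fG]; split; split.
- exact: (spart_preserved f0 homog_T fT).
- exact: (spart_preserved f0 homog_V fV).
- exact: (spart_preserved f0 homog_H fH).
- exact: (spart_preserved f0 homog_F fF).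
- exact: (spart_preserved f0 homog_Z fZ).
- exact: (spart_preserved f0 homog_E fE).
- exact: (spart_preserved f0 homog_G fG).
Qed.

Lemma even_morphism (C : superAlgType k) (f : {fps U} -> {fps C}) : alg_morphism f ->
  [/\ homogeneous false (f T), homogeneous false (f V),
      homogeneous false (f H) & homogeneous false (f F)] ->
  [/\ homogeneous false (f Z), homogeneous true (f E) & homogeneous true (f G)] ->
  superalg_morphism f.
Proof.
move=> fm h1 h2; split; [exact: amor_linear fm | exact: amor_1 fm | exact: amor_M fm |].
apply: (parity_on_generators (amor_linear fm) (generator_parities (amor0 fm) h1 h2)).
split.
- by move=> x y hx hy d; rewrite linearD /= !(amorD fm) linearD /= hx hy.
- by move=> c x hx d; rewrite linearZ /= !(amorZ fm) linearZ /= hx.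
- move=> x y hx hy d.
  by rewrite spart_mul (amorD fm) !(amor_M fm) !hx !hy spart_mul.
- by move=> x hx d; apply: hpar_inj; rewrite /= -(amorZ fm) -!linearZ /= hx (amorZ fm).
- move=> x y hx hy xy yx px d; apply: spart_preserved (amor0 fm) hy _ d.
  have hfx : homogeneous false (f x) by rewrite /homogeneous -px hx.
  by apply: (homog_inverse_even hfx); rewrite -(amor_M fm) ?xy ?yx (amor_1 fm).
Qed.

(** ** The coproduct *)

(** In these generators the coproduct has a uniform shape: each generator other than
    T and V is skew-primitive with respect to powers of t and u. *)
Definition coproduct_values (D : {fps U} -> {fps tens U U}) : Prop :=
  [/\ D T = T *T T, D V = V *T V, D H = H *T T + V *T H & D F = F *T T + V *T F]
  /\ [/\ D Z = Z *T 1 + 1 *T Z, D E = E *T u + t *T E & D G = G *T u + t *T G].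

Let X1 (x : {fps U}) : {fps tens U U} := x *T 1.
Let X2 (y : {fps U}) : {fps tens U U} := 1 *T y.
Let X1m : alg_morphism X1 := tpure_1r_morphism U U.
Let X2m : alg_morphism X2 := tpure_1l_morphism U U.
Let X12 x y : X1 x * X2 y = x *T y. Proof. exact: tpure_split. Qed.

Let homog_env i : homogeneous (odd_letter i) (env i).
Proof.
have hE : homogeneous true Es by apply/homogMn/homogZ.
rewrite /env /env_of; do 12?[case: i => [|i] /=] => //.
- exact: homog0.
- exact: homogD.
- exact: homogB.
- exact: homogMn.
- exact: (homogB (@homogM _ _ false true _ _ homog_F hE) (@homogM _ _ true false _ _ hE homog_F)).
- exact: (homogB (@homogM _ _ false true _ _ homog_F homog_G)
    (@homogM _ _ true false _ _ homog_G homog_F)).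
- by rewrite nth_nil; exact: homog0.
Qed.

Let rules1 : holds eta (fun i => X1 (env i)) root_rules.
Proof. exact: (holds_morphism X1m rules). Qed.

Let rules2 : holds eta (fun i => X2 (env i)) root_rules.
Proof. exact: (holds_morphism X2m rules). Qed.

Let cross i j : X2 (env i) * X1 (env j)
  = if odd_letter i && odd_letter j then - (X1 (env j) * X2 (env i))
    else X1 (env j) * X2 (env i).
Proof.
rewrite X12 /X1 /X2 (fps_tmul_homog _ _ (homog_env i) (homog_env j)).
by rewrite mulr1 mul1r; case: (_ && _); rewrite ?expr1 ?scaleN1r ?expr0 ?scale1r.
Qed.

Let scale_inj := @fps_eta16_inj k (tens U U).

Lemma coproduct_exists :
  exists2 D : {fps U} -> {fps tens U U}, superalg_morphism D & coproduct_values D.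
Proof.
have De : T *T T - V *T V = (eta *: (e0 *T V + T *T e0)) *+ 16 :> {fps tens U U}.
  by rewrite -fps_tpure_scale -Te fps_tpure_difference.
have rels := abstract_coproduct X1m X2m X12 (fun=> erefl) (fun=> erefl)
  tt uu erefl erefl rules1 rules2 cross.
have [D Dm [[DT DV DH DF] [DZ DE DG]]] := lift
  (fps_tpure_coef0 T0 T0) (fps_tpure_coef0 V0 V0) De rels.
exists D; last by split.
have h1 : homogeneous false (1 : {fps U}) by exact: homog1.
apply: (even_morphism Dm).
- rewrite DT DV DH DF; split; [exact: homog_tpure_even | exact: homog_tpure_even| |];
    exact: homog_tpure_even2.
- by rewrite DZ DE DG; split; [exact: homog_tpure_even2| |]; exact: homog_tpure_odd.
Qed.

(** ** The counit *)

Definition counit_values (eps : {fps U} -> {fps k^o}) : Prop :=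
  [/\ eps T = 1, eps V = 1, eps H = 0 & eps F = 0]
  /\ [/\ eps Z = 0, eps E = 0 & eps G = 0].

Lemma counit_exists :
  exists2 eps : {fps U} -> {fps k^o}, superalg_morphism eps & counit_values eps.
Proof.
have e1 : (1 : {fps k^o}) - 1 = (eta *: 0) *+ 16 by rewrite subrr scaler0 mul0rn.
have rels := trivial_deformed eta (A := {fps k^o}) 0.
have rels' : holds eta (env_of [:: 0; (1 : {fps k^o}) + 1; 1 - 1; 0 *+ 2; 0; 0;
    (eta *: 0) *+ 16; 0]) deformed_rels.
  by rewrite subrr scaler0 !mul0rn -mulr2n.
have [eps em [v1 v2]] := lift (C := k^o) erefl erefl e1 rels'.
exists eps; last by split.
case: v1 v2 => [eT eV eH eF] [eZ eE eG].
apply: (even_morphism em); rewrite ?eT ?eV ?eH ?eF ?eZ ?eE ?eG.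
  by split; [exact: homog1 | exact: homog1 | exact: homog0 | exact: homog0].
by split; exact: homog0.
Qed.

(** ** The antipode *)

Definition antipode_values (S : {fps U} -> {fps U}) : Prop :=
  [/\ S T = V, S V = T, S H = - (T * H * V) & S F = - (T * F * V)]
  /\ [/\ S Z = - Z, S E = - E & S G = - G].

Variable i : k.
Hypothesis imaginary : i * i = -1.

Lemma antimorphism_exists : exists S : {fps U} -> {fps U},
  [/\ linear S, S 1 = 1 & forall x y, S (x * y) = S y * S x]
  /\ [/\ S T = V, S V = T, S H = - (T * H * V) & S F = - (T * F * V)]
  /\ [/\ S Z = - Z, S E = (i%:S : {fps k}) *: E & S G = (i%:S : {fps k}) *: G].
Proof.
pose I : {fps k} := i%:S.
have II : I * I = -1 by rewrite -[LHS]/((i : k^o)%:S * i%:S) -fpsCM imaginary fpsCN.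
have Ie : (- e0 : {fps U^c}) = - e0 by [].
have De : V - T = (eta *: (- e0)) *+ 16 by rewrite scalerN mulNrn -Te opprB.
have rels : holds eta (env_of [:: 0; V + T; V - T; (- (T * H * V)) *+ 2; - (T * F * V);
    - Z; (eta *: (I *: E)) *+ 16; I *: G]) (rev_rels deformed_rels).
  have c x : x * I%:A = I%:A * x :> {fps U} by rewrite mulr_algl mulr_algr.
  have Im : I%:A * I%:A = -1 :> {fps U} by rewrite mulr_algl scalerA II scaleN1r.
  have := antipode_deformed rules Im c 0.
  rewrite /env /env_of /= tt uu !mulr_algl [V + T]addrC.
  have -> : - (T * (H *+ 2) * V) = (- (T * H * V)) *+ 2.
    by rewrite mulrnAr mulrnAl mulNrn.
  by have -> : I *: Es = (eta *: (I *: E)) *+ 16 by rewrite -scalerMnr !scalerA mulrC.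
have rels' : @holds _ eta {fps U^c} (env_of [:: 0; V + T; V - T; (- (T * H * V)) *+ 2;
    - (T * F * V); - Z; (eta *: (I *: E)) *+ 16; I *: G]) deformed_rels.
  exact/holds_converse.
have [S' Sm [[ST SV SH SF] [SZ SE SG]]] := lift (C := U^c) V0 T0 De rels'.
exists S'; split; last by [].
split; [exact: amor_linear Sm | exact: amor_1 Sm |] => x y.
by rewrite (amor_M Sm) fps_converse_mul.
Qed.

(** The odd values of the ordinary antihomomorphism are multiplied by i once more, so
    that an odd generator X goes to i ^ 2 X = - X. *)
Lemma antipode_exists :
  exists2 S : {fps U} -> {fps U}, superalg_antimorphism S & antipode_values S.
Proof.
pose I : {fps k} := i%:S.
have II : I * I = -1 by rewrite -[LHS]/((i : k^o)%:S * i%:S) -fpsCM imaginary fpsCN.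
have [S' [[Sl S1 SM] [[ST SV SH SF] [SZ SE SG]]]] := antimorphism_exists.
have SD x y : S' (x + y) = S' x + S' y by rewrite -[x]scale1r Sl !scale1r.
have S0 : S' 0 = 0 by apply: (addrI (S' 0)); rewrite -SD !addr0.
have SZc (c : {fps k}) x : S' (c *: x) = c *: S' x.
  by rewrite -[c *: x]addr0 Sl S0 addr0.
have Spar : forall d x, S' (spart d x) = spart d (S' x).
  apply: (parity_on_generators Sl).
    apply: generator_parities => //.
      rewrite ST SV SH SF; split=> //; apply: homogN;
        by apply: (@homogM _ _ false false) => //; apply: (@homogM _ _ false false).
    by rewrite SZ SE SG; split; [exact: homogN | exact: homogZ | exact: homogZ].
  split.
  - by move=> x y hx hy d; rewrite linearD /= !SD linearD /= hx hy.
  - by move=> c x hx d; rewrite linearZ /= !SZc linearZ /= hx.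
  - move=> x y hx hy d.
    by rewrite spart_mul SD !SM !hx !hy spart_mulV.
  - by move=> x hx d; apply: hpar_inj; rewrite /= -SZc -!linearZ /= hx SZc.
  - move=> x y hx hy xy yx px d; apply: (spart_preserved (f := S' : {fps U} -> {fps U})) S0 hy _ d.
    have hfx : homogeneous false (S' x) by rewrite /homogeneous -px hx.
    by apply: (homog_inverse_even hfx); rewrite -SM ?xy ?yx S1.
pose S x := S' (spart false x) + I *: S' (spart true x) : {fps U}.
have Sh d x : homogeneous d x -> S x = (if d then I else 1) *: S' x.
  move=> hx; rewrite /S !(homog_spart _ hx).
  by case: d {hx}; rewrite /= S0 ?scaler0 ?add0r ?addr0 ?scale1r.
exists S.
  split.
  - move=> c x y; rewrite /S !linearP /= !Sl scalerDr !scalerDr addrACA !scalerA.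
    by rewrite (mulrC I).
  - by rewrite (Sh false) ?scale1r //; exact: homog1.
  - move=> a b x y hx hy.
    rewrite (Sh _ _ (homogM hx hy)) (Sh _ _ hx) (Sh _ _ hy) SM -scalerAl -scalerAr !scalerA.
    congr (_ *: _).
    case: a b {hx hy} => [] []; rewrite /= ?mul1r ?mulr1 //.
    by rewrite expr1 mulN1r mulNr II opprK.
  - move=> d x; rewrite (Sh d _ (sparts d x)) /S.
    have sD a b : spart d (a + b) = spart d a + spart d b :> {fps U} by rewrite linearD.
    have sZ c a : spart d (c *: a) = c *: spart d a :> {fps U} by rewrite linearZ.
    rewrite sD sZ -!Spar !spartK.
    by case: d {sD sZ}; rewrite /= S0 ?scaler0 ?addr0 ?add0r ?scale1r.
have I2 x : I *: (I *: x) = - x :> {fps U} by rewrite scalerA II scaleN1r.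
have even x : homogeneous false x -> S x = S' x by move=> hx; rewrite (Sh _ _ hx) scale1r.
have odd x : homogeneous true x -> S x = I *: S' x by exact: (Sh true).
split; split; rewrite ?(even _ homog_T) ?(even _ homog_V) ?(even _ homog_H)
  ?(even _ homog_F) ?(even _ homog_Z) ?(odd _ homog_E) ?(odd _ homog_G) //.
- by rewrite SE I2.
- by rewrite SG I2.
Qed.

Let root_commutes : [/\ E * u = u * E, E * t = t * E, G * u = u * G & G * t = t * G].
Proof.
have d : holds eta env [:: (xE * xu, xu * xE); (xE * xt, xt * xE);
    (xG * xu, xu * xG); (xG * xt, xt * xG)]%nc.
  by apply: (nc_derive (n := 60%N) rules); vm_compute.
case: d => [Eu [Et [Gu [Gt _]]]]; split => //.
- exact: fps_eta16_commute Eu.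
- exact: fps_eta16_commute Et.
Qed.

(** ** The laws of a Hopf superalgebra *)

Section HopfLaws.
Variables (D : {fps U} -> {fps tens U U}) (eps : {fps U} -> {fps k^o})
  (S : {fps U} -> {fps U}).
Hypotheses (Dm : superalg_morphism D) (Dv : coproduct_values D).
Hypotheses (em : superalg_morphism eps) (ev : counit_values eps).
Hypotheses (Sm : superalg_antimorphism S) (Sv : antipode_values S).

Let Da := superalg_alg_morphism Dm.
Let ea := superalg_alg_morphism em.
Let Slin := santi_linear Sm.

Let D1 : D 1 = 1 *T 1. Proof. by rewrite (amor_1 Da) fps_tpure1. Qed.

(* Square roots with constant term 1 are unique, so morphisms respect them. *)
Let sqrt_value (x y : {fps U}) (z : {fps tens U U}) : x 0%N = 1 -> x * x = y ->
  z 0%N = 1 -> D y = z * z -> D x = z.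
Proof.
move=> x0 xy z0 Dy; rewrite (fps_sqrt_unique z0 erefl) -Dy -xy (amor_M Da).
exact: fps_sqrt_unique (linear_coef0 (amor_linear Da) (amor_1 Da) x0) erefl.
Qed.

Lemma coproduct_t : D t = t *T t.
Proof.
case: Dv => -[DT _ _ _] _; apply: (sqrt_value t0 tt); first exact: fps_tpure_coef0.
by rewrite DT fps_tmul_even ?tt //; left.
Qed.

Lemma coproduct_u : D u = u *T u.
Proof.
case: Dv => -[_ DV _ _] _; apply: (sqrt_value u0 uu); first exact: fps_tpure_coef0.
by rewrite DV fps_tmul_even ?uu //; left.
Qed.

Lemma counit_t : eps t = 1.
Proof.
case: ev => -[eT _ _ _] _.
rewrite [RHS](@fps_sqrt_unique k k^o 1 1) ?mulr1 // -eT -tt (amor_M ea).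
exact: fps_sqrt_unique (linear_coef0 (amor_linear ea) (amor_1 ea) t0) erefl.
Qed.

Lemma counit_u : eps u = 1.
Proof.
case: ev => -[_ eV _ _] _.
rewrite [RHS](@fps_sqrt_unique k k^o 1 1) ?mulr1 // -eV -uu (amor_M ea).
exact: fps_sqrt_unique (linear_coef0 (amor_linear ea) (amor_1 ea) u0) erefl.
Qed.

Lemma antipode_M_even x y : homogeneous false x -> homogeneous false y ->
  S (x * y) = S y * S x.
Proof. by move=> hx hy; rewrite (santi_M Sm hx hy) scale1r. Qed.

Lemma antipode_t : S t = u.
Proof.
case: Sv => -[ST _ _ _] _.
rewrite [RHS](fps_sqrt_unique u0 uu) -ST -tt antipode_M_even //.
exact: fps_sqrt_unique (linear_coef0 Slin (santi_1 Sm) t0) erefl.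
Qed.

Lemma antipode_u : S u = t.
Proof.
case: Sv => -[_ SV _ _] _.
rewrite [RHS](fps_sqrt_unique t0 tt) -SV -uu antipode_M_even //.
exact: fps_sqrt_unique (linear_coef0 Slin (santi_1 Sm) u0) erefl.
Qed.

Let idm : superalg_morphism (@id {fps U}). Proof. by split. Qed.

Let tmapDl := fps_tmap_pure (smor_linear Dm) (smor_linear idm).
Let tmapDr := fps_tmap_pure (smor_linear idm) (smor_linear Dm).
Let tmapEl := fps_tmap_pure (smor_linear em) (smor_linear idm).
Let tmapEr := fps_tmap_pure (smor_linear idm) (smor_linear em).
Let tmapSl := fps_tmap_pure Slin (smor_linear idm).
Let tmapSr := fps_tmap_pure (smor_linear idm) Slin.

Let tmap_morphism (A B A' B' : superAlgType k) (f : {fps A} -> {fps A'})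
    (g : {fps B} -> {fps B'}) : superalg_morphism f -> superalg_morphism g ->
  alg_morphism (fps_tmap f g).
Proof.
move=> fm gm; split; last exact: fps_tmap_M.
  exact: fps_tmap_linear (smor_linear fm) (smor_linear gm).
exact: fps_tmap_1.
Qed.

Let assoc_morphism : alg_morphism (fps_map (@tassoc k U U U)).
Proof.
split; [exact: fps_assoc_linear | | exact: fps_assoc_M].
by rewrite -!fps_tpure1 fps_assoc_pure.
Qed.

Let unitl_morphism : alg_morphism (fps_map (@tunitl k U)).
Proof.
split; [exact: fps_unitl_linear | | exact: fps_unitl_M].
by rewrite -fps_tpure1 fps_unitl_pure scale1r.
Qed.

Let unitr_morphism : alg_morphism (fps_map (@tunitr k U)).
Proof.
split; [exact: fps_unitr_linear | | exact: fps_unitr_M].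
by rewrite -fps_tpure1 fps_unitr_pure scale1r.
Qed.

Let comp_morphism (A B C : algType {fps k}) (f : B -> C) (g : A -> B) :
  alg_morphism f -> alg_morphism g -> alg_morphism (fun x => f (g x)).
Proof.
move=> fm gm; split=> [c x y||x y].
- by rewrite (amor_linear gm) (amor_linear fm).
- by rewrite (amor_1 gm) (amor_1 fm).
- by rewrite (amor_M gm) (amor_M fm).
Qed.

Let coassoc_l x := fps_map (@tassoc k U U U) (fps_tmap D id (D x)).
Let coassoc_r x := fps_tmap id D (D x).

Let coassoc_twisted X a b : D X = X *T a + b *T X -> D a = a *T a -> D b = b *T b ->
  coassoc_l X = coassoc_r X.
Proof.
move=> DX Da' Db; rewrite /coassoc_l /coassoc_r DX.
rewrite (amorD (tmap_morphism Dm idm)) (amorD (tmap_morphism idm Dm)).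
rewrite !tmapDl !tmapDr DX Da' Db fps_tpureDl fps_tpureDr !(amorD assoc_morphism).
by rewrite !fps_assoc_pure addrA.
Qed.

Lemma hopf_coassoc x : coassoc_l x = coassoc_r x.
Proof.
move: x; apply: agree_on_generators.
- exact: comp_morphism assoc_morphism (comp_morphism (tmap_morphism Dm idm) Da).
- exact: comp_morphism (tmap_morphism idm Dm) Da.
case: Dv => -[DT DV DH DF] [DZ DE DG].
have grp X : D X = X *T X -> coassoc_l X = coassoc_r X.
  by move=> DX; rewrite /coassoc_l /coassoc_r DX tmapDl tmapDr DX fps_assoc_pure.
split; split; [exact: grp | exact: grp | | | | |].
- exact: (coassoc_twisted DH).
- exact: (coassoc_twisted DF).
- exact: (coassoc_twisted DZ D1 D1).
- exact: (coassoc_twisted DE coproduct_u coproduct_t).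
- exact: (coassoc_twisted DG coproduct_u coproduct_t).
Qed.

Let counit_twisted X a b : D X = X *T a + b *T X -> eps X = 0 -> eps a = 1 -> eps b = 1 ->
  fps_map (@tunitl k U) (fps_tmap eps id (D X)) = X /\
  fps_map (@tunitr k U) (fps_tmap id eps (D X)) = X.
Proof.
move=> DX eX ea' eb; rewrite DX.
rewrite (amorD (tmap_morphism em idm)) (amorD (tmap_morphism idm em)) !tmapEl !tmapEr.
rewrite (amorD unitl_morphism) (amorD unitr_morphism) !fps_unitl_pure !fps_unitr_pure.
by rewrite eX ea' eb !scale0r !scale1r addr0 add0r.
Qed.

Lemma hopf_counit :
  (forall x, fps_map (@tunitl k U) (fps_tmap eps id (D x)) = x) /\
  (forall x, fps_map (@tunitr k U) (fps_tmap id eps (D x)) = x).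
Proof.
case: Dv ev => -[DT DV DH DF] [DZ DE DG] -[[eT eV eH eF] [eZ eE eG]].
have grp X : D X = X *T X -> eps X = 1 ->
    fps_map (@tunitl k U) (fps_tmap eps id (D X)) = X /\
    fps_map (@tunitr k U) (fps_tmap id eps (D X)) = X.
  by move=> DX eX; rewrite DX tmapEl tmapEr fps_unitl_pure fps_unitr_pure eX scale1r.
have [Tl Tr] := grp _ DT eT; have [Vl Vr] := grp _ DV eV.
have [Hl Hr] := counit_twisted DH eH eT eV; have [Fl Fr] := counit_twisted DF eF eT eV.
have [Zl Zr] := counit_twisted DZ eZ (amor_1 ea) (amor_1 ea).
have [El Er] := counit_twisted DE eE counit_u counit_t.
have [Gl Gr] := counit_twisted DG eG counit_u counit_t.
have idm' : alg_morphism (@id {fps U}) by split.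
split; apply: agree_on_generators idm' _ => //.
- exact: comp_morphism unitl_morphism (comp_morphism (tmap_morphism em idm) Da).
- exact: comp_morphism unitr_morphism (comp_morphism (tmap_morphism idm em) Da).
Qed.

Let mulS X := fps_map (@tmult k U) (fps_tmap S id X).
Let mulSr X := fps_map (@tmult k U) (fps_tmap id S X).

Let mulS_linear : linear mulS.
Proof.
move=> c X Y; rewrite /mulS (fps_tmap_linear Slin (smor_linear idm)).
exact: fps_mult_linear.
Qed.

Let mulSr_linear : linear mulSr.
Proof.
move=> c X Y; rewrite /mulSr (fps_tmap_linear (smor_linear idm) Slin).
exact: fps_mult_linear.
Qed.

Let mulS_pure x y : mulS (x *T y) = S x * y.
Proof. by rewrite /mulS tmapSl fps_mult_pure. Qed.

Let mulSr_pure x y : mulSr (x *T y) = x * S y.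
Proof. by rewrite /mulSr tmapSr fps_mult_pure. Qed.

Let linD (A B : lmodType {fps k}) (f : A -> B) : linear f -> forall x y, f (x + y) = f x + f y.
Proof. by move=> fl x y; rewrite -[x]scale1r fl !scale1r. Qed.

Let lin0 (A B : lmodType {fps k}) (f : A -> B) : linear f -> f 0 = 0.
Proof. by move=> fl; apply: (addrI (f 0)); rewrite -(linD fl) !addr0. Qed.

Let linZ (A B : lmodType {fps k}) (f : A -> B) : linear f ->
  forall c x, f (c *: x) = c *: f x.
Proof. by move=> fl c x; rewrite -[c *: x]addr0 fl (lin0 fl) addr0. Qed.

(* Multiplying by a (x) b wraps mulS X between S a and b, up to a sign. With X = D x
   and mulS X a scalar, this makes the antipode law pass to products. *)
Let mulS_product (d l : bool) X a b :
  mulS (spart d X * (spart l a *T b))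
  = (-1) ^+ (d && l) *: (S (spart l a) * mulS (spart d X) * b).
Proof.
move: X; apply: linear_fps_eq => [c X Y|c X Y|X].
- by rewrite linearP linear_mulr mulS_linear.
- rewrite linearP mulS_linear linear_mull linear_mulr scalerDr.
  by rewrite !scalerA mulrC.
elim/tens_homog_ind: X => [p q x y hx hy|X Y IHX IHY]; last first.
  rewrite fpsCD linearD /= mulrDl !(linD mulS_linear) IHX IHY mulrDr mulrDl scalerDr.
  by [].
rewrite -fps_tpureC; have hX := homog_tpure (homogC hx) (homogC hy).
rewrite !(homog_spart d hX); case: eqP => [->|_]; last first.
  by rewrite mul0r (lin0 mulS_linear) mulr0 mul0r scaler0.
have ha := sparts l a.
rewrite (fps_tmul_homog _ _ (homogC hy) ha) (linZ mulS_linear) !mulS_pure.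
rewrite (santi_M Sm (homogC hx) ha) -scalerAl scalerA -signr_addb !mulrA.
by congr (_ *: _); case: p q l {hx hy hX ha} => [] [] [].
Qed.

Let mulSr_product (d l : bool) Y a b :
  mulSr ((a *T spart l b) * spart d Y)
  = (-1) ^+ (l && d) *: (a * mulSr (spart d Y) * S (spart l b)).
Proof.
move: Y; apply: linear_fps_eq => [c X Y|c X Y|Y].
- by rewrite linearP linear_mull mulSr_linear.
- rewrite linearP mulSr_linear linear_mull linear_mulr scalerDr.
  by rewrite !scalerA mulrC.
elim/tens_homog_ind: Y => [p q x y hx hy|X Y IHX IHY]; last first.
  rewrite fpsCD linearD /= mulrDr !(linD mulSr_linear) IHX IHY mulrDr mulrDl scalerDr.
  by [].
rewrite -fps_tpureC; have hY := homog_tpure (homogC hx) (homogC hy).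
rewrite !(homog_spart d hY); case: eqP => [->|_]; last first.
  by rewrite mulr0 (lin0 mulSr_linear) mulr0 mul0r scaler0.
have hb := sparts l b.
rewrite (fps_tmul_homog _ _ hb (homogC hx)) (linZ mulSr_linear) !mulSr_pure.
rewrite (santi_M Sm hb (homogC hy)) -scalerAr scalerA -signr_addb !mulrA.
by congr (_ *: _); case: p q l {hx hy hY hb} => [] [] [].
Qed.

Let mulS_scalar (d : bool) X (c : {fps k}) : mulS (spart d X) = c *: 1 -> (d -> c = 0) ->
  forall Y, mulS (spart d X * Y) = c *: mulS Y.
Proof.
move=> Xc cd; apply: linear_fps_eq => [a Y Y'|a Y Y'|Y].
- by rewrite linear_mull mulS_linear.
- by rewrite mulS_linear scalerDr !scalerA mulrC.
elim/tens_homog_ind: Y => [p q x y hx hy|Y Y' IH IH']; last first.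
  by rewrite fpsCD mulrDr !(linD mulS_linear) IH IH' scalerDr.
rewrite -fps_tpureC -(homogC hx) mulS_product Xc mulS_pure -scalerAr -!scalerAl mulr1.
by case: d cd {Xc} => [/(_ isT) ->|_]; rewrite /= ?scale0r ?scaler0 ?scale1r.
Qed.

Let mulSr_scalar (d : bool) Y (c : {fps k}) : mulSr (spart d Y) = c *: 1 -> (d -> c = 0) ->
  forall X, mulSr (X * spart d Y) = c *: mulSr X.
Proof.
move=> Yc cd; apply: linear_fps_eq => [a X X'|a X X'|X].
- by rewrite linear_mulr mulSr_linear.
- by rewrite mulSr_linear scalerDr !scalerA mulrC.
elim/tens_homog_ind: X => [p q x y hx hy|X X' IH IH']; last first.
  by rewrite fpsCD mulrDl !(linD mulSr_linear) IH IH' scalerDr.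
rewrite -fps_tpureC -(homogC hy) mulSr_product Yc mulSr_pure -scalerAr -!scalerAl mulr1.
by case: d cd {Yc} => [/(_ isT) ->|_]; rewrite ?andbF /= ?scale0r ?scaler0 ?scale1r.
Qed.

(* The antipode law for the convolution f of S with the identity. It is not an
   equality of morphisms, but it is stable under products of homogeneous elements
   since eps takes scalar values. *)
Let law (f : {fps tens U U} -> {fps U}) x := f (D x) = (eps x : {fps k}) *: 1.

Let eps_odd x : eps (spart true x) = 0. Proof. by rewrite (smor_even em). Qed.

Let law_closed (f : {fps tens U U} -> {fps U}) : linear f -> f 1 = 1 ->
  (forall i j x y, law f (spart i x) -> law f (spart j y) ->
     f (D (spart i x) * D (spart j y)) = (eps (spart i x) * eps (spart j y) : {fps k}) *: 1) ->
  (forall x y, homogeneous false x -> homogeneous false y -> x * y = 1 -> y * x = 1 ->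
     law f x -> law f y) ->
  hclosed (fun x => forall d, law f (spart d x)).
Proof.
move=> fl f1 fM fV.
have lawD x y : law f x -> law f y -> law f (x + y).
  by move=> hx hy; rewrite /law (amorD Da) (amorD ea) (linD fl) hx hy scalerDl.
have law0 : law f 0 by rewrite /law (amor0 Da) (amor0 ea) (lin0 fl) scale0r.
split.
- by move=> x y hx hy d; rewrite linearD /=; apply: lawD; [exact: hx | exact: hy].
- move=> c x hx d; rewrite linearZ /= /law (amorZ Da) (amorZ ea) (linZ fl) hx.
  by rewrite scalerA.
- move=> x y hx hy d; rewrite spart_mul; apply: lawD;
    by rewrite /law (amor_M Da) (amor_M ea); exact: fM.
- move=> x hx d; apply: (@hpar_inj k U); have := hx d.
  rewrite linearZ /= /law (amorZ Da) (amorZ ea) (linZ fl) => ->.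
  by rewrite scalerA.
- move=> x y hx hy xy yx px d; rewrite (homog_spart d hy); case: d => //=.
  by apply: fV xy yx _ => //; rewrite -hx.
Qed.

Let mulS_1 : mulS 1 = 1.
Proof. by rewrite -fps_tpure1 mulS_pure (santi_1 Sm) mulr1. Qed.

Let mulSr_1 : mulSr 1 = 1.
Proof. by rewrite -fps_tpure1 mulSr_pure (santi_1 Sm) mulr1. Qed.

Let mulS_closed : hclosed (fun x => forall d, law mulS (spart d x)).
Proof.
have scal d x : law mulS (spart d x) -> forall Y,
    mulS (D (spart d x) * Y) = (eps (spart d x) : {fps k}) *: mulS Y.
  rewrite /law (smor_even Dm) => h; apply: mulS_scalar h _.
  by move=> dt; rewrite dt eps_odd.
apply: (law_closed mulS_linear mulS_1).
- by move=> i1 j x y hx hy; rewrite scal // hy scalerA.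
- move=> x y hx hy xy yx lx.
  have := scal false x; rewrite hx => /(_ lx (D y)).
  rewrite -(amor_M Da) xy (amor_1 Da) mulS_1 => e1.
  have exy : eps y * eps x = 1 :> {fps k^o} by rewrite -(amor_M ea) yx (amor_1 ea).
  by rewrite /law e1 scalerA [_ * _]exy scale1r.
Qed.

Let mulSr_closed : hclosed (fun x => forall d, law mulSr (spart d x)).
Proof.
have scal d y : law mulSr (spart d y) -> forall X,
    mulSr (X * D (spart d y)) = (eps (spart d y) : {fps k}) *: mulSr X.
  rewrite /law (smor_even Dm) => h; apply: mulSr_scalar h _.
  by move=> dt; rewrite dt eps_odd.
apply: (law_closed mulSr_linear mulSr_1).
- by move=> i1 j x y hx hy; rewrite scal // hx scalerA mulrC.
- move=> x y hx hy xy yx lx.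
  have := scal false x; rewrite hx => /(_ lx (D y)).
  rewrite -(amor_M Da) yx (amor_1 Da) mulSr_1 => e1.
  have exy : eps y * eps x = 1 :> {fps k^o} by rewrite -(amor_M ea) yx (amor_1 ea).
  by rewrite /law e1 scalerA [_ * _]exy scale1r.
Qed.

Let law_generators (f : {fps tens U U} -> {fps U}) : linear f ->
  [/\ law f T, law f V, law f H & law f F] -> [/\ law f Z, law f E & law f G] ->
  on_generators (fun x => forall d, law f (spart d x)).
Proof.
move=> fl [lT lV lH lF] [lZ lE lG].
have law0 : law f 0 by rewrite /law (amor0 Da) (amor0 ea) (lin0 fl) scale0r.
have h (b : bool) x : homogeneous b x -> law f x -> forall d, law f (spart d x).
  by move=> hx lx d; rewrite (homog_spart d hx); case: ifP.
by split; split; apply: h; eassumption.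
Qed.

Let law_everywhere (f : {fps tens U U} -> {fps U}) : linear f ->
  hclosed (fun x => forall d, law f (spart d x)) ->
  on_generators (fun x => forall d, law f (spart d x)) -> forall x, law f x.
Proof.
move=> fl cl gen; apply: linear_fps_eq => [c x y|c x y|a].
- by rewrite (amor_linear Da) fl.
- by rewrite (amor_linear ea) scalerDl scalerA.
have h := generated cl gen a; rewrite -[a%:S]spart_sum.
have := h false; have := h true; rewrite /law => h1 h0.
by rewrite (amorD Da) (amorD ea) (linD fl) h1 h0 scalerDl.
Qed.

Lemma hopf_antipode : (forall x, law mulS x) /\ (forall x, law mulSr x).
Proof.
case: Dv ev Sv => -[DT DV DH DF] [DZ DE DG] -[[eT eV eH eF] [eZ eE eG]].
move=> -[[ST SV SH SF] [SZ SE SG]].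
have S1 := santi_1 Sm.
have conj X : T * X * V * T = T * X by rewrite -mulrA VT mulr1.
have conj' X : V * (T * X * V) = X * V by rewrite !mulrA VT mul1r.
have [Eu Et Gu Gt] := root_commutes.
split; apply: law_everywhere => //; try exact: mulS_closed; try exact: mulSr_closed;
  apply: law_generators => //.
- split; rewrite /law.
  + by rewrite DT mulS_pure ST eT VT scale1r.
  + by rewrite DV mulS_pure SV eV TV scale1r.
  + by rewrite DH (linD mulS_linear) !mulS_pure SH SV eH scale0r mulNr conj addNr.
  + by rewrite DF (linD mulS_linear) !mulS_pure SF SV eF scale0r mulNr conj addNr.
- split; rewrite /law.
  + by rewrite DZ (linD mulS_linear) !mulS_pure SZ S1 eZ scale0r mulr1 mul1r addNr.
  + by rewrite DE (linD mulS_linear) !mulS_pure SE antipode_t eE scale0r mulNr Eu addNr.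
  + by rewrite DG (linD mulS_linear) !mulS_pure SG antipode_t eG scale0r mulNr Gu addNr.
- split; rewrite /law.
  + by rewrite DT mulSr_pure ST eT TV scale1r.
  + by rewrite DV mulSr_pure SV eV VT scale1r.
  + by rewrite DH (linD mulSr_linear) !mulSr_pure SH ST eH scale0r mulrN conj' subrr.
  + by rewrite DF (linD mulSr_linear) !mulSr_pure SF ST eF scale0r mulrN conj' subrr.
- split; rewrite /law.
  + by rewrite DZ (linD mulSr_linear) !mulSr_pure SZ S1 eZ scale0r mulr1 mul1r subrr.
  + by rewrite DE (linD mulSr_linear) !mulSr_pure SE antipode_u eE scale0r mulrN Et subrr.
  + by rewrite DG (linD mulSr_linear) !mulSr_pure SG antipode_u eG scale0r mulrN Gt subrr.
Qed.

Lemma generated_hopf : is_hopf_superalgebra (HopfOps D eps S).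
Proof.
have [cl cr] := hopf_counit; have [al ar] := hopf_antipode.
by split => //=; exact: hopf_coassoc.
Qed.
End HopfLaws.

(** ** The remaining generators *)

(* The third hypothesis is H2 = (Z - (T + V) H / 2) / 2, cleared of denominators. *)
Variables E2 F3 H2 H3 : {fps U}.
Hypotheses (E2_def : E2 = F * E - E * F) (F3_def : F3 = G * F - F * G)
  (H2_def : H2 *+ 8 = Z *+ 4 - (T + V) * (H *+ 2)) (H3_def : H3 = Z - H2).

Let q : {fps k} := 4^-1%:S.
Let r : {fps k} := 2^-1%:S.

Let mul8_inj (A : lmodType k) (x y : {fps A}) : x *+ 8 = y *+ 8 -> x = y.
Proof. by rewrite -[8%N]/(2 * 2 * 2)%N !mulrnA => /fps_mul2_inj/fps_mul2_inj/fps_mul2_inj. Qed.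

Let q8 (A : lmodType k) (x : {fps A}) : (q *: x) *+ 8 = x *+ 2.
Proof. by rewrite -[8%N]/(4 * 2)%N mulrnA (fps_scale_natK 3). Qed.

Let r8 (A : lmodType k) (x : {fps A}) : (r *: x) *+ 8 = x *+ 4.
Proof. by rewrite -[8%N]/(2 * 4)%N mulrnA (fps_scale_natK 1). Qed.

Let eta2 (A : lmodType k) (x : {fps A}) : (eta *+ 2) *: x = (q * hpar) *: x.
Proof.
apply: mul8_inj; rewrite -scalerMnl -mulrnA -[(q * _) *: _]scalerA q8 (fps_eta16 x).
by [].
Qed.

Let eta4 (A : lmodType k) (x : {fps A}) : (eta *: x) *+ 4 = (r * hpar) *: x.
Proof.
apply: mul8_inj; rewrite -mulrnA -[(r * _) *: _]scalerA r8.
by rewrite -[(4 * 8)%N]/(16 * 2)%N mulrnA fps_eta16 -mulrnA.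
Qed.

Section DerivedCoproduct.
Variable D : {fps U} -> {fps tens U U}.
Hypotheses (Dm : alg_morphism D) (Dv : coproduct_values D).

Let descendant X : X = E \/ X = G ->
  D (F * X - X * F) = (F * X - X * F) *T t + u *T (F * X - X * F)
    + (q * hpar) *: ((V * X) *T (u * H + H * u))
    - (q * hpar) *: ((t * H + H * t) *T (T * X)).
Proof.
move=> hX; rewrite (amorB Dm) !(amor_M Dm).
case: Dv => -[_ _ _ ->] [_ DE DG].
have -> : D X = X *T u + t *T X by case: hX => ->.
have := abstract_coproduct_descendant X1m X2m X12
  (@fps_eta16_inj _ _) tt uu erefl erefl rules1 rules2 cross hX.
by rewrite -!eta2.
Qed.

Lemma coproduct_E2 : D E2 = E2 *T t + u *T E2
  + (q * hpar) *: ((V * E) *T (u * H + H * u))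
  - (q * hpar) *: ((t * H + H * t) *T (T * E)).
Proof. by rewrite E2_def descendant //; left. Qed.

Lemma coproduct_F3 : D F3 = F3 *T t + u *T F3
  - (q * hpar) *: ((V * G) *T (u * H + H * u))
  + (q * hpar) *: ((t * H + H * t) *T (T * G)).
Proof.
rewrite F3_def -opprB (amorN Dm) descendant; last by right.
by rewrite fps_tpureNl fps_tpureNr opprD opprK opprD opprD.
Qed.

Lemma coproduct_H2 : D H2 = H2 *T 1 + 1 *T H2
  + q *: ((T * H) *T (1 - T ^+ 2)) + q *: ((1 - V ^+ 2) *T (V * H)).
Proof.
apply: mul8_inj; rewrite -(amorMn Dm) H2_def.
rewrite (amorB Dm) (amorMn Dm) (amor_M Dm) (amorMn Dm) (amorD Dm T).
case: Dv => -[-> -> -> _] [-> _ _]; rewrite -fps_tpure_double.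
have -> := abstract_coproduct_H2 X1m X2m X12 (fun=> erefl) (fun=> erefl)
  tt uu rules1 rules2 cross.
rewrite -H2_def -!X12 !(amorMn X1m) !(amorMn X2m) !mulrnAr.
rewrite !mulrnDl !q8 !mulrnAl (amorMn X1m) (amorMn X2m) mulrnAl mulrnAr.
by rewrite -!expr2.
Qed.

Lemma coproduct_H3 : D H3 = H3 *T 1 + 1 *T H3
  - q *: ((T * H) *T (1 - T ^+ 2)) - q *: ((1 - V ^+ 2) *T (V * H)).
Proof.
rewrite {1}H3_def (amorB Dm) coproduct_H2; case: Dv => _ [-> _ _].
rewrite H3_def (fps_tpureDl Z) (fps_tpureDr _ Z) fps_tpureNl fps_tpureNr !opprD !addrA.
by rewrite [Z *T 1 - _ + _]addrAC.
Qed.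
End DerivedCoproduct.

Section DerivedAntipode.
Variable S : {fps U} -> {fps U}.
Hypotheses (Sm : superalg_antimorphism S) (Sv : antipode_values S).

Let Slin := santi_linear Sm.
Let SD x y : S (x + y) = S x + S y. Proof. by rewrite -[x]scale1r Slin !scale1r. Qed.

Let S0 : S 0 = 0. Proof. by apply: (addrI (S 0)); rewrite -SD !addr0. Qed.

Let SN x : S (- x) = - S x.
Proof. by rewrite -scaleN1r -[_ *: x]addr0 Slin S0 addr0 scaleN1r. Qed.

Let SMn x n : S (x *+ n) = S x *+ n.
Proof. by elim: n => [|n IH]; rewrite ?mulr0n // !mulrS SD IH. Qed.

Let SMl x y : homogeneous false x -> S (x * y) = S y * S x.
Proof.
move=> hx; rewrite -(spart_sum y) mulrDr SD.
rewrite !(santi_M Sm hx (sparts _ _)) !scale1r -mulrDl -SD.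
by [].
Qed.

Let SMr x y : homogeneous false y -> S (x * y) = S y * S x.
Proof.
move=> hy; rewrite -(spart_sum x) mulrDl SD.
by rewrite !(santi_M Sm (sparts _ _) hy) !scale1r -mulrDr -SD.
Qed.

Let descendant X : X = E \/ X = G ->
  S (F * X - X * F) = - (F * X - X * F) - (r * hpar) *: ((T + V) * X).
Proof.
move=> hX; rewrite SD SN (SMl _ homog_F) (SMr _ homog_F).
case: Sv => -[_ _ _ ->] [_ SE SG].
have -> : S X = - X by case: hX => ->.
rewrite !mulrNN -eta4.
have := antipode_descendants_hold rules; rewrite /env /env_of /= tt uu.
case: hX => -> [hE hG] //; apply: fps_eta16_inj => /=.
move: hE; rewrite !mulrnAl !mulrnAr -!scalerAl -!scalerAr -!mulrnBl -!scalerBr => ->.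
rewrite [RHS](_ : _ = (eta *: - (F * E - E * F)) *+ 16
    - (eta *: ((eta *: ((T + V) * E)) *+ 4)) *+ 16); last by rewrite scalerBr mulrnBl.
by rewrite scalerN mulNrn -!scalerMnr -!mulrnA.
Qed.

Lemma antipode_E2 : S E2 = - E2 - (r * hpar) *: ((T + V) * E).
Proof. by rewrite E2_def descendant //; left. Qed.

Lemma antipode_F3 : S F3 = - F3 + (r * hpar) *: ((T + V) * G).
Proof. by rewrite F3_def -opprB SN descendant ?opprD ?opprK //; right. Qed.

Lemma antipode_H2 : S H2 = - H2 + r *: (V ^+ 2 - 1).
Proof.
apply: mul8_inj; rewrite -SMn H2_def SD SN !SMn SMl; last exact: homogD.
case: Sv => -[ST SV SH _] [SZ _ _]; rewrite SMn SD ST SV SH SZ.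
rewrite mulrnDl r8 !mulNrn H2_def mulNr opprK opprB.
have := antipode_H2_hold rules; rewrite /env /env_of /= tt uu.
rewrite !mulrnAr !mulrnAl [V + T]addrC => ->.
by rewrite expr2 addrCA addrA.
Qed.

Lemma antipode_H3 : S H3 = - H3 - r *: (V ^+ 2 - 1).
Proof.
rewrite H3_def SD SN antipode_H2; case: Sv => _ [-> _ _].
by rewrite opprD opprK opprB addrA [- Z + _]addrC.
Qed.
End DerivedAntipode.

(** ** Existence and uniqueness *)

Lemma counit_derived (eps : {fps U} -> {fps k^o}) : alg_morphism eps -> counit_values eps ->
  [/\ eps H2 = 0, eps H3 = 0, eps E2 = 0 & eps F3 = 0].
Proof.
move=> em -[[eT eV eH eF] [eZ eE eG]].
have e2 : eps H2 = 0.
  apply: mul8_inj; rewrite -(amorMn em) H2_def (amorB em) (amor_M em) !(amorMn em).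
  by rewrite eZ eH !mul0rn mulr0 subr0.
split=> //.
- by rewrite H3_def (amorB em) eZ e2 subr0.
- by rewrite E2_def (amorB em) !(amor_M em) eF eE !mul0r subr0.
- by rewrite F3_def (amorB em) !(amor_M em) eF eG !mul0r subr0.
Qed.

(** Graded antihomomorphisms that agree on the homogeneous components of x and y
    agree on those of x * y; so agreement spreads from the generators. *)
Lemma antipode_unique (S S' : {fps U} -> {fps U}) :
  superalg_antimorphism S -> antipode_values S ->
  superalg_antimorphism S' -> antipode_values S' -> S =1 S'.
Proof.
move=> Sm Sv Sm' Sv'; apply: linear_fps_eq (santi_linear Sm) (santi_linear Sm') _.
have SD x y : S (x + y) = S x + S y by rewrite -[x]scale1r (santi_linear Sm) !scale1r.
have SD' x y : S' (x + y) = S' x + S' y by rewrite -[x]scale1r (santi_linear Sm') !scale1r.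
have S0 : S 0 = 0 by apply: (addrI (S 0)); rewrite -SD !addr0.
have S0' : S' 0 = 0 by apply: (addrI (S' 0)); rewrite -SD' !addr0.
have SZ c x : S (c *: x) = c *: S x by rewrite -[_ *: x]addr0 (santi_linear Sm) S0 addr0.
have SZ' c x : S' (c *: x) = c *: S' x.
  by rewrite -[_ *: x]addr0 (santi_linear Sm') S0' addr0.
pose P x := forall d, S (spart d x) = S' (spart d x).
have Phom (b : bool) x : homogeneous b x -> S x = S' x -> P x.
  by move=> hx eq d; rewrite (homog_spart d hx); case: ifP; rewrite ?S0 ?S0'.
have clP : hclosed P.
  split.
  - by move=> x y hx hy d; rewrite linearD /= SD SD' hx hy.
  - by move=> c x hx d; rewrite linearZ /= SZ SZ' hx.
  - move=> x y hx hy d; rewrite spart_mul SD SD'.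
    rewrite !(santi_M Sm (sparts _ _) (sparts _ _)).
    by rewrite !(santi_M Sm' (sparts _ _) (sparts _ _)) !hx !hy.
  - by move=> x hx d; apply: hpar_inj; rewrite /= -SZ -SZ' -!linearZ /= hx.
  - move=> x y hx hy xy yx px; apply: (Phom _ _ hy).
    have px' : S x = S' x by rewrite -hx px.
    have hM z w : homogeneous false z -> homogeneous false w ->
        S (z * w) = S w * S z /\ S' (z * w) = S' w * S' z.
      by move=> hz hw; rewrite (santi_M Sm hz hw) (santi_M Sm' hz hw) !scale1r.
    have e1 : S y * S x = 1 by rewrite -(hM _ _ hx hy).1 xy (santi_1 Sm).
    have e2 : S x * S' y = 1 by rewrite px' -(hM _ _ hy hx).2 yx (santi_1 Sm').
    by rewrite -[S y]mulr1 -e2 mulrA e1 mul1r.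
have genP : on_generators P.
  case: Sv Sv' => -[ST SV SH SF] [SsZ SE SG] -[[ST' SV' SH' SF'] [SsZ' SE' SG']].
  split; split.
  - by apply: (Phom _ _ homog_T); rewrite ST ST'.
  - by apply: (Phom _ _ homog_V); rewrite SV SV'.
  - by apply: (Phom _ _ homog_H); rewrite SH SH'.
  - by apply: (Phom _ _ homog_F); rewrite SF SF'.
  - by apply: (Phom _ _ homog_Z); rewrite SsZ SsZ'.
  - by apply: (Phom _ _ homog_E); rewrite SE SE'.
  - by apply: (Phom _ _ homog_G); rewrite SG SG'.
move=> a; have := generated clP genP a; rewrite -{2 3}[a%:S]spart_sum => h.
by rewrite SD SD' !h.
Qed.

(** The values on the remaining generators follow from those on T, H, F, Z, E and G;
    conversely Z = H_2 + H_3, so the prescribed values determine the ones on Z. *)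
Theorem deformed_hopf : exists! Hf : hopf_ops U,
  let Delta := comult Hf in
  let S := antipode Hf in
  let eps := counit Hf in
  is_hopf_superalgebra Hf
  /\ [/\ Delta H = H *T T + V *T H,
         Delta T = T *T T,
         Delta V = V *T V
       & Delta F = F *T T + V *T F]
  /\ [/\ S H = - (T * H * V), S T = V, S V = T & S F = - (T * F * V)]
  /\ [/\ eps H = 0, eps F = 0, eps T = 1 & eps V = 1]
  /\ Delta E2 = E2 *T t + u *T E2
                + (q * hpar) *: ((V * E) *T (u * H + H * u))
                - (q * hpar) *: ((t * H + H * t) *T (T * E))
  /\ Delta G = G *T u + t *T G
  /\ Delta E = E *T u + t *T E
  /\ Delta F3 = F3 *T t + u *T F3
                - (q * hpar) *: ((V * G) *T (u * H + H * u))
                + (q * hpar) *: ((t * H + H * t) *T (T * G))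
  /\ Delta H2 = H2 *T 1 + 1 *T H2
                + q *: ((T * H) *T (1 - T ^+ 2))
                + q *: ((1 - V ^+ 2) *T (V * H))
  /\ Delta H3 = H3 *T 1 + 1 *T H3
                - q *: ((T * H) *T (1 - T ^+ 2))
                - q *: ((1 - V ^+ 2) *T (V * H))
  /\ S E2 = - E2 - (r * hpar) *: ((T + V) * E)
  /\ S F3 = - F3 + (r * hpar) *: ((T + V) * G)
  /\ S G = - G
  /\ S E = - E
  /\ S H2 = - H2 + r *: (V ^+ 2 - 1)
  /\ S H3 = - H3 - r *: (V ^+ 2 - 1)
  /\ [/\ eps H2 = 0, eps H3 = 0 & eps E2 = 0]
  /\ [/\ eps G = 0, eps E = 0 & eps F3 = 0].
Proof.
have [D Dm Dv] := coproduct_exists.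
have [eps em ev] := counit_exists.
have [S Sm Sv] := antipode_exists.
have Z23 : Z = H2 + H3 by rewrite H3_def addrC subrK.
exists (HopfOps D eps S); split.
  have Da := superalg_alg_morphism Dm; have ea := superalg_alg_morphism em.
  have [e2 e3 eE2 eF3] := counit_derived ea ev.
  split; first exact: generated_hopf.
  rewrite /= coproduct_E2 // coproduct_F3 // coproduct_H2 // coproduct_H3 //.
  rewrite antipode_E2 // antipode_F3 // antipode_H2 // antipode_H3 //.
  case: Dv ev Sv => -[? ? ? ?] [? ? ?] -[[? ? ? ?] [? ? ?]] [[? ? ? ?] [? ? ?]].
  by do !split.
move=> [D' eps' S'] /= [[/= Dm' em' Sm' _ _ _ _ _]].
case=> [[DH DT DV DF]] [[SH ST SV SF]] [[eH eF eT eV]] [_] [DG] [DE] [_] [DH2] [DH3].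
case=> [_] [_] [SG] [SE] [SH2] [SH3] [[e2 e3 _]] [eG eE _].
have Da' := superalg_alg_morphism Dm'; have ea' := superalg_alg_morphism em'.
have Dv' : coproduct_values D'.
  split; split=> //; rewrite Z23 (amorD Da') DH2 DH3.
  rewrite (fps_tpureDl H2 H3) (fps_tpureDr 1 H2 H3) (addrACA (H2 *T 1)).
  set a := q *: _; set b := q *: _.
  by rewrite -[_ + a + b]addrA -[_ - a - b]addrA -opprD [LHS]addrACA subrr addr0.
have ev' : counit_values eps' by split; split=> //; rewrite Z23 (amorD ea') e2 e3 addr0.
have Sv' : antipode_values S'.
  split; split=> //.
  have -> : S' Z = S' H2 + S' H3.
    by rewrite {1}Z23 -[H2]scale1r (santi_linear Sm') !scale1r.
  by rewrite SH2 SH3 addrACA subrr addr0 Z23 opprD.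
congr HopfOps; apply/funext.
- apply: agree_on_generators (superalg_alg_morphism Dm) Da' _.
  case: Dv Dv' => -[? ? ? ?] [? ? ?] -[[? ? ? ?] [? ? ?]].
  by split; split; congruence.
- apply: agree_on_generators (superalg_alg_morphism em) ea' _.
  case: ev ev' => -[? ? ? ?] [? ? ?] -[[? ? ? ?] [? ? ?]].
  by split; split; congruence.
- exact: antipode_unique.
Qed.
End HopfStructure.

(** * The Hopf superalgebra U_h(sl(2|1)) *)

Section Generation.
Variable k : numFieldType.
Local Notation U := (Usl21 k).
Local Notation h1 := (ugen (gen_h node1) : U).
Local Notation h2 := (ugen (gen_h node2) : U).
Local Notation e1 := (ugen (gen_e node1) : U).
Local Notation e2 := (ugen (gen_e node2) : U).
Local Notation f1 := (ugen (gen_f node1) : U).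
Local Notation f2 := (ugen (gen_f node2) : U).

Local Notation eta := (fps_eta k).
Local Notation T := (dT k).
Local Notation TV := (dTV k).
Local Notation Th := (dTh k).
Local Notation TVh := (dTVh k).
Local Notation W := (dW k *+ 2).
Local Notation H := (dH1 k *+ 2).
Local Notation F := (dF1 k).
Local Notation Z := (uZ k)%:S.
Local Notation E := (dE3 k).
Local Notation G := (dF2 k).
Local Notation on_generators := (on_generators T TV (dH1 k) F Z E G).

Lemma homog_e1 : homogeneous false (e1%:S : {fps U}).
Proof. exact/homogC/ugen_homogeneous. Qed.

Lemma homog_dW : homogeneous false (dW k).
Proof.
apply/homog_sqrt/homogD; first exact: homog1.
by apply/homogZ/homogC; rewrite expr2; apply: (@homogM _ _ false false);
  exact: ugen_homogeneous.
Qed.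

(** Here dW is invertible, so h_1 = dW^-1 H_1 is reached; then f_1 is F_1 up to a
    polynomial in e_1 and h_1, and e_2 = [f_1, e_3]. *)
Lemma generation (P : {fps U} -> Prop) : hclosed P -> on_generators P ->
  forall a : U, P a%:S.
Proof.
move=> [PD PZ PM Pdiv PV] [[PT PTV PH1 PF1] [PuZ PE3 PF2]].
have PN x : P x -> P (- x) by move=> Px; rewrite -scaleN1r; apply: PZ.
have PB x y : P x -> P y -> P (x - y) by move=> Px Py; apply: PD => //; apply: PN.
have halve x : P (x *+ 2) -> P x.
  by move=> Px; rewrite -[x](fps_scale_natK 1) scalerMnr; apply: PZ.
have Pe1 : P e1%:S.
  by apply/Pdiv/halve; rewrite -fps_eta16; move: (PB _ _ PT PTV); rewrite dTB.
have PW : P (dW k) by apply: halve; rewrite -dTD; apply: PD.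
have [v [Wv vW _]] := fps_inverse (erefl : dW k 0%N = 1).
have Pv : P v.
  exact: (PV _ _ homog_dW (homog_inverse_even homog_dW Wv vW) Wv vW PW).
have P1 : P 1 by rewrite -Wv; apply: PM.
have Ph1 : P h1%:S by rewrite -[h1%:S]mul1r -vW -mulrA; apply: PM.
have Pf1 : P f1%:S.
  rewrite -[f1%:S](subrK ((4^-1%:S * hpar ^+ 2) *: (e1 * (h1 ^+ 2 - 1))%:S)).
  apply: PD => //; apply: PZ; rewrite fpsCM fpsCD fpsCN expr2 fpsCM.
  by apply/PM/PB => //; apply/PM.
have Pe2 : P e2%:S.
  by rewrite -usl21_descendant fpsCD fpsCN !fpsCM; apply: PB; apply: PM.
have Ph2 : P h2%:S.
  apply: halve; have -> : h2%:S *+ 2 = (uZ k)%:S - h1%:S :> {fps U}.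
    by rewrite /uZ fpsCD fpsCMn addrC addKr.
  exact: PB.
elim/Usl21_ind => [[[]|[]|[]]|c|x y Px Py|x y Px Py] //.
- by rewrite fpsCZ; apply: PZ.
- by rewrite fpsCD; apply: PD.
- by rewrite fpsCM; apply: PM.
Qed.

Lemma homog_H1 : homogeneous false (dH1 k).
Proof. have hh : homogeneous false (ugen (gen_h node1) : U) by exact: ugen_homogeneous.
have hh' := homogC hh. have := (@homogM _ _ false false _ _ homog_dW hh'). by []. Qed.

Lemma homog_F1 : homogeneous false F.
Proof.
apply/homogB; first exact/homogC/ugen_homogeneous.
apply/homogZ/homogC; apply: (@homogM _ _ false false); first exact: ugen_homogeneous.
apply: homogB; last exact: homog1.
by rewrite expr2; apply: (@homogM _ _ false false); exact: ugen_homogeneous.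
Qed.

Lemma homog_Z : homogeneous false (Z : {fps U}).
Proof. by apply/homogC/homogD; [|apply: homogMn]; exact: ugen_homogeneous. Qed.

Lemma homog_E3 : homogeneous true E.
Proof.
have he1 : homogeneous false e1 by exact: ugen_homogeneous.
have he2 : homogeneous true (ugen (gen_e node2) : U) by exact: ugen_homogeneous.
apply/homogC/homogB; first exact: (@homogM _ _ false true _ _ he1 he2).
exact: (@homogM _ _ true false _ _ he2 he1).
Qed.

Lemma homog_F2 : homogeneous true G.
Proof. exact/homogC/(ugen_homogeneous k (gen_f node2)). Qed.

Lemma homog_T : homogeneous false T.
Proof. by apply: homogD; [apply: homogZ; exact: homog_e1 | exact: homog_dW]. Qed.

Lemma homog_TV : homogeneous false TV.
Proof. by apply: homogD; [apply: homogN; apply: homogZ; exact: homog_e1 | exact: homog_dW]. Qed.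

Lemma homog_Th : homogeneous false Th. Proof. exact/homog_sqrt/homog_T. Qed.

Lemma homog_TVh : homogeneous false TVh. Proof. exact/homog_sqrt/homog_TV. Qed.

Lemma dT_double : T *+ 2 = W + scaled_e k.
Proof. by rewrite -dTD -dTB [RHS]addrACA subrr addr0 mulr2n. Qed.

Lemma dTV_double : TV *+ 2 = W - scaled_e k.
Proof. by rewrite -dTD -dTB opprB [RHS]addrC [RHS]addrA subrK mulr2n. Qed.

(** The same universal property as [lift_deformed], stated for T and T^-1. *)
Lemma lift_values (C : algType k) (T' V' H' F' Z' E' G' e0 : {fps C}) :
  T' 0%N = 1 -> V' 0%N = 1 -> T' - V' = (eta *: e0) *+ 16 ->
  holds eta (env_of [:: 0; T' + V'; T' - V'; H' *+ 2; F'; Z'; (eta *: E') *+ 16; G'])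
    deformed_rels ->
  exists2 D : {fps U} -> {fps C}, alg_morphism D &
    [/\ D T = T', D TV = V', D (dH1 k) = H' & D F = F']
    /\ [/\ D Z = Z', D E = E' & D G = G'].
Proof.
move=> T0 V0 e0E rels.
have W0 : (T' + V') 0%N = 1 *+ 2 by rewrite fps_addE T0 V0 mulr2n.
have [D Dm [[DW De DH DF] [DZ DE DG]]] := lift_deformed W0 e0E rels.
have De' : D (scaled_e k) = T' - V'.
  by rewrite e0E /scaled_e (amorMn Dm) (amorZ Dm) De.
exists D => //; split; split=> //; apply: fps_mul2_inj; rewrite -(amorMn Dm).
- by rewrite dT_double (amorD Dm) DW De' addrACA subrr addr0 mulr2n.
- by rewrite dTV_double (amorB Dm) DW De' opprB addrC addrA subrK mulr2n.
- exact: DH.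
Qed.

(** Both E_3 and F_2 have weight 1 for h_1 and commute with e_1; this gives the
    correction terms of E_2 and of F_3 at once. *)
Lemma deformed_descendant (e h x : U) : h * x = x * h + x -> x * e = e * x ->
  e * (h ^+ 2 - 1) * x - x * (e * (h ^+ 2 - 1)) = e * x * (2%:R * h + 1).
Proof.
move=> hx xe; rewrite (mulrA x e) xe -(mulrA e x (_ - _)) -(mulrA e) -mulrBr -(mulrA e).
congr (e * _); rewrite mulrBl mulrBr mul1r mulr1 opprB addrA addrNK expr2.
rewrite -(mulrA h) hx (mulrDr h) (mulrA h) hx (mulrDl (x * h)) -(mulrA x).
by rewrite mulrDr mulr1 mulr_natl mulrnAr mulr2n addrC -!addrA addKr addrA.
Qed.

Lemma dE2E : dE2 k = F * E - E * F.
Proof.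
have d := usl21_data k.
have hE : h1 * ue3 k = ue3 k * h1 + ue3 k by rewrite (dat_Eh d) subrK.
rewrite /dE2 -(deformed_descendant hE (dat_Ee d)) -(usl21_descendant k).
rewrite /dF1 /dE3 (mulrBl (ue3 k)%:S) (mulrBr (ue3 k)%:S) -scalerAl -scalerAr -!fpsCM.
rewrite !(fpsCD, fpsCN) scalerBr !opprB [LHS]addrACA [RHS]addrACA.
by congr (_ + _); exact: addrC.
Qed.

Lemma dF3E : dF3 k = G * F - F * G.
Proof.
have d := usl21_data k.
have hG : h1 * f2 = f2 * h1 + f2 by rewrite (dat_Gh d) subrK.
rewrite /dF3 /uf3 -(deformed_descendant hG (dat_Ge d)).
rewrite /dF1 /dF2 (mulrBl f2%:S) (mulrBr f2%:S) -scalerAl -scalerAr -!fpsCM.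
rewrite !(fpsCD, fpsCN) scalerBr !opprB [LHS]addrACA [RHS]addrACA.
by congr (_ + _); exact: addrC.
Qed.

Lemma dH2E : dH2 k *+ 8 = Z *+ 4 - (T + TV) * H.
Proof.
have -> : (T + TV) * H = h1%:S *+ 4 + (hpar ^+ 2 *: (e1 ^+ 2 * h1)%:S) *+ 4.
  rewrite dTD mulrnAl mulrnAr -mulrnA /dH1 mulrA dWW mulrDl mul1r mulrnDl.
  by rewrite -scalerAl -fpsCM.
have -> : Z = h1%:S + h2%:S *+ 2 :> {fps U} by rewrite /uZ fpsCD fpsCMn.
rewrite (mulrnDl 4) opprD addrACA subrr add0r -mulrnA /dH2 mulrnBl -scalerA.
by congr (_ - _); rewrite -[8%N]/(2 * 4)%N mulrnA (fps_scale_natK 1).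
Qed.

Lemma dH3E : dH3 k = Z - dH2 k.
Proof.
rewrite /dH3 /dH2 opprB addrCA addrC /uh3 /uZ mulr2n !fpsCD addrA addrK.
by [].
Qed.

End Generation.

Theorem proposition3 (R : realType) :
  exists! H : hopf_ops (Usl21 R[i]),
  let Delta := comult H in
  let S := antipode H in
  let eps := counit H in
  let T := dT R[i] in let TV := dTV R[i] in
  let Th := dTh R[i] in let TVh := dTVh R[i] in
  let H1 := dH1 R[i] in let F1 := dF1 R[i] in
  let H2 := dH2 R[i] in let E2 := dE2 R[i] in let F2 := dF2 R[i] in
  let H3 := dH3 R[i] in let E3 := dE3 R[i] in let F3 := dF3 R[i] in
  let h : {fps R[i]} := hpar in
  let q : {fps R[i]} := 4^-1%:S in
  let r : {fps R[i]} := 2^-1%:S in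
  is_hopf_superalgebra H
  /\ [/\ Delta H1 = H1 *T T + TV *T H1,
         Delta T = T *T T,
         Delta TV = TV *T TV
       & Delta F1 = F1 *T T + TV *T F1]
  /\ [/\ S H1 = - (T * H1 * TV), S T = TV, S TV = T & S F1 = - (T * F1 * TV)]
  /\ [/\ eps H1 = 0, eps F1 = 0, eps T = 1 & eps TV = 1]
  /\ Delta E2 = E2 *T Th + TVh *T E2
                + (q * h) *: ((TV * E3) *T (TVh * H1 + H1 * TVh))
                - (q * h) *: ((Th * H1 + H1 * Th) *T (T * E3))
  /\ Delta F2 = F2 *T TVh + Th *T F2
  /\ Delta E3 = E3 *T TVh + Th *T E3
  /\ Delta F3 = F3 *T Th + TVh *T F3
                - (q * h) *: ((TV * F2) *T (TVh * H1 + H1 * TVh))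
                + (q * h) *: ((Th * H1 + H1 * Th) *T (T * F2))
  /\ Delta H2 = H2 *T 1 + 1 *T H2
                + q *: ((T * H1) *T (1 - T ^+ 2))
                + q *: ((1 - TV ^+ 2) *T (TV * H1))
  /\ Delta H3 = H3 *T 1 + 1 *T H3
                - q *: ((T * H1) *T (1 - T ^+ 2))
                - q *: ((1 - TV ^+ 2) *T (TV * H1))
  /\ S E2 = - E2 - (r * h) *: ((T + TV) * E3)
  /\ S F3 = - F3 + (r * h) *: ((T + TV) * F2)
  /\ S F2 = - F2
  /\ S E3 = - E3
  /\ S H2 = - H2 + r *: (TV ^+ 2 - 1)
  /\ S H3 = - H3 - r *: (TV ^+ 2 - 1)
  /\ [/\ eps H2 = 0, eps H3 = 0 & eps E2 = 0]
  /\ [/\ eps F2 = 0, eps E3 = 0 & eps F3 = 0].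
Proof.
have [tu ut] := dTh_TVh R[i].
have ii : 'i * 'i = -1 :> R[i] by rewrite -expr2 sqrCi.
have Te : dT R[i] - dTV R[i] = (fps_eta R[i] *: (ugen (gen_e node1))%:S) *+ 16 by exact: dTB.
have rules := root_relations R[i]; rewrite -dTD -dTB in rules.
exact: (deformed_hopf (dThK _) (dTVhK _) tu ut erefl erefl Te rules (homog_Th _) (homog_TVh _)
  (homog_H1 _) (homog_F1 _) (homog_Z _) (homog_E3 _) (homog_F2 _)
  (@generation R[i]) (@lift_values R[i]) ii (dE2E _) (dF3E _) (dH2E _) (dH3E _)).
Qed.
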